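(* Let $1\le p\le\infty$ (with $1/\infty=0$), let $\alpha>-1$, let $N\ge 0$ be an integer, and let $M_0,\dots,M_N\ge 0$. Let $\{c_{k,n}\}_{k=0}^n$, $n\in\mathbb{N}\cup\{0\}$, be a family of complex numbers with $|c_{n,n}|>0$, and let $T_n^{\alpha,S}(f)=\sum_{k=0}^n c_{k,n}\hat f(k)\,q_k$ be the associated operators, where $\{q_k\}$ are the orthonormal discrete Laguerre–Sobolev polynomials and $\hat f(k)=\langle f,q_k\rangle_S$. There exists a positive constant $C$, independent of $n$, such that for all $n\ge 1$ the following hold. (i) For $\alpha>-1/2$, with $q_0=\frac{4\alpha+4}{2\alpha+1}$ and $p_0$ given by $1/p_0+1/q_0=1$, $$\Vert T_n^{\alpha,S}\Vert_{[S_p^{\alpha}]}\ge C\,|c_{n,n}|\begin{cases} n^{\frac{2\alpha+2}{p}-\frac{2\alpha+3}{2}}, & \text{if } 1\le p<p_0,\\ (\log(n+1))^{\frac{2\alpha+1}{4\alpha+4}}, & \text{if } p=p_0 \text{ or } p=q_0,\\ n^{\frac{2\alpha+1}{2}-\frac{2\alpha+2}{p}}, & \text{if } q_0<p\le\infty.\end{cases}$$ (ii) For $\alpha>-2/p$ if $1\le p<\infty$ and $\alpha\ge 0$ if $p=\infty$, with $q_0=4$ and $p_0=4/3$, $$\Vert T_n^{\alpha,S}\Vert_{[S_p^{p\alpha/2}]}\ge C\,|c_{n,n}|\begin{cases} n^{\frac{2}{p}-\frac{3}{2}}, & \text{if } 1\le p<p_0,\\ (\log(n+1))^{\frac14}, &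 \text{if } p=p_0 \text{ or } p=q_0,\\ n^{\frac12-\frac2p}, & \text{if } q_0<p\le\infty.\end{cases}$$
   Context: For $\alpha>-1$, an integer $N\ge0$ and $M_0,\dots,M_N\ge0$, define the discrete Sobolev inner product $$\langle f,g\rangle_S=\frac{1}{\Gamma(\alpha+1)}\int_0^\infty f(x)g(x)x^\alpha e^{-x}\,dx+\sum_{j=0}^N M_j f^{(j)}(0)g^{(j)}(0).$$ Let $L_n^\alpha$ be the Laguerre polynomial of degree $n$, orthogonal on $[0,\infty)$ with respect to $\frac{1}{\Gamma(\alpha+1)}x^\alpha e^{-x}dx$ and normalized by $L_n^\alpha(0)=\binom{n+\alpha}{n}$. Let $Q_n$ be the polynomial of degree $n$ orthogonal with respect to $\langle\cdot,\cdot\rangle_S$ having the same leading coefficient as $L_n^\alpha$, and let $q_n=\langle Q_n,Q_n\rangle_S^{-1/2}Q_n$ (orthonormal polynomials). The symbol $\beta$ stands for either $\alpha$ or $p\alpha/2$. For $1\le p<\infty$, $\Vert f\Vert_{L_p(x^\beta dx)}^p=\int_0^\infty|f(x)e^{-x/2}|^p x^\beta dx$. For $p=\infty$, $\Vert f\Vert_{L_\infty(x^\beta dx)}$ means $\operatorname{ess\,sup}_{0<x<\infty}|f(x)e^{-x/2}|$ in the case $\beta=\alpha$, and $\operatorname{ess\,sup}_{0<x<\infty}|f(x)e^{-x/2}x^{\alpha/2}|$ in the case $\beta=p\alpha/2$. $S_p^\beta$ is the space of measurable functions $f$ on $[0,\infty)$ such that $f^{(k)}(0)$ exists for $k=0,\dots,N$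 and $\Vert f\Vert_{S_p^\beta}<\infty$, where for $1\le p<\infty$ $$\Vert f\Vert_{S_p^\beta}^p=\Vert f\Vert_{L_p(x^\beta dx)}^p+\sum_{j=0}^N M_j|f^{(j)}(0)|^p,$$ and for $p=\infty$ $$\Vert f\Vert_{S_\infty^\beta}=\max\{\Vert f\Vert_{L_\infty(x^\beta dx)},|f(0)|,\dots,|f^{(N)}(0)|\},$$ where $|f^{(j)}(0)|$ is omitted from the maximum whenever $M_j=0$. The operators $T_n^{\alpha,S}$ are regarded as operators from $S_p^\beta$ into itself, and $\Vert T\Vert_{[S_p^\beta]}=\sup_{0\ne f\in S_p^\beta}\Vert Tf\Vert_{S_p^\beta}/\Vert f\Vert_{S_p^\beta}$ is the usual operator norm. *)

(* Defs.v *)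
(* MathComp-Analysis, over an arbitrary [R : realType]; complex numbers are
   [R[i]] from mathcomp-real-closed. *)
From mathcomp Require Import all_boot all_order all_algebra.
From mathcomp Require Import complex.
From mathcomp Require Import all_classical all_reals all_analysis ess_sup_inf.
Set Implicit Arguments.
Unset Strict Implicit.
Unset Printing Implicit Defensive.
Import Order.TTheory GRing.Theory Num.Theory.
Import numFieldNormedType.Exports.
Import Normc.

Local Open Scope classical_set_scope.
Local Open Scope ring_scope.

(* Functions on [0, +oo[ are represented by total functions on R; every notion
   below depends only on their values on [0, +oo[. Derivatives are taken within
   [0, +oo[: two-sided at x > 0, one-sided at x = 0. *)

Definition diffquot_filter (R : realType) (x : R) : set_system R :=
  within [set h | 0 <= x + h] 0^'.

Definition hl_derivable (R : realType) (u : R -> R) (x : R) : Prop :=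
  cvg ((fun h => h^-1 * (u (x + h) - u x)) @ diffquot_filter x).

Definition hl_derive (R : realType) (u : R -> R) (x : R) : R :=
  lim ((fun h => h^-1 * (u (x + h) - u x)) @ diffquot_filter x).

Definition hl_deriven (R : realType) (k : nat) (u : R -> R) : R -> R :=
  iter k (@hl_derive R) u.

(* Existence of the k-th derivative at x: the (k-1)-st derivative exists on a
   neighbourhood of x in [0, +oo[ and is differentiable at x. *)
Fixpoint hl_nderivable (R : realType) (k : nat) (u : R -> R) (x : R) : Prop :=
  if k is k'.+1 then
    within [set y | 0 <= y] (nbhs x) [set y | hl_nderivable k' u y] /\
    hl_derivable (hl_deriven k' u) x
  else True.

Definition Re_fun (R : realType) (f : R -> R[i]) : R -> R :=
  fun x => complex.Re (f x).

Definition Im_fun (R : realType) (f : R -> R[i]) : R -> R :=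
  fun x => complex.Im (f x).

(* f^(k)(0) for a complex-valued f *)
Definition derivC0 (R : realType) (f : R -> R[i]) (k : nat) : R[i] :=
  (hl_deriven k (Re_fun f) 0 +i* hl_deriven k (Im_fun f) 0)%C.

(* Gamma (alpha + 1), for alpha > -1 *)
Definition Gamma1 (R : realType) (alpha : R) : R :=
  \int[lebesgue_measure]_(x in `]0, +oo[) (x `^ alpha * expR (- x)).

Definition laguerre_dot (R : realType) (alpha : R) (f g : R -> R) : R :=
  (Gamma1 alpha)^-1 *
  \int[lebesgue_measure]_(x in `]0, +oo[)
     (f x * g x * x `^ alpha * expR (- x)).

Definition sobolev_dot (R : realType) (alpha : R) (N : nat)
    (M : 'I_N.+1 -> R) (f g : R -> R) : R :=
  laguerre_dot alpha f g +
  \sum_(j < N.+1) M j * hl_deriven j f 0 * hl_deriven j g 0.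

Definition gbinom (R : realType) (x : R) (n : nat) : R :=
  (\prod_(i < n) (x - i%:R)) / n`!%:R.

Definition laguerre_polys (R : realType) (alpha : R) (L : nat -> {poly R})
    : Prop :=
  [/\ forall n, size (L n) = n.+1,
      forall m n, m != n -> laguerre_dot alpha (horner (L m)) (horner (L n)) = 0
    & forall n, (L n).[0] = gbinom (n%:R + alpha) n].

Definition sobolev_polys (R : realType) (alpha : R) (N : nat)
    (M : 'I_N.+1 -> R) (L Q : nat -> {poly R}) : Prop :=
  [/\ forall n, size (Q n) = n.+1,
      forall m n, m != n ->
        sobolev_dot alpha M (horner (Q m)) (horner (Q n)) = 0
    & forall n, lead_coef (Q n) = lead_coef (L n)].

Definition sobolev_orthonormal (R : realType) (alpha : R) (N : nat)
    (M : 'I_N.+1 -> R) (Q : nat -> {poly R}) (n : nat) : {poly R} :=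
  sobolev_dot alpha M (horner (Q n)) (horner (Q n)) `^ (- 2^-1) *: Q n.

(* <f, q_k>_S for complex-valued f, by complex linearity; q_k is real. *)
Definition fourier_coef (R : realType) (alpha : R) (N : nat)
    (M : 'I_N.+1 -> R) (q : nat -> {poly R}) (f : R -> R[i]) (k : nat) : R[i] :=
  (sobolev_dot alpha M (Re_fun f) (horner (q k)) +i*
   sobolev_dot alpha M (Im_fun f) (horner (q k)))%C.

Definition sobolev_op (R : realType) (alpha : R) (N : nat)
    (M : 'I_N.+1 -> R) (q : nat -> {poly R}) (c : nat -> nat -> R[i]) (n : nat)
    (f : R -> R[i]) : R -> R[i] :=
  fun x => \sum_(k < n.+1) c k n * fourier_coef alpha M q f k * ((q k).[x])%:C%C.

(* The symbol beta: [BetaAlpha] is beta = alpha, [BetaHalf] is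
   beta = p alpha / 2, kept symbolic so that it makes sense for p = +oo. *)
Inductive beta_choice := BetaAlpha | BetaHalf.

Definition Lp_norm (R : realType) (alpha : R) (b : beta_choice) (p : \bar R)
    (f : R -> R[i]) : \bar R :=
  match p with
  | r%:E =>
      let beta := if b is BetaAlpha then alpha else r * alpha / 2 in
      ((\int[lebesgue_measure]_(x in `]0%R, +oo[)
          ((normc (f x) * expR (- x / 2)) `^ r * x `^ beta)%:E) `^ r^-1)%E
  | +oo%E =>
      ess_sup (mrestr (@lebesgue_measure R) (measurable_itv `]0%R, +oo[))
        (fun x => (normc (f x) * expR (- x / 2) *
                   (if b is BetaAlpha then 1 else x `^ (alpha / 2)))%:E)
  | -oo%E => 0%E
  end.

Definition S_norm (R : realType) (alpha : R) (N : nat) (M : 'I_N.+1 -> R)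
    (b : beta_choice) (p : \bar R) (f : R -> R[i]) : \bar R :=
  match p with
  | r%:E =>
      ((Lp_norm alpha b p f `^ r +
        (\sum_(j < N.+1) M j * normc (derivC0 f j) `^ r)%:E) `^ r^-1)%E
  | +oo%E =>
      maxe (Lp_norm alpha b p f)
        (\big[maxe/0%E]_(j < N.+1 | M j != 0) (normc (derivC0 f j))%:E)
  | -oo%E => 0%E
  end.

Definition S_space (R : realType) (alpha : R) (N : nat) (M : 'I_N.+1 -> R)
    (b : beta_choice) (p : \bar R) : set (R -> R[i]) :=
  [set f | [/\ measurable_fun (`[0, +oo[ : set R) (Re_fun f) /\
               measurable_fun (`[0, +oo[ : set R) (Im_fun f),
               forall k, (k <= N)%N ->
                 hl_nderivable k (Re_fun f) 0 /\ hl_nderivable k (Im_fun f) 0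
             & (S_norm alpha M b p f < +oo)%E]].

(* Functions of norm 0 represent the zero element of the space. *)
Definition op_norm (R : realType) (alpha : R) (N : nat) (M : 'I_N.+1 -> R)
    (b : beta_choice) (p : \bar R) (T : (R -> R[i]) -> (R -> R[i])) : \bar R :=
  ereal_sup [set (S_norm alpha M b p (T f) / S_norm alpha M b p f)%E
            | f in [set f | S_space alpha M b p f /\
                            S_norm alpha M b p f != 0%E]].

(* Main.v *)
Require Import Defs.
From mathcomp Require Import all_boot all_order all_algebra.
From mathcomp Require Import complex.
From mathcomp Require Import all_classical all_reals all_analysis ess_sup_inf.
From mathcomp Require Import measurable_realfun ring lra zify.
Set Implicit Arguments.
Unset Strict Implicit.
Unset Printing Implicit Defensive.
Import Order.TTheory GRing.Theory Num.Theory.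
Import numFieldNormedType.Exports.
Import Normc.

Local Open Scope classical_set_scope.
Local Open Scope ring_scope.

(* Write [beta = e + p (alpha - e) / 2], where [e = alpha] or [e = 0]. Testing
   functions that vanish to order [> N] at 0 removes the derivative terms from
   both the norm and the inner product.

   For [p < 2] the test function is [x^J g], with [g] a combination of Laguerre
   polynomials [L_m^(alpha+J)], [|m - n| <= w K], whose coefficients are a bump
   at scale [K] with zeros that cancel all but the leading coefficient of [q_n]:
   orthogonality to [x^J P], [deg P < n - J], leaves [q_n] only its top [J + 1]
   coefficients in this basis. Summation by parts makes [g] concentrate near
   [x = n / K^2]; taking [K ~ n] gives the power rate, and averaging over
   [K = 2^k], [k <= log n], gives the logarithm at the critical exponent. The
   resulting norms are controlled by Hoelder from two weighted [L^2] norms, which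
   are explicit by orthogonality.

   The norm of [T_n f] is bounded below by duality with a function [G] supported
   on [1, 4 n + 1] that annihilates polynomials of degree [< n], so that only
   [c_{n,n}] and the leading coefficient of [q_n] enter. [G] is built from
   Chebyshev polynomials of the second kind and an approximation of
   [exp (- n z)] on the unit circle, which makes its size match [n!] up to
   constants by Stirling.

   For [p > 2] the roles are exchanged: [T_n G] is a multiple of [q_n], whose norm
   is estimated by duality with [x^J g]. *)

(** The obstacle is that [q_n] is known only through its orthogonality and its leading coefficient.
    The extremal property of [Q_n] bounds n! times that coefficient below by n^(-alpha/2), and this
    factor enters twice: once through the pairing of [q_n] with x^J g, once through its pairing with
    G. The function G, of weighted size e^n n^(-(alpha+e)/2), supplies n^(n+1), and Stirling turns
    what remains into a power of n.

    All estimates are made for a general e > -1, so both choices of beta follow from one argument.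
    Part (ii) is the case e = 0; the critical exponents are (4 e + 4) / (2 e + 3) and its conjugate
    (4 e + 4) / (2 e + 1).

    At the critical exponent r < 2 every dyadic K gives a test function of the same quality, living
    at its own scale x = n / 4^k. One Hoelder weight common to all scales costs a factor log n in
    the mass, while averaging about log n functions divides the squared norm by log n; together this
    leaves (log n)^(1/r - 1). *)

Lemma le_of_eq d (T : porderType d) (x y : T) : x = y -> (x <= y)%O.
Proof. by move=> ->. Qed.

Lemma powRD_gt0 (R : realType) (x a b : R) : 0 < x -> x `^ (a + b) = x `^ a * x `^ b.
Proof. by move=> x0; rewrite powRD// (gt_eqF x0) implybT. Qed.

Lemma measurable_powR_on (R : realType) (b : R) (D : set (measurableTypeR R)) :
  measurable_fun D (fun x : R => x `^ b).
Proof. by apply: (measurable_funS measurableT) => //; exact: measurable_powR. Qed.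

Lemma measurable_horner (R : realType) (P : {poly R}) (D : set (measurableTypeR R)) :
  measurable_fun D (horner P).
Proof.
apply: (measurable_funS measurableT) => //.
by apply: continuous_measurable_fun; exact: continuous_horner.
Qed.


Lemma FTC_itv (R : realType) (F f : R -> R) (a b : R) : a < b ->
  (forall x, a < x < b -> is_derive x 1 F (f x)) ->
  (forall x, a <= x <= b -> {for x, continuous F}) ->
  (forall x, a <= x <= b -> {for x, continuous f}) ->
  (\int[lebesgue_measure]_(x in `[a, b]) (f x)%:E)%E = (F b - F a)%:E.
Proof.
move=> ab dF cF cf.
have cw (g : R -> R) : (forall x, a <= x <= b -> {for x, continuous g}) ->
    {within `[a, b], continuous g}.
  by move=> cg; apply: continuous_subspace_itv => x; rewrite in_itv /=; exact: cg.
rewrite (@continuous_FTC2 R f F) ?EFinB//.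
- exact: cw.
- split.
  + by move=> x; rewrite in_itv /= => /dF ?; exact: ex_derive.
  + by apply: cvg_at_right_filter; apply: cF; rewrite lexx ltW.
  + by apply: cvg_at_left_filter; apply: cF; rewrite lexx ltW.
- by move=> x; rewrite in_itv /= => /dF ?; rewrite derive1E derive_val.
Qed.

(** * Gamma function and Laguerre polynomials *)

Definition egamma (R : realType) (a : R) : \bar R :=
  (\int[lebesgue_measure]_(x in `]0%R, +oo[) (x `^ a * expR (- x))%:E)%E.

Lemma is_derive_powR_expRN (R : realType) (b x : R) : 0 < x ->
  is_derive x 1 (fun t => t `^ b * expR (- t))
    (b * (x `^ (b - 1) * expR (- x)) - x `^ b * expR (- x)).
Proof.
move=> x0.
have h1 := is_derive1_powR b x0.
have h2 : is_derive x 1 (fun t : R => expR (- t)) (- expR (- x)).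
  have hN : is_derive x (1 : R) (fun t : R => - t) (- 1) by exact: is_deriveN.
  by have := is_derive1_comp (is_derive_expR (- x)) hN; rewrite mulrN1.
apply: is_derive_eq.
rewrite /GRing.scale /=; ring.
Qed.

Lemma continuous_powR_expRN (R : realType) (b x : R) : 0 < x ->
  {for x, continuous (fun t : R => t `^ b * expR (- t))}.
Proof.
move=> x0; have h := is_derive_powR_expRN b x0.
by apply/differentiable_continuous/derivable1_diffP; exact: ex_derive.
Qed.

Lemma powR_expRN_le (R : realType) (b : R) : exists2 C : R, 0 < C &
  forall x : R, 1 <= x -> x `^ b * expR (- x) <= C / x.
Proof.
have [m hm] : exists m : nat, b <= m%:R.
  exists (Num.Def.archi_bound `|b|).
  by rewrite (le_trans (ler_norm b))// ltW// archi_boundP.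
exists (m.+1)`!%:R; first by rewrite ltr0n fact_gt0.
move=> x x1; have x0 : 0 < x by exact: lt_le_trans x1.
have h : x ^+ m.+1 / (m.+1)`!%:R <= expR x.
  by apply: (le_trans _ (expR_ge1Dxn m (ltW x0))); rewrite lerDr.
have f0 : 0 < (m.+1)`!%:R :> R by rewrite ltr0n fact_gt0.
rewrite ler_pdivrMr// in h.
rewrite expRN ler_pdivrMr ?expR_gt0// mulrAC ler_pdivlMr//.
apply: le_trans (_ : x ^+ m.+1 <= _); last by rewrite mulrC.
rewrite exprSr ler_wpM2r ?(ltW x0)//.
by rewrite -powR_mulrn ?(ltW x0)// ler_powR.
Qed.

Lemma measurable_powR_expRN (R : realType) (a : R) (D : set (measurableTypeR R)) :
  measurable_fun D (fun x : R => x `^ a * expR (- x)).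
Proof.
apply: (measurable_funS measurableT) => //.
apply: measurable_funM; first exact: measurable_powR.
exact: measurableT_comp.
Qed.

Lemma powR_expRN_ge0 (R : realType) (a x : R) : (0 <= (x `^ a * expR (- x))%:E)%E.
Proof. by rewrite lee_fin mulr_ge0 ?powR_ge0 ?expR_ge0. Qed.

Lemma egamma_ge0 (R : realType) (a : R) : (0 <= egamma a)%E.
Proof. by apply: integral_ge0 => x _; exact: powR_expRN_ge0. Qed.

(** Compact exhaustion of the open half-line: x^a may be singular at 0, so integration by parts is
    done on these intervals. The shift [k.+2] keeps the two endpoints distinct. *)
Definition exhaust_itv (R : realType) (k : nat) : set R :=
  `[(k.+2%:R)^-1, k.+2%:R].

Lemma exhaust_itv_nd (R : realType) : nondecreasing_seq (@exhaust_itv R).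
Proof.
move=> m n mn; rewrite subsetEset => x; rewrite /exhaust_itv /= !in_itv /=.
move=> /andP[h1 h2]; apply/andP; split.
  by apply: le_trans h1; rewrite lef_pV2 ?posrE ?ltr0n// ler_nat.
by apply: le_trans h2 _; rewrite ler_nat.
Qed.

Lemma exhaust_itv_bigcup (R : realType) :
  \bigcup_k @exhaust_itv R k = `]0, +oo[%classic.
Proof.
apply/seteqP; split => x /=.
  move=> [k _]; rewrite /exhaust_itv /= !in_itv /= => /andP[h _].
  by rewrite andbT; apply: lt_le_trans h; rewrite invr_gt0 ltr0n.
rewrite in_itv /= andbT => x0.
pose m := Num.Def.archi_bound x; pose n := Num.Def.archi_bound x^-1.
exists (m + n)%N => //; rewrite /exhaust_itv /= in_itv /=.
have hm : x < m%:R by apply: archi_boundP; exact: ltW.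
have hn : x^-1 < n%:R by apply: archi_boundP; rewrite invr_ge0 ltW.
apply/andP; split.
  rewrite -[leRHS]invrK lef_pV2 ?posrE ?invr_gt0 ?ltr0n// (le_trans (ltW hn))//.
  by rewrite ler_nat; lia.
by rewrite (le_trans (ltW hm))// ler_nat; lia.
Qed.

Lemma egamma_cvg (R : realType) (a : R) :
  (\int[lebesgue_measure]_(x in @exhaust_itv R k) (x `^ a * expR (- x))%:E)%E
    @[k --> \oo] --> egamma a.
Proof.
rewrite /egamma -(@exhaust_itv_bigcup R).
apply: (@ge0_nondecreasing_set_cvg_integral _ (measurableTypeR R) R (@exhaust_itv R)
  (fun x : R => (x `^ a * expR (- x))%:E) lebesgue_measure (@exhaust_itv_nd R)).
- by move=> k; exact: measurable_itv.
- by move=> k; apply/measurable_EFinP; exact: measurable_powR_expRN.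
- by move=> k x _; exact: powR_expRN_ge0.
Qed.

Lemma integrable_powR_expRN_itv (R : realType) (a u v : R) : 0 < u ->
  lebesgue_measure.-integrable `[u, v] (fun x : R => (x `^ a * expR (- x))%:E).
Proof.
move=> u0.
apply: (@continuous_compact_integrable R (fun x : R => x `^ a * expR (- x))).
  exact: segment_compact.
apply: continuous_subspace_itv => x; rewrite in_itv /= => /andP[h _].
by apply: continuous_powR_expRN; exact: lt_le_trans h.
Qed.

(** Integration by parts along the exhaustion; the boundary term at 0 vanishes because a + 1 > 0.
    The identity is stated in the extended reals because the finiteness of [egamma] is deduced from
    it. *)
Lemma egamma_rec (R : realType) (a : R) : -1 < a ->
  ((a + 1)%:E * egamma a = egamma (a + 1)%R)%E.
Proof.
move=> a1.
pose F x : R := x `^ (a + 1) * expR (- x).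
pose J (b : R) (k : nat) : \bar R := (\int[lebesgue_measure]_(x in @exhaust_itv R k)
  (x `^ b * expR (- x))%:E)%E.
have mE k : measurable (@exhaust_itv R k : set (measurableTypeR R)) by exact: measurable_itv.
have hb b k : lebesgue_measure.-integrable (@exhaust_itv R k)
    (fun x : R => (x `^ b * expR (- x))%:E).
  by apply: integrable_powR_expRN_itv; rewrite invr_gt0 ltr0n.
have hI k : ((a + 1)%:E * J a k - J (a + 1)%R k =
    (F k.+2%:R - F (k.+2%:R)^-1)%:E)%E.
  have u0 : 0 < (k.+2%:R)^-1 :> R by rewrite invr_gt0 ltr0n.
  have h1 : lebesgue_measure.-integrable (@exhaust_itv R k)
    (EFin \o (fun x : R => (a + 1) * (x `^ a * expR (- x)))).
    rewrite (_ : _ \o _ = fun x : R => ((a + 1)%:E * (x `^ a * expR (- x))%:E)%E).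
      exact: (integrableZl (mE k) (a + 1) (hb a k)).
    by apply/funext => x; rewrite /= EFinM.
  rewrite /J -integralZl//=.
  rewrite -(integralB_EFin (mE k) h1 (hb (a + 1) k)).
  under eq_integral do rewrite -EFinB.
  rewrite /exhaust_itv; apply: (@FTC_itv R F).
  - have k1 : 1 < k.+2%:R :> R by rewrite ltr1n.
    by apply: lt_trans k1; rewrite invf_lt1 ?ltr0n// ltr1n.
  - move=> x /andP[h _]; have x0 := lt_trans u0 h.
    by have := is_derive_powR_expRN (a + 1) x0; rewrite addrK.
  - move=> x /andP[h _]; have x0 := lt_le_trans u0 h.
    exact: continuous_powR_expRN.
  - move=> x /andP[h _]; have x0 := lt_le_trans u0 h.
    apply: continuousB; last exact: continuous_powR_expRN.
    by apply: continuousM; [exact: cst_continuous|exact: continuous_powR_expRN].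
have [C C0 hC] := powR_expRN_le (a + 1).
have Foo : (F (k.+2%:R) @[k --> \oo] --> (0 : R)).
  apply: (@squeeze_cvgr _ _ _ _ (fun=> 0) (fun k => C * harmonic k)).
  - near=> k; rewrite /F mulr_ge0 ?powR_ge0 ?expR_ge0//=.
    apply: le_trans (hC _ _) _; first by rewrite ler1n.
    by rewrite ler_pM2l// lef_pV2 ?posrE ?ltr0n// ler_nat.
  - exact: cvg_cst.
  - by rewrite -[X in _ --> X](mulr0 C); apply: cvgMr; exact: cvg_harmonic.
have F0 : (F ((k.+2%:R)^-1) @[k --> \oo] --> (0 : R)).
  apply: (@squeeze_cvgr _ _ _ _ (fun=> 0) (fun k => (harmonic k) `^ (a + 1))).
  - near=> k; rewrite /F mulr_ge0 ?powR_ge0 ?expR_ge0//=.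
    apply: le_trans (_ : (k.+2%:R)^-1 `^ (a + 1) <= _).
      rewrite ler_piMr ?powR_ge0// -expR0 ler_expR oppr_le0 invr_ge0//.
    apply: ge0_ler_powR; rewrite ?nnegrE ?invr_ge0 ?harmonic_ge0//.
      lra.
    by rewrite /harmonic /= lef_pV2 ?posrE ?ltr0n// ler_nat.
  - exact: cvg_cst.
  - have /cvg_at_rightP := @powR_cvg0 R (a + 1) ltac:(lra); apply; split.
      by move=> n; rewrite /harmonic /= invr_gt0 ltr0n.
    exact: cvg_harmonic.
have fI b k : J b k \is a fin_num.
  exact: (integrable_fin_num (mE k) (hb b k)).
have e k : ((a + 1)%:E * J a k = J (a + 1)%R k + (F k.+2%:R - F (k.+2%:R)^-1)%:E)%E.
  by rewrite -hI addeC subeK// fin_numM.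
have c1 : ((a + 1)%:E * J a k)%E @[k --> \oo] --> ((a + 1)%:E * egamma a)%E.
  by apply: cvgeZl => //; exact: egamma_cvg.
have c2 : (J (a + 1)%R k + (F k.+2%:R - F (k.+2%:R)^-1)%:E)%E @[k --> \oo] -->
    (egamma (a + 1)%R + 0)%E.
  apply: cvgeD; [by rewrite fin_num_adde_defl|exact: egamma_cvg|].
  apply: cvg_EFin; first by near=> k.
  by rewrite -[X in _ --> X](subr0 (0 : R)); apply: cvgB.
rewrite adde0 in c2; apply: (cvg_unique _ _ c2) => //.
by move: c1; under eq_fun do rewrite e.
Unshelve. all: by end_near. Qed.

Lemma egamma0_fin (R : realType) : egamma (0 : R) \is a fin_num.
Proof.
rewrite /egamma (eq_integral (fun x : measurableTypeR R => (expR (- x))%:E)); last first.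
  by move=> x _; rewrite powRr0 mul1r.
rewrite integral_itv_obnd_cbnd; last first.
  by apply/measurable_EFinP; apply: (measurable_funS measurableT) => //; apply: measurableT_comp.
rewrite (@ge0_continuous_FTC2y _ _ (fun x => - expR (- x)) 0 0)//.
- apply: continuous_subspaceT => x.
  by apply: continuous_comp; [exact: opp_continuous|exact: continuous_expR].
- by rewrite -[X in _ --> X]oppr0; apply: cvgN; exact: cvgr_expR.
- apply: cvg_at_right_filter; apply: cvgN.
  by apply: continuous_comp; [exact: opp_continuous|exact: continuous_expR].
- move=> x _; rewrite derive1E.
  have hN : is_derive x (1 : R) (fun t : R => - t) (- 1) by exact: is_deriveN.
  have h := is_derive1_comp (is_derive_expR (- x)) hN.
  have h2 : is_derive x (1 : R) (fun t : R => - expR (- t)) (- (expR (- x) * -1)).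
    exact: is_deriveN.
  by rewrite derive_val mulrN1 opprK.
Qed.

Lemma egamma_nat_fin (R : realType) (m : nat) : egamma (m%:R : R) \is a fin_num.
Proof.
elim: m => [|m IH]; first exact: egamma0_fin.
rewrite -natr1 -egamma_rec ?fin_numM//.
by rewrite (@lt_le_trans _ _ 0)// ltrN10.
Qed.

(** For b >= 0, x^b is at most x^m + 1 with an integer m >= b. For negative a the recursion is read
    backwards: an infinite [egamma a] would make [egamma (a + 1)] infinite. *)
Lemma egamma_fin (R : realType) (a : R) : -1 < a -> egamma a \is a fin_num.
Proof.
have hpos (b : R) : 0 <= b -> egamma b \is a fin_num.
  move=> b0; pose m := Num.Def.archi_bound b.
  have bm : b <= m%:R by rewrite ltW// archi_boundP.
  rewrite ge0_fin_numE ?egamma_ge0//.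
  apply: (@le_lt_trans _ _ (egamma m%:R + egamma 0)%E); last first.
    have h1 := egamma_nat_fin R m; have h2 := egamma0_fin R.
    rewrite ge0_fin_numE ?egamma_ge0// in h1; rewrite ge0_fin_numE ?egamma_ge0// in h2.
    exact: lte_add_pinfty.
  rewrite /egamma -ge0_integralD//.
  - apply: ge0_le_integral => //.
    + by move=> x _; exact: powR_expRN_ge0.
    + by apply/measurable_EFinP; exact: measurable_powR_expRN.
    + by apply: emeasurable_funD; apply/measurable_EFinP; exact: measurable_powR_expRN.
    + move=> x; rewrite /= in_itv/= andbT => x0.
      rewrite -EFinD lee_fin -mulrDl ler_wpM2r ?expR_ge0// powRr0.
      have [x1|x1] := leP x 1.
        rewrite (@le_trans _ _ 1) ?lerDr ?powR_ge0//.
        by rewrite -(powRr0 x) ger_powR// x0 x1.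
      by rewrite (@le_trans _ _ (x `^ m%:R)) ?lerDl// ler_powR// ltW.
  - by move=> x _; exact: powR_expRN_ge0.
  - by apply/measurable_EFinP; exact: measurable_powR_expRN.
  - by move=> x _; exact: powR_expRN_ge0.
  - by apply/measurable_EFinP; exact: measurable_powR_expRN.
move=> a1; have a0 : 0 < a + 1 by rewrite -ltrBlDr sub0r.
have := hpos (a + 1) (ltW a0); rewrite -egamma_rec//.
rewrite !ge0_fin_numE ?egamma_ge0 ?mule_ge0 ?egamma_ge0 ?lee_fin ?(ltW a0)//.
move=> h; rewrite ltNge leye_eq; apply/eqP => e.
by move: h; rewrite e gt0_muley ?lte_fin// ltxx.
Qed.

Lemma integrable_powR_expRN (R : realType) (a : R) : -1 < a ->
  lebesgue_measure.-integrable `]0, +oo[ (fun x : R => (x `^ a * expR (- x))%:E).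
Proof.
move=> a1; apply/integrableP; split.
  by apply/measurable_EFinP; exact: measurable_powR_expRN.
rewrite (eq_integral (fun x : measurableTypeR R => (x `^ a * expR (- x))%:E)); last first.
  by move=> x _; rewrite gee0_abs// powR_expRN_ge0.
by have := egamma_fin a1; rewrite ge0_fin_numE// egamma_ge0.
Qed.

Lemma Gamma1E (R : realType) (a : R) : -1 < a -> (Gamma1 a)%:E = egamma a.
Proof. by move=> a1; rewrite /Gamma1 /Rintegral fineK ?egamma_fin. Qed.

Lemma Gamma1_rec (R : realType) (a : R) : -1 < a ->
  Gamma1 (a + 1) = (a + 1) * Gamma1 a.
Proof.
move=> a1; apply: EFin_inj; rewrite EFinM !Gamma1E ?egamma_rec//.
by rewrite (@lt_trans _ _ 0) ?ltrN10// -ltrBlDr sub0r.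
Qed.
Lemma integrable_poly (R : realType) (a : R) (P : {poly R}) : -1 < a ->
  lebesgue_measure.-integrable `]0, +oo[
    (fun x : R => (P.[x] * (x `^ a * expR (- x)))%:E).
Proof.
elim/poly_ind: P a => [|P c IH] a a1.
  apply: (eq_integrable _ (fun=> 0%E)) => //; last exact: integrable0.
  by move=> x _; rewrite horner0 mul0r.
have a2 : -1 < a + 1 by rewrite (lt_trans a1)// ltrDl.
have h : lebesgue_measure.-integrable `]0, +oo[ (fun x : R =>
    ((P.[x] * (x `^ (a + 1) * expR (- x)))%:E +
     c%:E * (x `^ a * expR (- x))%:E)%E).
  by apply: integrableD => //; [exact: IH|apply: integrableZl => //; exact: integrable_powR_expRN].
apply: eq_integrable h => // x; rewrite inE /= in_itv /= andbT => x0.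
rewrite -EFinM -EFinD hornerMXaddC; congr (_%:E).
by rewrite (powRD_gt0 _ _ x0)// powRr1 ?(ltW x0)//; ring.
Qed.

Definition Lint (R : realType) (a : R) (P : {poly R}) : R :=
  \int[lebesgue_measure]_(x in `]0, +oo[) (P.[x] * (x `^ a * expR (- x))).

Section Lint.
Variables (R : realType) (a : R).
Hypothesis a1 : -1 < a.
Implicit Types (P Q : {poly R}).

Let mpos : measurable (`]0, +oo[%classic : set (measurableTypeR R)).
Proof. exact: measurable_itv. Qed.

Lemma LintD P Q : Lint a (P + Q) = Lint a P + Lint a Q.
Proof.
rewrite /Lint -RintegralD//; try exact: integrable_poly.
by apply: eq_Rintegral => x _; rewrite hornerD mulrDl.
Qed.

Lemma LintZ c P : Lint a (c *: P) = c * Lint a P.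
Proof.
rewrite /Lint -RintegralZl//; last exact: integrable_poly.
by apply: eq_Rintegral => x _; rewrite hornerZ -mulrA.
Qed.

Lemma Lint0 : Lint a 0 = 0.
Proof. by rewrite -(scale0r 0) LintZ mul0r. Qed.

Lemma LintN P : Lint a (- P) = - Lint a P.
Proof. by rewrite -scaleN1r LintZ mulN1r. Qed.

Lemma LintB P Q : Lint a (P - Q) = Lint a P - Lint a Q.
Proof. by rewrite LintD LintN. Qed.

Lemma Lint_sum (I : Type) (r : seq I) (p : pred I) (F : I -> {poly R}) :
  Lint a (\sum_(i <- r | p i) F i) = \sum_(i <- r | p i) Lint a (F i).
Proof. by apply: (big_morph (Lint a)); [exact: LintD|exact: Lint0]. Qed.

Lemma Lint_ge0 P : (forall x, 0 < x -> 0 <= P.[x]) -> 0 <= Lint a P.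
Proof.
move=> P0; apply: Rintegral_ge0 => x /=; rewrite in_itv /= andbT => x0.
by rewrite mulr_ge0 ?P0// mulr_ge0 ?powR_ge0 ?expR_ge0.
Qed.

Lemma Lint1 : Lint a 1 = Gamma1 a.
Proof. by apply: eq_Rintegral => x _; rewrite hornerC mul1r. Qed.

End Lint.

(** This is how the factor X^J of the test functions moves the whole analysis from the parameter
    alpha to alpha + J. *)
Lemma LintXn (R : realType) (a : R) (k : nat) (P : {poly R}) :
  Lint a ('X^k * P) = Lint (a + k%:R) P.
Proof.
apply: eq_Rintegral => x; rewrite inE /= in_itv /= andbT => x0.
rewrite hornerM hornerXn (powRD_gt0 _ _ x0)//.
by rewrite powR_mulrn ?(ltW x0)//; ring.
Qed.

Lemma mulrS_binE (R : comRingType) (k n : nat) :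
  n.+1%:R * 'C(k, n.+1)%:R = (k%:R - n%:R) * 'C(k, n)%:R :> R.
Proof.
have [nk|kn] := leqP n k.
  by rewrite -natrM mul_bin_left natrM natrB.
by rewrite !bin_small ?mulr0// (leq_trans kn).
Qed.

(** Two consecutive Laguerre polynomials are carried along so that the three-term recurrence becomes
    structural. *)
Fixpoint lag2 (R : realType) (a : R) (n : nat) : {poly R} * {poly R} :=
  if n is m.+1 then
    let: (p, q) := lag2 a m in
    (q, (m.+2%:R)^-1 *: (((2 * m.+1)%:R + 1 + a) *: q - 'X * q - (m.+1%:R + a) *: p))
  else (1, (1 + a)%:P - 'X).

Definition lag (R : realType) (a : R) (n : nat) := (lag2 a n).1.

Section Laguerre.
Variables (R : realType) (a : R).
Local Notation l := (lag a).

Lemma lag_0 : l 0 = 1. Proof. by []. Qed.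

Lemma lag_1 : l 1 = (1 + a)%:P - 'X. Proof. by []. Qed.

Lemma lag_SS n : l n.+2 = (n.+2%:R)^-1 *:
  (((2 * n.+1)%:R + 1 + a) *: l n.+1 - 'X * l n.+1 - (n.+1%:R + a) *: l n).
Proof. by rewrite /lag /=; case: (lag2 a n). Qed.

Lemma lag_rec n : 'X * l n = ((2 * n)%:R + 1 + a) *: l n - n.+1%:R *: l n.+1
  - (if n is m.+1 then (n%:R + a) *: l m else 0).
Proof.
case: n => [|n].
  by rewrite lag_0 lag_1 muln0 add0r mulr1 subr0 scale1r opprB alg_polyC addrCA subrr addr0.
rewrite lag_SS scalerA divff ?pnatr_eq0// scale1r.
by move: (((2 * n.+1)%:R + 1 + a) *: l n.+1) ('X * l n.+1) ((n.+1%:R + a) *: l n) => u v w; ring.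
Qed.

Lemma size_lag n : size (l n) = n.+1 /\ lead_coef (l n) = (-1) ^+ n / n`!%:R.
Proof.
suff: (size (l n) = n.+1 /\ lead_coef (l n) = (-1) ^+ n / n`!%:R) /\
  (size (l n.+1) = n.+2 /\ lead_coef (l n.+1) = (-1) ^+ n.+1 / n.+1`!%:R).
  by case.
elim: n => [|n [h1 [h2 h3]]].
  rewrite lag_0 lag_1 size_poly1 lead_coef1 expr0 fact0 divr1.
  rewrite -opprB size_polyN size_XsubC lead_coefN lead_coefXsubC.
  by rewrite expr1 [1`!]/= divr1.
split=> //.
have ln0 : l n.+1 != 0 by rewrite -size_poly_gt0 h2.
have sX : size ('X * l n.+1) = n.+3 by rewrite mulrC size_mulX// h2.
have e : l n.+2 = (n.+2%:R)^-1 *: (- ('X * l n.+1) +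
   (((2 * n.+1)%:R + 1 + a) *: l n.+1 - (n.+1%:R + a) *: l n)).
  by rewrite lag_SS addrAC addrC.
have sl : (size (((2 * n.+1)%:R + 1 + a) *: l n.+1 - (n.+1%:R + a) *: l n)%R <
    size (- ('X * l n.+1))%R)%N.
  rewrite size_polyN sX (leq_ltn_trans (size_polyD _ _))// size_polyN gtn_max.
  apply/andP; split; apply: leq_ltn_trans (size_scale_leq _ _) _; rewrite ?h2//.
  by rewrite h1.1.
have i0 : (n.+2%:R)^-1 != 0 :> R by rewrite invr_eq0 pnatr_eq0.
split; first by rewrite e size_scale// size_polyDl// size_polyN sX.
rewrite e lead_coefZ lead_coefDl// lead_coefN ['X * _]mulrC lead_coefMX h3.
by rewrite [n.+2`!]factS natrM invfM [in RHS]exprS; ring.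
Qed.

Lemma horner0_lag n : (l n).[0] = (\prod_(i < n) (a + i.+1%:R)) / n`!%:R.
Proof.
suff: (l n).[0] = (\prod_(i < n) (a + i.+1%:R)) / n`!%:R /\
  (l n.+1).[0] = (\prod_(i < n.+1) (a + i.+1%:R)) / n.+1`!%:R by case.
elim: n => [|n [h1 h2]].
  rewrite lag_0 lag_1 big_ord0 big_ord_recl big_ord0 hornerC !hornerE.
  by split; [rewrite fact0 invr1|rewrite (_ : 1`! = 1%N)// invr1 mulr1 subr0 addrC].
split=> //; rewrite lag_SS hornerZ !hornerE h1 h2.
rewrite [in RHS]big_ord_recr /= big_ord_recr /= [n.+2`!]factS [n.+1`!]factS !natrM.
have f0 : n`!%:R != 0 :> R by rewrite pnatr_eq0 -lt0n fact_gt0.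
have n1 : 0 < 1 + n%:R :> R by rewrite -[1]/(1%:R) -natrD ltr0n.
have n2 : 0 < 2 + n%:R :> R by rewrite -natrD ltr0n.
rewrite -!natr1; field; rewrite f0 /=; apply/andP; split; apply: lt0r_neq0; lra.
Qed.

Hypothesis a1 : -1 < a.

Lemma gtN1_addn k : -1 < a + k%:R.
Proof. by rewrite (lt_le_trans a1)// lerDl. Qed.

(** The binomial coefficient encodes orthogonality, since it vanishes for k < n. The induction
    treats two consecutive n at once, for all k, because the recurrence multiplies by X. *)
Lemma Lint_Xn_lag k n :
  Lint a ('X^k * l n) = (-1) ^+ n * 'C(k, n)%:R * Gamma1 (a + k%:R).
Proof.
have aux k' : Gamma1 (a + k'.+1%:R) = (a + k'%:R + 1) * Gamma1 (a + k'%:R).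
  by rewrite -natr1 addrA Gamma1_rec// gtN1_addn.
have base k' : Lint a 'X^k' = Gamma1 (a + k'%:R).
  by rewrite -[X in Lint _ X]mulr1 LintXn Lint1.
suff: forall k, Lint a ('X^k * l n) = (-1) ^+ n * 'C(k, n)%:R * Gamma1 (a + k%:R) /\
  Lint a ('X^k * l n.+1) = (-1) ^+ n.+1 * 'C(k, n.+1)%:R * Gamma1 (a + k%:R).
  by move=> /(_ k)[].
elim: n => [|n IH] {}k.
  rewrite lag_0 lag_1 mulr1 bin0 expr0 !mul1r base; split=> //.
  rewrite mulrBr -exprSr (LintB a1) mulrC mul_polyC (LintZ a1) !base aux bin1.
  by rewrite expr1; ring.
have [h1 h2] := IH k; have [h3 h4] := IH k.+1.
split=> //; rewrite lag_SS -scalerAr (LintZ a1) !mulrBr !(LintB a1) mulrA -exprSr.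
rewrite -!scalerAr !(LintZ a1) h1 h2 h4 aux.
apply: (@mulfI _ n.+2%:R); first by rewrite pnatr_eq0.
rewrite mulVKf ?pnatr_eq0//.
have e1 := @mulrS_binE R k n; have e2 := @mulrS_binE R k n.+1.
rewrite binS natrD.
have -> : n.+2%:R * ((-1) ^+ n.+2 * 'C(k, n.+2)%:R * Gamma1 (a + k%:R)) =
  (-1) ^+ n * (n.+2%:R * 'C(k, n.+2)%:R) * Gamma1 (a + k%:R).
  by rewrite !exprS; ring.
rewrite e2 !exprS.
have -> : (-1) ^+ n * ((k%:R - n.+1%:R) * 'C(k, n.+1)%:R) * Gamma1 (a + k%:R)
  = (-1) ^+ n * Gamma1 (a + k%:R) * ((k%:R - 2 * n.+1%:R) * 'C(k, n.+1)%:R +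
    n.+1%:R * 'C(k, n.+1)%:R) by ring.
by rewrite e1 natrM -!natr1; ring.
Qed.

Lemma Lint_lagl n (P : {poly R}) : (size P <= n.+1)%N ->
  Lint a (P * l n) = (-1) ^+ n * P`_n * Gamma1 (a + n%:R).
Proof.
move=> sP; rewrite -[in LHS](coefK P) poly_def mulr_suml (Lint_sum a1).
under eq_bigr do rewrite -scalerAl (LintZ a1) Lint_Xn_lag.
have [sn|sn] := ltnP n (size P).
  rewrite (bigD1 (Ordinal sn))//= binn mulr1 big1 ?addr0; first by ring.
  move=> i /eqP ni; rewrite bin_small ?mulr0 ?mul0r ?mulr0//.
  have := ltn_ord i; rewrite leq_eqVlt in sP; move=> hi.
  rewrite ltn_neqAle -ltnS (leq_trans hi) ?andbT; last by case/orP: sP => [/eqP ->//|/ltnW].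
  by apply/eqP => e; apply: ni; apply: val_inj.
rewrite nth_default// mulr0 mul0r big1// => i _.
by rewrite bin_small ?mulr0 ?mul0r ?mulr0// (leq_trans (ltn_ord i)).
Qed.

(** Squared norm of [lag a n] in the weight x^a exp(-x), that is Gamma(a + n + 1) / n!. *)
Definition lagn n := Gamma1 (a + n%:R) / n`!%:R.

Lemma Lint_lag_lag m n : Lint a (l m * l n) = if m == n then lagn n else 0.
Proof.
wlog mn : m n / (m <= n)%N.
  move=> h; have [/h//|/ltnW /h e] := leqP m n.
  by rewrite mulrC e eq_sym; case: eqP => // ->.
rewrite Lint_lagl ?(size_lag m).1//.
case: eqP => [->|/eqP nmn]; last by rewrite nth_default ?mulr0 ?mul0r// (size_lag m).1 ltn_neqAle nmn.
have [s c] := size_lag n; rewrite lead_coefE s /= in c; rewrite c /lagn.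
by rewrite mulrA -exprD addnn -mul2n exprM sqrrN expr1n expr1n mul1r mulrC.
Qed.

End Laguerre.
(** * Derivatives on the half-line and the Sobolev form *)

Lemma diffquot_filter_proper (R : realType) (x : R) : 0 <= x ->
  ProperFilter (diffquot_filter x).
Proof.
move=> x0; apply: Build_ProperFilter.
move=> [e /= e0 he].
have e2 : 0 < e / 2 by rewrite divr_gt0.
apply: (he (e / 2)) => /=.
- by rewrite sub0r normrN gtr0_norm// ltr_pdivrMr// ltr_pMr// ltr1n.
- by rewrite gt_eqF.
- by rewrite addr_ge0// ltW.
Qed.

(** Agreement with a polynomial on [0, d) covers both kinds of test function: polynomials, and
    [bulk_fun], which is 0 on [0, 1). *)
Lemma diffquot_poly_cvg (R : realType) (P : {poly R}) (u : R -> R) (d x : R) :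
  (forall y, 0 <= y < d -> u y = P.[y]) -> 0 <= x < d ->
  h^-1 * (u (x + h) - u x) @[h --> diffquot_filter x] --> P^`().[x].
Proof.
move=> uP /andP[x0 xd].
have hP : is_derive x (1 : R) (horner P) P^`().[x] by exact: is_derive_poly.
have c1 : h^-1 * (P.[x + h] - P.[x]) @[h --> diffquot_filter x] --> P^`().[x].
  have dP : derivable (horner P) x 1 by exact: ex_derive.
  have := @derive_val _ _ _ _ _ _ _ hP; rewrite /derive => <-.
  apply: cvg_trans dP; apply: cvg_trans; last first.
    exact: (cvg_app _ (@cvg_within _ 0^' _ [set h | 0 <= x + h])).
  apply: near_eq_cvg; apply: nearW => h /=.
  by rewrite (_ : h%:A + x = x + h)// addrC; congr (_ + _); exact: mulr1.
apply: cvg_trans c1; apply: near_eq_cvg.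
rewrite /diffquot_filter near_withinE.
have : \forall h \near 0^', `|h : R| < d - x.
  apply: dnbhs0_lt; rewrite subr_gt0//.
apply: filterS => h hd /= xh; rewrite !uP ?x0//.
by rewrite xh /= -ltrBrDl (le_lt_trans (ler_norm h)).
Qed.

Lemma hl_derive_poly (R : realType) (P : {poly R}) (u : R -> R) (d : R) :
  (forall y, 0 <= y < d -> u y = P.[y]) ->
  forall x, 0 <= x < d -> hl_derivable u x /\ hl_derive u x = P^`().[x].
Proof.
move=> uP x xd; have c := diffquot_poly_cvg uP xd.
have pf : ProperFilter (diffquot_filter x).
  by apply: diffquot_filter_proper; case/andP: xd.
by split; [exact: cvgP c|exact: cvg_lim c].
Qed.

Lemma hl_deriven_poly (R : realType) (P : {poly R}) (u : R -> R) (d : R) k :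
  (forall y, 0 <= y < d -> u y = P.[y]) ->
  forall x, 0 <= x < d -> hl_deriven k u x = P^`(k).[x].
Proof.
move=> uP; elim: k => [|k IH]; first exact: uP.
by move=> x xd; rewrite derivnS; exact: (hl_derive_poly IH xd).2.
Qed.

Lemma hl_nderivable_poly (R : realType) (P : {poly R}) (u : R -> R) (d : R) k :
  (forall y, 0 <= y < d -> u y = P.[y]) ->
  forall x, 0 <= x < d -> hl_nderivable k u x.
Proof.
move=> uP; elim: k => [//|k IH] x /andP[x0 xd]; split.
  have : \forall y \near x, y < d by exact: lt_nbhsl.
  by apply: filterS => y yd /= y0; apply: IH; rewrite y0.
have xd' : 0 <= x < d by rewrite x0.
exact: (hl_derive_poly (fun y => @hl_deriven_poly R P u d k uP y) xd').1.
Qed.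

Lemma hl_deriven_horner (R : realType) (P : {poly R}) k :
  hl_deriven k (horner P) 0 = P^`(k).[0].
Proof. by apply: (@hl_deriven_poly _ _ _ 1) => //; rewrite lexx ltr01. Qed.

Lemma derivn_XnM0 (R : comNzRingType) (P : {poly R}) (J k : nat) : (k < J)%N ->
  ('X^J * P)^`(k).[0] = 0.
Proof.
move=> kJ; rewrite horner_coef0 coef_derivn addn0 coefXnM.
by rewrite kJ mul0rn.
Qed.
Lemma Gamma1_gt0 (R : realType) (a : R) : -1 < a -> 0 < Gamma1 a.
Proof.
move=> a1; rewrite -lte_fin Gamma1E//.
pose c := Num.min 1 (2 `^ a) * expR (- 2) : R.
have c0 : 0 < c by rewrite mulr_gt0 ?expR_gt0// lt_min ltr01 powR_gt0.
apply: (@lt_le_trans _ _ (\int[lebesgue_measure]_(x in `[1%R, 2%R]) c%:E)%E).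
  rewrite integral_cst//= lebesgue_measure_itv/= lte_fin ltr1n/=.
  by rewrite -EFinB -EFinM lte_fin mulr_gt0// subr_gt0 ltr1n.
apply: (@le_trans _ _ (\int[lebesgue_measure]_(x in `[1%R, 2%R])
    (x `^ a * expR (- x))%:E)%E).
  apply: ge0_le_integral => //.
  - by move=> x _; rewrite lee_fin ltW.
  - by apply/measurable_EFinP; exact: measurable_powR_expRN.
  - move=> x; rewrite /= in_itv/= => /andP[x1 x2]; rewrite lee_fin.
    have x0 : 0 < x by exact: lt_le_trans x1.
    rewrite ler_pM ?le_min ?ler01 ?powR_ge0 ?expR_ge0//; last by rewrite ler_expR lerN2.
    rewrite ge_min; have [aneg|apos] := leP a 0; apply/orP; [right|left].
      rewrite -[X in 2 `^ X](opprK a) -[X in x `^ X](opprK a) !(powRN _ (- a)).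
      rewrite lef_pV2 ?posrE ?powR_gt0//.
      by rewrite ge0_ler_powR ?nnegrE ?oppr_ge0// ltW.
    by rewrite -(powRr0 x) ler_powR// ltW.
apply: ge0_subset_integral => //.
- by apply/measurable_EFinP; exact: measurable_powR_expRN.
- by move=> x _; exact: powR_expRN_ge0.
- by move=> x; rewrite /= !in_itv/= andbT => /andP[x1 _]; exact: lt_le_trans x1.
Qed.

Lemma lagn_gt0 (R : realType) (a : R) n : -1 < a -> 0 < lagn a n.
Proof. by move=> a1; rewrite divr_gt0 ?Gamma1_gt0 ?gtN1_addn ?ltr0n ?fact_gt0. Qed.

Lemma sqr_Lint_lag_le (R : realType) (a : R) (P : {poly R}) n : -1 < a ->
  Lint a (P * lag a n) ^+ 2 / lagn a n <= Lint a (P * P).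
Proof.
move=> a1; have h0 := lagn_gt0 n a1.
pose v := Lint a (P * lag a n).
have : 0 <= Lint a ((P - (v / lagn a n) *: lag a n) * (P - (v / lagn a n) *: lag a n)).
  by apply: Lint_ge0 => x _; rewrite hornerM -expr2 sqr_ge0.
rewrite mulrBl !mulrBr -!scalerAr -!scalerAl !(LintB a1) !(LintZ a1).
rewrite -/v [lag a n * P]mulrC -/v (Lint_lag_lag a1) eqxx.
have -> : v / lagn a n * (v / lagn a n * lagn a n) = v / lagn a n * v.
  by rewrite divfK// gt_eqF.
by rewrite subrr subr0 subr_ge0 [v / _ * v]mulrC.
Qed.

(** One term of Bessel's inequality, at n = deg P: the pairing of P with the Laguerre polynomial of
    its own degree is a nonzero multiple of its leading coefficient. *)
Lemma Lint_sqr_gt0 (R : realType) (a : R) (P : {poly R}) : -1 < a ->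
  P != 0 -> 0 < Lint a (P * P).
Proof.
move=> a1 P0; apply: lt_le_trans (sqr_Lint_lag_le P (size P).-1 a1).
rewrite divr_gt0 ?lagn_gt0// lt0r sqr_ge0 andbT expf_eq0 /=.
have sP : (size P <= (size P).-1.+1)%N by rewrite prednK ?size_poly_gt0.
rewrite (Lint_lagl a1)// !mulf_neq0 ?signr_eq0//.
  by rewrite -lead_coefE lead_coef_eq0.
by rewrite gt_eqF ?Gamma1_gt0 ?gtN1_addn.
Qed.

Lemma size_poly_sub_lead (R : fieldType) (P Q : {poly R}) k :
  size Q = k.+1 -> (size P <= k.+1)%N ->
  (size (P - (P`_k / lead_coef Q) *: Q)%R <= k)%N.
Proof.
move=> sQ sP; apply/leq_sizeP => j; rewrite leq_eqVlt => /predU1P[<-|kj].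
  rewrite coefB coefZ [in X in _ / X]lead_coefE sQ /= divfK ?subrr//.
  have := lead_coef_eq0 Q; rewrite lead_coefE sQ /= => ->.
  by rewrite -size_poly_eq0 sQ.
by rewrite coefB coefZ [P`_j]nth_default ?(leq_trans sP)// [Q`_j]nth_default ?sQ// mulr0 subr0.
Qed.

Lemma functional_low_degree (R : fieldType) (B : {poly R} -> R)
    (Q : nat -> {poly R}) n :
  (forall P P', B (P + P') = B P + B P') -> (forall c P, B (c *: P) = c * B P) ->
  (forall k, size (Q k) = k.+1) -> (forall k, (k < n)%N -> B (Q k) = 0) ->
  forall P : {poly R}, (size P <= n)%N -> B P = 0.
Proof.
move=> BD BZ sQ BQ.
suff h k : (k <= n)%N -> forall P : {poly R}, (size P <= k)%N -> B P = 0 by exact: h.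
elim: k => [|k IH] kn P sP.
  by move: sP; rewrite leqn0 size_poly_eq0 => /eqP->; rewrite -(scale0r 0) BZ mul0r.
have e := size_poly_sub_lead (sQ k) sP.
rewrite -(subrK ((P`_k / lead_coef (Q k)) *: Q k) P) BD BZ BQ// mulr0 addr0.
by apply: IH => //; exact: ltnW.
Qed.

Section LaguerreUnique.
Variables (R : realType) (a : R) (L : nat -> {poly R}).
Hypotheses (a1 : -1 < a) (hL : laguerre_polys a L).

Lemma laguerre_dot_poly (P Q : {poly R}) :
  laguerre_dot a (horner P) (horner Q) = (Gamma1 a)^-1 * Lint a (P * Q).
Proof.
congr (_ * _); apply: eq_Rintegral => x _.
by rewrite hornerM -!mulrA.
Qed.

(** Orthogonality fixes [L n] up to a scalar, and the value at 0 fixes the scalar, because it is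
    nonzero for a > -1. *)
Lemma laguerre_polyE n : L n = lag a n.
Proof.
case: hL => sL oL vL; have G0 := Gamma1_gt0 a1.
have oL' m k : m != k -> Lint a (L m * L k) = 0.
  move=> /oL; rewrite laguerre_dot_poly => /eqP.
  by rewrite mulf_eq0 invr_eq0 (gt_eqF G0) => /eqP.
have low (P : {poly R}) : (size P <= n)%N -> Lint a (P * L n) = 0.
  apply: (@functional_low_degree _ (fun P => Lint a (P * L n)) L) => //.
  - by move=> P1 P2; rewrite mulrDl (LintD a1).
  - by move=> c P1; rewrite -scalerAl (LintZ a1).
  - by move=> k kn; apply: oL'; rewrite ltn_eqF.
pose c := (L n)`_n / lead_coef (lag a n); pose D := L n - c *: lag a n.
have sD : (size D <= n)%N.
  by apply: size_poly_sub_lead; [exact: (size_lag a n).1|rewrite sL].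
have D0 : D = 0.
  apply/eqP/negPn/negP => /(Lint_sqr_gt0 a1).
  rewrite {2}/D mulrBr -scalerAr (LintB a1) (LintZ a1) low//.
  by rewrite (Lint_lagl a1) ?(leq_trans sD)// nth_default// mulr0 mul0r mulr0 subrr ltxx.
have e : L n = c *: lag a n by apply/eqP; rewrite -subr_eq0; exact/eqP.
have := vL n; rewrite e hornerZ horner0_lag /gbinom.
have -> : \prod_(i < n) (n%:R + a - i%:R) = \prod_(i < n) (a + i.+1%:R).
  rewrite (reindex_inj rev_ord_inj) /=; apply: eq_bigr => i _.
  by rewrite natrB ?ltn_ord//; ring.
set v := _ / _ => cv; have v0 : v != 0.
  rewrite mulf_neq0 ?invr_eq0 ?pnatr_eq0 -?lt0n ?fact_gt0//.
  apply/prodf_neq0 => i _; rewrite gt_eqF// -natr1 addrCA.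
  by rewrite (@lt_le_trans _ _ (a + 1)) ?lerDr// -ltrBlDr sub0r.
by rewrite -[RHS]scale1r; congr (_ *: _); apply: (mulIf v0); rewrite cv mul1r.
Qed.

End LaguerreUnique.

(** * The Sobolev form on polynomials and its extremal property *)

Section SobolevForm.
Variables (R : realType) (a : R) (N : nat) (M : 'I_N.+1 -> R).
Hypotheses (a1 : -1 < a) (hM : forall j, 0 <= M j).
Implicit Types P Q : {poly R}.

Definition sform P Q : R := (Gamma1 a)^-1 * Lint a (P * Q) +
  \sum_(j < N.+1) M j * P^`(j).[0] * Q^`(j).[0].

Lemma sobolev_dot_poly P Q :
  sobolev_dot a M (horner P) (horner Q) = sform P Q.
Proof.
rewrite /sobolev_dot laguerre_dot_poly; congr (_ + _).
by apply: eq_bigr => j _; rewrite !hl_deriven_horner.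
Qed.

Lemma sformD P P' Q : sform (P + P') Q = sform P Q + sform P' Q.
Proof.
rewrite /sform mulrDl (LintD a1) mulrDr addrACA -big_split; congr (_ + _).
by apply: eq_bigr => j _; rewrite derivnD hornerD mulrDr mulrDl.
Qed.

Lemma sformZ c P Q : sform (c *: P) Q = c * sform P Q.
Proof.
rewrite /sform -scalerAl (LintZ a1) mulrDr mulrCA mulr_sumr; congr (_ + _).
by apply: eq_bigr => j _; rewrite derivnZ hornerZ !mulrA [c * _]mulrC.
Qed.

Lemma sformC P Q : sform P Q = sform Q P.
Proof.
by rewrite /sform [P * Q]mulrC; congr (_ + _); apply: eq_bigr => j _; rewrite mulrAC.
Qed.

Lemma sform_gt0 P : P != 0 -> 0 < sform P P.
Proof.
move=> P0; rewrite ltr_pwDl ?mulr_gt0 ?invr_gt0 ?Gamma1_gt0 ?Lint_sqr_gt0//.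
by apply: sumr_ge0 => j _; rewrite -mulrA -expr2 mulr_ge0 ?sqr_ge0.
Qed.

Lemma sform_ge0 P : 0 <= sform P P.
Proof.
have [->|/sform_gt0/ltW//] := eqVneq P 0.
by rewrite -[X in sform X _](scale0r (0 : {poly R})) sformZ mul0r.
Qed.

Lemma sform_XnM J P Q : (N < J)%N ->
  sform ('X^J * P) Q = (Gamma1 a)^-1 * Lint (a + J%:R) (P * Q).
Proof.
move=> NJ; rewrite /sform -mulrA LintXn big1 ?addr0// => j _.
by rewrite derivn_XnM0 ?mulr0 ?mul0r// (leq_trans (ltn_ord j)).
Qed.

Variables (L Q : nat -> {poly R}).
Hypotheses (hL : laguerre_polys a L) (hQ : sobolev_polys a M L Q).

Lemma size_sobolev_poly n : size (Q n) = n.+1. Proof. by case: hQ. Qed.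

Lemma lead_sobolev_poly n : lead_coef (Q n) = (-1) ^+ n / n`!%:R.
Proof. by case: hQ => _ _ ->; rewrite (laguerre_polyE a1 hL) (size_lag a n).2. Qed.

Lemma sobolev_poly_low n (P : {poly R}) : (size P <= n)%N -> sform P (Q n) = 0.
Proof.
apply: (@functional_low_degree _ (fun P => sform P (Q n)) Q).
- by move=> P1 P2; rewrite sformD.
- by move=> c P1; rewrite sformZ.
- exact: size_sobolev_poly.
- by move=> k kn; rewrite -sobolev_dot_poly; case: hQ => _ -> //; rewrite ltn_eqF.
Qed.

(** Pythagoras: P - [Q n] has degree < n, hence is orthogonal to [Q n]. *)
Lemma sobolev_poly_min n (P : {poly R}) : size P = n.+1 -> lead_coef P = lead_coef (Q n) ->
  sform (Q n) (Q n) <= sform P P.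
Proof.
move=> sP lP; pose D := P - Q n.
have sD : (size D <= n)%N.
  have := size_poly_sub_lead (size_sobolev_poly n) (_ : size P <= n.+1)%N.
  rewrite sP => /(_ (leqnn _)); rewrite {1}(_ : P`_n = lead_coef P); last first.
    by rewrite lead_coefE sP.
  by rewrite lP divff ?scale1r// lead_coef_eq0 -size_poly_eq0 size_sobolev_poly.
have eP : P = D + Q n by rewrite subrK.
rewrite eP; clearbody D.
rewrite sformD [sform D (D + _)]sformC [sform (Q n) (D + _)]sformC !sformD.
by rewrite ![sform (Q n) D]sformC !(sobolev_poly_low sD) addr0 add0r lerDr sform_ge0.
Qed.

Lemma sobolev_poly_gt0 n : 0 < sform (Q n) (Q n).
Proof. by apply: sform_gt0; rewrite -size_poly_eq0 size_sobolev_poly. Qed.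

(** The competitor is X^(N+1) times a multiple of the Laguerre polynomial of degree n - N - 1 with
    parameter a + 2 (N + 1). Its derivative terms vanish, and the factor X^(2N+2) of its square
    supplies the weight for which the norm is explicit. *)
Lemma sobolev_poly_le n : (N < n)%N -> sform (Q n) (Q n) <=
  (Gamma1 a)^-1 * ((n - N.+1)`!%:R / n`!%:R ^+ 2 * Gamma1 (a + (n + N.+1)%:R)).
Proof.
move=> Nn; pose m := (n - N.+1)%N; pose b := a + (N.+1 + N.+1)%:R.
have b1 : -1 < b by exact: gtN1_addn.
pose c : R := (-1) ^+ N.+1 * (m`!%:R / n`!%:R).
have f0 k : k`!%:R != 0 :> R by rewrite pnatr_eq0 -lt0n fact_gt0.
have c0 : c != 0 by rewrite !mulf_neq0 ?signr_eq0 ?invr_eq0.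
pose P := 'X^(N.+1) * (c *: lag b m).
have [sl ll] := size_lag b m.
have sP : size P = n.+1.
  rewrite /P mulrC size_mulXn ?size_scale ?sl// ?addnS ?subnKC//.
  by rewrite scaler_eq0 negb_or c0 -size_poly_eq0 sl.
have lP : lead_coef P = lead_coef (Q n).
  rewrite lead_coefM lead_coefXn mul1r lead_coefZ ll lead_sobolev_poly /c.
  rewrite mulrACA -exprD subnKC//; congr (_ * _).
  by rewrite mulrAC mulfV// mul1r.
apply: le_trans (sobolev_poly_min sP lP) _.
rewrite /P sform_XnM// mulrCA LintXn -addrA -natrD -/b -scalerAr -scalerAl.
rewrite !(LintZ b1) (Lint_lag_lag b1) eqxx /lagn /b -addrA -natrD.
have -> : (N.+1 + N.+1 + m = n + N.+1)%N by rewrite /m; lia.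
apply: le_of_eq; congr (_ * _).
rewrite /c -/m; have := f0 m; have := f0 n => h1 h2.
rewrite mulrA -expr2 exprMn -exprM mulnC exprM sqrrN expr1n expr1n mul1r.
by field; rewrite h1 h2.
Qed.

End SobolevForm.
Fixpoint chebU (R : nzRingType) (k : nat) : {poly R} :=
  match k with
  | 0 => 1
  | 1 => 2%:R *: 'X
  | (k'.+1 as k'').+1 => 2%:R *: ('X * chebU R k'') - chebU R k'
  end.

(** * The annihilating function G *)

Section Chebyshev.
Variable R : realType.
Local Notation U := (chebU R).

Lemma chebU_SS k : U k.+2 = 2%:R *: ('X * U k.+1) - U k. Proof. by []. Qed.

Lemma mulX_chebU k : 'X * U k.+1 = 2^-1 *: (U k.+2 + U k).
Proof. by rewrite chebU_SS subrK scalerA mulVf ?scale1r// pnatr_eq0. Qed.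

Lemma horner_chebU_SS k (y : R) : (U k.+2).[y] = 2 * (y * (U k.+1).[y]) - (U k).[y].
Proof. by rewrite chebU_SS !(hornerD, hornerN, hornerZ, hornerM, hornerX, hornerXn, hornerC). Qed.

Lemma deriv_chebU k (y : R) :
  (1 - y ^+ 2) * (U k)^`().[y] = (k%:R + 2) * (y * (U k).[y]) - (k%:R + 1) * (U k.+1).[y].
Proof.
suff: (1 - y ^+ 2) * (U k)^`().[y] =
    (k%:R + 2) * (y * (U k).[y]) - (k%:R + 1) * (U k.+1).[y] /\
  (1 - y ^+ 2) * (U k.+1)^`().[y] =
    (k.+1%:R + 2) * (y * (U k.+1).[y]) - (k.+1%:R + 1) * (U k.+2).[y] by case.
elim: k => [|k [h1 h2]].
  rewrite horner_chebU_SS /= derivC derivZ derivX !(hornerD, hornerN, hornerZ, hornerM, hornerX, hornerXn, hornerC).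
  by split; ring.
split=> //.
have e : (U k.+2)^`().[y] = 2 * (U k.+1).[y] + 2 * (y * (U k.+1)^`().[y]) - (U k)^`().[y].
  by rewrite chebU_SS derivB derivZ derivM derivX !(hornerD, hornerN, hornerZ, hornerM, hornerX, hornerXn, hornerC); ring.
have -> : (1 - y ^+ 2) * (U k.+2)^`().[y] = 2 * (1 - y ^+ 2) * (U k.+1).[y] +
  2 * y * ((1 - y ^+ 2) * (U k.+1)^`().[y]) - (1 - y ^+ 2) * (U k)^`().[y].
  by rewrite e; ring.
rewrite h1 h2 !horner_chebU_SS -!natr1; ring.
Qed.

(** With y = cos t, sqrt(1 - y^2) [U k.+1] is sin((k + 2) t). Integrating its product with -sin t
    gives (sin((k + 3) t) / (k + 3) - sin((k + 1) t) / (k + 1)) / 2, which is sqrt(1 - y^2) times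
    this polynomial. *)
Definition chebU_prim k : {poly R} :=
  2^-1 *: ((k.+3%:R)^-1 *: U k.+2 - (k.+1%:R)^-1 *: U k).

Lemma chebU_primE k (y : R) :
  - y * (chebU_prim k).[y] + (1 - y ^+ 2) * (chebU_prim k)^`().[y] =
  (1 - y ^+ 2) * (U k.+1).[y].
Proof.
rewrite /chebU_prim derivZ derivB !derivZ !(hornerD, hornerN, hornerZ, hornerM, hornerX, hornerXn, hornerC).
have -> : (1 - y ^+ 2) * (2^-1 * (k.+3%:R^-1 * (U k.+2)^`().[y] - k.+1%:R^-1 * (U k)^`().[y]))
  = 2^-1 * (k.+3%:R^-1 * ((1 - y ^+ 2) * (U k.+2)^`().[y]) -
     k.+1%:R^-1 * ((1 - y ^+ 2) * (U k)^`().[y])) by ring.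
rewrite !deriv_chebU !horner_chebU_SS.
have k0 : 0 <= k%:R :> R by [].
have -> : k.+3%:R = k%:R + 3 :> R by rewrite -addn3 natrD.
have -> : k.+2%:R = k%:R + 2 :> R by rewrite -addn2 natrD.
have -> : k.+1%:R = k%:R + 1 :> R by rewrite -addn1 natrD.
by field; apply/andP; split; apply: lt0r_neq0; lra.
Qed.

Lemma is_derive_chebU_prim k (y : R) : -1 < y < 1 ->
  is_derive y 1 (fun t => Num.sqrt (1 - t ^+ 2) * (chebU_prim k).[t])
    (Num.sqrt (1 - y ^+ 2) * (U k.+1).[y]).
Proof.
move=> /andP[y1 y2]; have y0 : 0 < 1 - y ^+ 2 by nra.
have s0 : 0 < Num.sqrt (1 - y ^+ 2) by rewrite sqrtr_gt0.
have h1 : is_derive y (1 : R) (fun t => 1 - t ^+ 2) (- (2 * y)).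
  have hX : is_derive y (1 : R) (horner (1 - 'X^2)) (1 - 'X^2)^`().[y].
    exact: is_derive_poly.
  move: hX; rewrite (_ : horner _ = fun t => 1 - t ^+ 2); last first.
    by apply/funext => t; rewrite !(hornerD, hornerN, hornerZ, hornerM, hornerX, hornerXn, hornerC).
  rewrite derivB derivC derivXn !(hornerD, hornerN, hornerZ, hornerM, hornerX, hornerXn, hornerC) /= expr1 => h.
  have e : - (2 * y) = 0 - (y + y) by ring.
  by rewrite e.
have h2 : is_derive y (1 : R) (fun t => Num.sqrt (1 - t ^+ 2))
    ((2 * Num.sqrt (1 - y ^+ 2))^-1 * (- (2 * y))).
  exact: (@is_derive1_comp R Num.sqrt (fun t => 1 - t ^+ 2) y _ _ (is_derive1_sqrt y0) h1).
have h3 : is_derive y (1 : R) (horner (chebU_prim k)) (chebU_prim k)^`().[y].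
  exact: is_derive_poly.
have h4 := is_deriveM h2 h3.
apply: (@is_derive_eq _ _ _ _ _ _ _ _ h4).
have sq : Num.sqrt (1 - y ^+ 2) ^+ 2 = 1 - y ^+ 2 by rewrite sqr_sqrtr// ltW.
have e := chebU_primE k y.
rewrite /GRing.scale /=; apply: (@mulfI _ (Num.sqrt (1 - y ^+ 2))); first by rewrite gt_eqF.
rewrite [RHS]mulrA -expr2 sq -e mulrDr mulrA -expr2 sq addrC; congr (_ + _).
by field; rewrite gt_eqF.
Qed.

Variables (c t : R).
Hypothesis t0 : 0 < t.

Definition affn (x : R) := (x - c) / t.

Definition chebInt (P : {poly R}) : R :=
  \int[lebesgue_measure]_(x in `[c - t, c + t])
    (P.[affn x] * Num.sqrt (1 - affn x ^+ 2)).

Lemma is_derive_affn (x : R) : is_derive x (1 : R) affn t^-1.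
Proof.
have h : is_derive x (1 : R) (horner ((t^-1) *: ('X - c%:P))) ((t^-1) *: ('X - c%:P))^`().[x].
  exact: is_derive_poly.
move: h; rewrite derivZ derivB derivX derivC !(hornerD, hornerN, hornerZ, hornerM, hornerX, hornerXn, hornerC) (_ : horner _ = affn) ?subr0 ?mulr1//.
by apply/funext => y; rewrite !(hornerD, hornerN, hornerZ, hornerM, hornerX, hornerXn, hornerC) mulrC.
Qed.

Lemma continuous_affn : continuous affn.
Proof.
move=> x; have h := is_derive_affn x.
by apply/differentiable_continuous/derivable1_diffP; exact: ex_derive.
Qed.

Lemma continuous_cheb_integrand (P : {poly R}) :
  continuous (fun x : R => P.[affn x] * Num.sqrt (1 - affn x ^+ 2)).
Proof.
have -> : (fun x : R => P.[affn x] * Num.sqrt (1 - affn x ^+ 2)) =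
  fun x => (horner P \o affn) x * (Num.sqrt \o (horner (1 - 'X^2) \o affn)) x.
  by apply/funext => x; rewrite /= !(hornerD, hornerN, hornerXn, hornerC).
move=> x; apply: continuousM; apply: continuous_comp.
- exact: continuous_affn.
- exact: continuous_horner.
- by apply: continuous_comp; [exact: continuous_affn|exact: continuous_horner].
- exact: sqrt_continuous.
Qed.

Lemma integrable_cheb (P : {poly R}) : lebesgue_measure.-integrable `[c - t, c + t]
  (fun x : R => (P.[affn x] * Num.sqrt (1 - affn x ^+ 2))%:E).
Proof.
apply: (@continuous_compact_integrable R (fun x : R => P.[affn x] * Num.sqrt (1 - affn x ^+ 2))).
  exact: segment_compact.
by apply: continuous_subspaceT; exact: continuous_cheb_integrand.
Qed.

Let mI : measurable (`[c - t, c + t]%classic : set (measurableTypeR R)).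
Proof. exact: measurable_itv. Qed.

Lemma chebIntD P Q : chebInt (P + Q) = chebInt P + chebInt Q.
Proof.
rewrite /chebInt -(RintegralD mI (integrable_cheb P) (integrable_cheb Q)).
by apply: eq_Rintegral => x _; rewrite hornerD mulrDl.
Qed.

Lemma chebIntZ k P : chebInt (k *: P) = k * chebInt P.
Proof.
rewrite /chebInt -(RintegralZl k mI (integrable_cheb P)).
by apply: eq_Rintegral => x _; rewrite hornerZ -mulrA.
Qed.

Lemma affn_lo : affn (c - t) = -1.
Proof. by rewrite /affn addrAC subrr add0r mulNr divff// gt_eqF. Qed.

Lemma affn_hi : affn (c + t) = 1.
Proof. by rewrite /affn addrAC subrr add0r divff// gt_eqF. Qed.

Lemma chebInt_chebU k : chebInt (U k.+1) = 0.
Proof.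
have lt : c - t < c + t by rewrite ltrD2l gt0_cp.
pose G y := Num.sqrt (1 - y ^+ 2) * (chebU_prim k).[y].
have e : (\int[lebesgue_measure]_(x in `[(c - t)%R, (c + t)%R])
   ((U k.+1).[affn x] * Num.sqrt (1 - affn x ^+ 2))%:E)%E =
   (t * G (affn (c + t)) - t * G (affn (c - t)))%:E.
  apply: (@FTC_itv R (fun x => t * G (affn x)) _ _ _ lt).
  - move=> x /andP[x1 x2].
    have hx : -1 < affn x < 1.
      by rewrite /affn ltr_pdivlMr// ltr_pdivrMr//; apply/andP; split; lra.
    have h := is_derive1_comp (is_derive_chebU_prim k hx) (is_derive_affn x).
    have h2 := is_deriveZ t h.
    apply: (@is_derive_eq _ _ _ _ _ _ _ _ h2).
    by rewrite /GRing.scale /= mulrCA mulfV ?gt_eqF// mulr1 mulrC.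
  - move=> x _; apply: continuousM; first exact: cst_continuous.
    have := @continuous_cheb_integrand (chebU_prim k) x.
    by under eq_fun do rewrite mulrC.
  - by move=> x _; exact: continuous_cheb_integrand.
rewrite /chebInt /Rintegral e /= affn_lo affn_hi /G sqrrN expr1n subrr sqrtr0.
by rewrite !mul0r mulr0 subrr.
Qed.

(** The exact value is pi t / 2. On the middle half of the interval, of length t, the weight is at
    least 1/2. *)
Lemma chebInt1 : t / 2 <= chebInt 1.
Proof.
rewrite -lee_fin /chebInt /Rintegral fineK; last first.
  exact: (integrable_fin_num mI (integrable_cheb 1)).
apply: (@le_trans _ _ (\int[lebesgue_measure]_(x in `[(c - t / 2)%R, (c + t / 2)%R])
   (2^-1)%:E)%E).
  rewrite integral_cst//= lebesgue_measure_itv/= lte_fin.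
  have t2 : 0 < t / 2 by rewrite divr_gt0.
  have lt : c - t / 2 < c + t / 2 by rewrite ltrBlDr -addrA ltrDl addr_gt0.
  rewrite lt.
  by rewrite -EFinB -EFinM lee_fin; apply: le_of_eq; field.
apply: (@le_trans _ _ (\int[lebesgue_measure]_(x in `[(c - t / 2)%R, (c + t / 2)%R])
   ((1 : {poly R}).[affn x] * Num.sqrt (1 - affn x ^+ 2))%:E)%E); last first.
  apply: ge0_subset_integral => //=.
  - apply/measurable_EFinP; apply: (measurable_funS measurableT) => //.
    by apply: continuous_measurable_fun; exact: continuous_cheb_integrand.
  - by move=> x _; rewrite lee_fin hornerC mul1r sqrtr_ge0.
  - by move=> x /=; rewrite !in_itv /= => /andP[h1 h2]; move: t0 => ?; apply/andP; split; lra.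
apply: ge0_le_integral => //=.
- apply/measurable_EFinP; apply: (measurable_funS measurableT) => //.
  by apply: continuous_measurable_fun; exact: continuous_cheb_integrand.
- move=> x; rewrite in_itv /= => /andP[h1 h2]; rewrite lee_fin hornerC mul1r.
  have a1 : - 2^-1 <= affn x by rewrite /affn ler_pdivlMr//; move: t0 h1 h2 => ? ? ?; lra.
  have a2 : affn x <= 2^-1 by rewrite /affn ler_pdivrMr//; move: t0 h1 h2 => ? ? ?; lra.
  rewrite -[leLHS]ger0_norm ?invr_ge0// -sqrtr_sqr ler_wsqrtr//; nra.
Qed.

Lemma chebInt_sum (I : Type) (r : seq I) (p : pred I) (F : I -> {poly R}) :
  chebInt (\sum_(i <- r | p i) F i) = \sum_(i <- r | p i) chebInt (F i).
Proof.
apply: (big_morph chebInt); first exact: chebIntD.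
by rewrite -[X in chebInt X](scale0r (0 : {poly R})) chebIntZ mul0r.
Qed.

Lemma chebInt_Xn_chebU j k : (j <= k)%N ->
  chebInt ('X^j * U k) = if j == k then 2^-1 ^+ k * chebInt 1 else 0.
Proof.
elim: j k => [|j IH] [|k]//; first by rewrite mul1r expr0 mul1r.
  by rewrite mul1r chebInt_chebU.
move=> jk; rewrite exprSr -mulrA mulX_chebU -scalerAr chebIntZ mulrDr chebIntD.
rewrite (IH k.+2); last by lia.
rewrite (IH k); last by lia.
rewrite [j == k.+2]ltn_eqF; last by lia.
rewrite add0r eqSS; case: eqP => _; last by rewrite mulr0.
by rewrite exprS mulrA.
Qed.

Lemma chebInt_mul (P D : {poly R}) n : (size P <= n.+1)%N ->
  chebInt (P * \sum_(k < size D) D`_k *: U (n + k)) =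
  P`_n * D`_0 * (2^-1 ^+ n * chebInt 1).
Proof.
move=> sP; rewrite -[in LHS](coefK P) poly_def mulr_suml chebInt_sum.
have h j k : (j <= n)%N -> chebInt ('X^j * U (n + k)) =
    if (j == n) && (k == 0%N) then 2^-1 ^+ n * chebInt 1 else 0.
  move=> jn; rewrite chebInt_Xn_chebU ?(leq_trans jn) ?leq_addr//.
  case: k => [|k]; first by rewrite addn0 andbT.
  by rewrite andbF ltn_eqF// addnS ltnS (leq_trans jn) ?leq_addr.
have e (j : 'I_(size P)) : chebInt (P`_j *: 'X^j * \sum_(k < size D) D`_k *: U (n + k)) =
    if j == n :> nat then P`_j * D`_0 * (2^-1 ^+ n * chebInt 1) else 0.
  have jn : (j <= n)%N by rewrite -ltnS (leq_trans (ltn_ord j)).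
  rewrite -scalerAl chebIntZ mulr_sumr chebInt_sum.
  under eq_bigr do rewrite -scalerAr chebIntZ h//.
  case: eqP => /= [_|_]; last by rewrite big1 ?mulr0// => i _; rewrite mulr0.
  case: (size D) (fun k => @nth_default _ 0 D k) => [|m] hD.
    by rewrite big_ord0 hD// !mulr0 mul0r.
  rewrite big_ord_recl /= big1 ?addr0 ?mulrA// => i _.
  by rewrite mulr0.
under eq_bigr do rewrite e.
rewrite -big_mkcond /=.
have [sn|sn] := ltnP n (size P).
  rewrite (big_pred1 (Ordinal sn))// => i /=.
rewrite [P`_n]nth_default// !mul0r big1// => i /eqP ni.
by have := ltn_ord i; rewrite ni ltnNge sn.
Qed.

End Chebyshev.

(** * Bounds for Chebyshev combinations on the unit circle *)

Section ComplexBound.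
Variable R : realType.
Implicit Types (y s : R) (z : R[i]).
Local Notation toC := (real_complex R).

Lemma complexImD z w : complex.Im (z + w) = complex.Im z + complex.Im w.
Proof. by case: z => a b; case: w. Qed.

Lemma complexIm_realM (r : R) z : complex.Im (r%:C%C * z) = r * complex.Im z.
Proof. by case: z => a b; simpc. Qed.

Lemma complexRe_realM (r : R) z : complex.Re (r%:C%C * z) = r * complex.Re z.
Proof. by case: z => a b; simpc. Qed.

Lemma normr_Im_le z : `|complex.Im z| <= normc z.
Proof. by case: z => a b /=; rewrite -sqrtr_sqr ler_wsqrtr// lerDr sqr_ge0. Qed.

Lemma normr_Re_le z : `|complex.Re z| <= normc z.
Proof. by case: z => a b /=; rewrite -sqrtr_sqr ler_wsqrtr// lerDl sqr_ge0. Qed.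

Lemma normcX z k : normc (z ^+ k) = normc z ^+ k.
Proof. by elim: k => [|k IH]; rewrite ?expr0 ?normc1// !exprS normcM IH. Qed.

(** De Moivre: z = y + i s lies on the unit circle, so z^2 = 2 y z - 1, which is the Chebyshev
    recurrence. *)
Lemma chebU_Im y s k : y ^+ 2 + s ^+ 2 = 1 ->
  complex.Im ((y +i* s)%C ^+ k.+1) = s * (chebU R k).[y].
Proof.
move=> ys; set z := (y +i* s)%C.
have z2 : z ^+ 2 = (2 * y)%:C%C * z + (-1)%:C%C.
  rewrite expr2 /z; simpc; congr (_ +i* _)%C; last ring.
  have -> : s * s = 1 - y * y by rewrite -ys; ring.
  by ring.
have rec j : z ^+ j.+2 = (2 * y)%:C%C * z ^+ j.+1 + (-1)%:C%C * z ^+ j.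
  by rewrite -addn2 exprD z2 exprSr; ring.
suff: complex.Im (z ^+ k.+1) = s * (chebU R k).[y] /\
  complex.Im (z ^+ k.+2) = s * (chebU R k.+1).[y] by case.
elim: k => [|k [h1 h2]].
  rewrite rec !complexImD !complexIm_realM !expr1 expr0 /=.
  by rewrite !(hornerZ, hornerX, hornerC); split; ring.
split=> //; rewrite rec complexImD !complexIm_realM h1 h2 horner_chebU_SS; ring.
Qed.

(** The factor z^(n+1) has modulus 1, so the combination is bounded by |D(z)| whatever n is,
    although its pairing depends on D(0) alone. *)
Lemma cheb_comb_Im y s (D : {poly R}) n : y ^+ 2 + s ^+ 2 = 1 ->
  s * (\sum_(k < size D) D`_k *: chebU R (n + k)).[y] =
  complex.Im ((y +i* s)%C ^+ n.+1 * (map_poly toC D).[(y +i* s)%C]).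
Proof.
move=> ys; set z := (y +i* s)%C.
rewrite [(map_poly _ _).[z]]horner_coef size_map_poly mulr_sumr horner_sum mulr_sumr.
rewrite (big_morph (@complex.Im R) complexImD (erefl : complex.Im 0 = 0)).
apply: eq_bigr => k _; rewrite coef_map /= hornerZ [z ^+ _ * _]mulrCA -exprD complexIm_realM.
by rewrite addSn chebU_Im// mulrCA.
Qed.

Lemma cheb_comb_le y s (D : {poly R}) n : y ^+ 2 + s ^+ 2 = 1 ->
  `|s * (\sum_(k < size D) D`_k *: chebU R (n + k)).[y]| <=
  normc (map_poly toC D).[(y +i* s)%C].
Proof.
move=> ys; rewrite cheb_comb_Im//; apply: le_trans (normr_Im_le _) _.
by rewrite normcM normcX /= ys sqrtr1 expr1n mul1r.
Qed.

(* On the unit circle [|1 - z/n|^(n^2) <= exp (1/2 - n Re z)]: this polynomial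
   stands in for the outer function [exp (- n z)]. *)
Definition outer_poly (n m : nat) : {poly R} :=
  (1 - (n%:R)^-1 *: 'X) ^+ (n ^ 2) * (1 - 'X^2) ^+ (2 * m).

Lemma coef0_outer_poly n m : (outer_poly n m)`_0 = 1.
Proof.
rewrite -horner_coef0 /outer_poly hornerM !horner_exp.
rewrite !(hornerD, hornerN, hornerZ, hornerX, hornerXn, hornerC).
by rewrite mulr0 expr0n /= subr0 !expr1n mulr1.
Qed.

(** On the circle |1 - z/n|^2 = 1 + n^(-2) - 2 y / n is at most exp(n^(-2) - 2 y / n), and |1 -
    z^2|^2 = 4 (1 - y^2). The zeros of the second factor at y = -1 will absorb a power of x / n at
    the left end of the bulk. *)
Lemma cheb_outer_le y n m : (0 < n)%N -> -1 <= y <= 1 ->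
  `|Num.sqrt (1 - y ^+ 2) * (\sum_(k < size (outer_poly n m))
     (outer_poly n m)`_k *: chebU R (n + k)).[y]| <=
  expR (2^-1 - n%:R * y) * (4 * (1 - y ^+ 2)) ^+ m.
Proof.
move=> n0 /andP[y1 y2]; set s := Num.sqrt _.
have n0' : 0 < n%:R :> R by rewrite ltr0n.
have y0 : 0 <= 1 - y ^+ 2 by nra.
have s2 : s ^+ 2 = 1 - y ^+ 2 by rewrite sqr_sqrtr.
have ys : y ^+ 2 + s ^+ 2 = 1 by rewrite s2; ring.
apply: le_trans (cheb_comb_le _ _ ys) _.
rewrite /outer_poly rmorphM !rmorphXn /= !rmorphB rmorph1 /= map_polyZ map_polyX map_polyXn.
rewrite hornerM !horner_exp !(hornerD, hornerN, hornerZ, hornerX, hornerXn, hornerC).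
rewrite normcM !normcX; apply: ler_pM; rewrite ?exprn_ge0//.
- by case: (_ - _) => ? ?; exact: sqrtr_ge0.
- by case: (_ - _) => ? ?; exact: sqrtr_ge0.
- have -> : (1 - (n%:R^-1)%:C%C * (y +i* s)%C) = ((1 - n%:R^-1 * y) +i* (- (n%:R^-1 * s)))%C.
    by simpc.
  rewrite /= sqrrN.
  set v := (X in Num.sqrt X).
  have v0 : 0 <= v by rewrite addr_ge0 ?sqr_ge0.
  have ev : v = 1 + (n%:R^-1 ^+ 2 - 2 * (n%:R^-1 * y)).
    by rewrite /v !exprMn s2; ring.
  have hv : Num.sqrt v <= expR (n%:R^-1 ^+ 2 / 2 - n%:R^-1 * y).
    rewrite -[leRHS]ger0_norm ?expR_ge0// -sqrtr_sqr ler_wsqrtr//.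
    rewrite ev; apply: le_trans (expR_ge1Dx _) _; rewrite le_eqVlt; apply/orP; left.
    by rewrite -expRM_natl; apply/eqP; congr expR; field; rewrite gt_eqF.
  apply: le_trans (_ : expR (n%:R^-1 ^+ 2 / 2 - n%:R^-1 * y) ^+ (n ^ 2) <= _).
    by apply: lerXn2r; rewrite ?nnegrE ?sqrtr_ge0 ?expR_ge0.
  rewrite -expRM_natl ler_expR natrX; apply: le_of_eq.
  by field; rewrite gt_eqF.
- rewrite exprM.
  have -> : normc (1 - (y +i* s)%C ^+ 2) ^+ 2 = 4 * (1 - y ^+ 2).
    have -> : 1 - (y +i* s)%C ^+ 2 = ((2 * s ^+ 2) +i* (- (2 * y * s)))%C.
      have ss : s * s = 1 - y * y by rewrite -[s * s]expr2 s2 expr2.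
      by rewrite expr2; simpc; rewrite ss s2; congr (_ +i* _)%C; ring.
    by rewrite /= sqr_sqrtr ?addr_ge0 ?sqr_ge0// !(sqrrN, exprMn) s2; ring.
  by [].
Qed.

End ComplexBound.
Lemma powR_div (R : realType) (x y r : R) : 0 <= x -> 0 <= y ->
  (x / y) `^ r = x `^ r / y `^ r.
Proof.
move=> x0 y0; rewrite powRM ?invr_ge0//; congr (_ * _).
by rewrite -(powR_inv1 y0) -powRrM mulN1r powRN.
Qed.

(** * The bulk function and its pairing with polynomials *)

Section BulkFunction.
Variables (R : realType) (a : R).

(** The interval is [1, 4 n + 1]; starting at 1 makes G vanish near 0. With radius 2 n one has n y =
    x/2 - n - 1/2 for the rescaled variable y, so the outer factor exp(-n y) cancels exp(x)
    exp(-x/2) exactly and leaves exp(n) up to a constant. *)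
Definition bulk_ctr (n : nat) : R := (2 * n + 1)%:R.
Definition bulk_rad (n : nat) : R := (2 * n)%:R.
Definition bulk_itv (n : nat) : set R :=
  `[bulk_ctr n - bulk_rad n, bulk_ctr n + bulk_rad n].
Local Notation aff n := (affn (bulk_ctr n) (bulk_rad n)).

Definition cheb_outer (n m : nat) : {poly R} :=
  \sum_(k < size (outer_poly R n m)) (outer_poly R n m)`_k *: chebU R (n + k).

(* Times [x^a exp(-x)], this is a Chebyshev weight times a combination of the
   [chebU k] with [k >= n], so it annihilates polynomials of degree [< n]. *)
Definition bulk_fun (n m : nat) : R -> R :=
  (fun x => x `^ (- a) * expR x *
    (Num.sqrt (1 - aff n x ^+ 2) * (cheb_outer n m).[aff n x])) \_ (bulk_itv n).

Lemma bulk_itvP n x : bulk_itv n x -> 1 <= x <= 4 * n%:R + 1.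
Proof.
rewrite /bulk_itv /= in_itv /= /bulk_ctr /bulk_rad natrD !natrM => /andP[h1 h2].
by apply/andP; split; lra.
Qed.

Lemma bulk_fun_out n m x : ~ bulk_itv n x -> bulk_fun n m x = 0.
Proof. by move=> h; rewrite /bulk_fun patchE memNset. Qed.

Lemma bulk_fun_in n m x : bulk_itv n x -> bulk_fun n m x = x `^ (- a) * expR x *
    (Num.sqrt (1 - aff n x ^+ 2) * (cheb_outer n m).[aff n x]).
Proof. by move=> h; rewrite /bulk_fun patchE mem_set. Qed.

Lemma bulk_fun_near0 n m x : x < 1 -> bulk_fun n m x = 0.
Proof. by move=> x1; apply: bulk_fun_out => /bulk_itvP; rewrite leNgt x1. Qed.

Lemma bulk_rad_gt0 n : (0 < n)%N -> 0 < bulk_rad n.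
Proof. by move=> n0; rewrite ltr0n muln_gt0. Qed.

Lemma measurable_bulk_fun n m :
  measurable_fun (setT : set (measurableTypeR R)) (bulk_fun n m).
Proof.
apply/(measurable_restrictT _ _).1; first exact: measurable_itv.
apply: (measurable_funS measurableT) => //.
apply: measurable_funM.
  by apply: measurable_funM; [exact: measurable_powR|exact: measurable_expR].
rewrite (_ : (fun x => _) = (fun x : R => (cheb_outer n m).[aff n x] * Num.sqrt (1 - aff n x ^+ 2))).
  by apply: continuous_measurable_fun; exact: continuous_cheb_integrand.
by apply/funext => x; rewrite mulrC.
Qed.

Lemma affn_itv n x : (0 < n)%N -> bulk_itv n x -> -1 <= aff n x <= 1.
Proof.
move=> n0; rewrite /bulk_itv /= in_itv /= => /andP[h1 h2].
have r0 := bulk_rad_gt0 n0.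
by rewrite /affn ler_pdivlMr// ler_pdivrMr//; apply/andP; split; lra.
Qed.

(** Once the exponentials cancel, x^(-(a+e)/2) remains. The m extra zeros turn it into n^(-(a+e)/2)
    (x/n)^d with d = m - (a+e)/2 >= 0, and x / n <= 5 on the bulk. *)
Lemma bulk_fun_le (e : R) : exists2 Bm : R * nat, 0 < Bm.1 &
  forall n x, (0 < n)%N -> bulk_itv n x ->
  `|bulk_fun n Bm.2 x| * (x `^ ((a - e) / 2) * expR (- (x / 2))) <=
  Bm.1 * (expR n%:R * n%:R `^ (- ((a + e) / 2))).
Proof.
pose m := Num.Def.archi_bound `|(a + e) / 2|.
have hm : (a + e) / 2 <= m%:R.
  by rewrite (le_trans (ler_norm _))// ltW// archi_boundP.
pose d := m%:R - (a + e) / 2; have d0 : 0 <= d by rewrite subr_ge0.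
exists (expR 1 * 4 ^+ m * 5 `^ d, m) => /=.
  by rewrite !mulr_gt0 ?expR_gt0 ?exprn_gt0 ?powR_gt0.
move=> n x n0 xI; rewrite bulk_fun_in//.
have /andP[x1 x2] := bulk_itvP xI.
have x0 : 0 < x by exact: lt_le_trans x1.
have n0' : 0 < n%:R :> R by rewrite ltr0n.
have nge1 : 1 <= n%:R :> R by rewrite ler1n.
have yI := affn_itv n0 xI.
have hS := cheb_outer_le m n0 yI.
rewrite !normrM (ger0_norm (powR_ge0 _ _)) (ger0_norm (expR_ge0 _)) -normrM.
set y := aff n x in yI hS *.
have ey : n%:R * y = x / 2 - n%:R - 2^-1.
  by rewrite /y /affn /bulk_ctr /bulk_rad natrD natrM; field; rewrite gt_eqF.
(* 1 - y^2 <= 2 (1 + y), and 2 n (1 + y) = x - 1. *)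
have y2 : 1 - y ^+ 2 <= x / n%:R.
  case/andP: yI => yl yr.
  apply: (@le_trans _ _ (2 * (1 + y))); first by nra.
  rewrite ler_pdivlMr// mulrAC -mulrA mulrDr mulr1 ey; lra.
have y20 : 0 <= 1 - y ^+ 2 by case/andP: yI => yl yr; nra.
have xn0 : 0 < x / n%:R by rewrite divr_gt0.
have xn5 : x / n%:R <= 5 by rewrite ler_pdivrMr//; lra.
have hT : (4 * (1 - y ^+ 2)) ^+ m <= 4 ^+ m * (x / n%:R) ^+ m.
  rewrite exprMn ler_pM2l ?exprn_gt0//; apply: lerXn2r => //.
  by rewrite nnegrE ltW.
apply: (@le_trans _ _ (x `^ (- a) * expR x * (expR (2^-1 - n%:R * y) * (4 ^+ m * (x / n%:R) ^+ m)) *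
    (x `^ ((a - e) / 2) * expR (- (x / 2))))).
  apply: ler_wpM2r; first by rewrite mulr_ge0 ?powR_ge0 ?expR_ge0.
  apply: ler_wpM2l; first by rewrite mulr_ge0 ?powR_ge0 ?expR_ge0.
  by apply: le_trans hS _; rewrite ler_wpM2l ?expR_ge0.
have eE : expR x * expR (2^-1 - n%:R * y) * expR (- (x / 2)) = expR 1 * expR n%:R.
  by rewrite -!expRD ey; congr expR; field.
have eP : x `^ (- a) * x `^ ((a - e) / 2) * (x / n%:R) ^+ m =
    n%:R `^ (- ((a + e) / 2)) * (x / n%:R) `^ d.
  have xne : x != 0 by rewrite gt_eqF.
  have xnne : x / n%:R != 0 by rewrite gt_eqF.
  have ed : (x / n%:R) `^ d = (x / n%:R) ^+ m * ((x / n%:R) `^ ((a + e) / 2))^-1.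
    by rewrite /d powRD ?xnne ?implybT// powR_mulrn ?(ltW xn0)// powRN.
  have eq : (x / n%:R) `^ ((a + e) / 2) = x `^ ((a + e) / 2) / n%:R `^ ((a + e) / 2).
    by rewrite powR_div ?(ltW x0) ?(ltW n0').
  rewrite -powRD ?xne ?implybT// ed eq.
  have -> : - a + (a - e) / 2 = - ((a + e) / 2) by field.
  rewrite !powRN; set u := n%:R `^ _; set v := x `^ _; set w := _ ^+ m.
  by field; rewrite !gt_eqF ?powR_gt0.
have -> : x `^ (- a) * expR x * (expR (2^-1 - n%:R * y) * (4 ^+ m * (x / n%:R) ^+ m)) *
    (x `^ ((a - e) / 2) * expR (- (x / 2))) =
  (expR x * expR (2^-1 - n%:R * y) * expR (- (x / 2))) * 4 ^+ m *
  (x `^ (- a) * x `^ ((a - e) / 2) * (x / n%:R) ^+ m) by ring.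
rewrite eE eP.
have -> : expR 1 * 4 ^+ m * 5 `^ d * (expR n%:R * n%:R `^ (- ((a + e) / 2))) =
  expR 1 * expR n%:R * 4 ^+ m * (n%:R `^ (- ((a + e) / 2)) * 5 `^ d) by ring.
rewrite ler_pM2l ?mulr_gt0 ?expR_gt0 ?exprn_gt0//.
rewrite ler_pM2l ?powR_gt0//.
by apply: ge0_ler_powR; rewrite ?nnegrE ?(ltW xn0).
Qed.

Lemma bulk_fun_mul n m (P : {poly R}) x : bulk_itv n x ->
  bulk_fun n m x * P.[x] * x `^ a * expR (- x) =
  P.[x] * (cheb_outer n m).[aff n x] * Num.sqrt (1 - aff n x ^+ 2).
Proof.
move=> xI; rewrite bulk_fun_in//.
have /andP[x1 x2] := bulk_itvP xI.
have x0 : 0 < x by exact: lt_le_trans x1.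
rewrite powRN expRN; set p := x `^ a; set q := expR x; set s := Num.sqrt _.
have p0 : p != 0 by rewrite gt_eqF ?powR_gt0.
have q0 : q != 0 by rewrite gt_eqF ?expR_gt0.
by field; rewrite p0 q0.
Qed.

(** The affine substitution multiplies the top coefficient by (2 n)^n and the Chebyshev pairing
    supplies 2^(-n), hence n^n. *)
Lemma bulk_fun_pair n m (P : {poly R}) : (0 < n)%N -> (size P <= n.+1)%N ->
  \int[lebesgue_measure]_(x in `]0, +oo[) (bulk_fun n m x * P.[x] * x `^ a * expR (- x)) =
  P`_n * (n%:R ^+ n * chebInt (bulk_ctr n) (bulk_rad n) 1).
Proof.
move=> n0 sP; have r0 := bulk_rad_gt0 n0.
pose L : {poly R} := bulk_rad n *: 'X + (bulk_ctr n)%:P.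
have LE x : P.[x] = (P \Po L).[aff n x].
  rewrite horner_comp /L !(hornerD, hornerZ, hornerX, hornerC) /affn.
  by rewrite mulrC divfK ?gt_eqF// subrK.
have sL : size L = 2%N.
  rewrite /L size_polyDl size_scale ?size_polyX ?gt_eqF//.
  by rewrite (leq_ltn_trans (size_polyC_leq1 _)).
have lL : lead_coef L = bulk_rad n.
  rewrite /L lead_coefDl ?lead_coefZ ?lead_coefX ?mulr1//.
  by rewrite size_scale ?size_polyX ?gt_eqF// (leq_ltn_trans (size_polyC_leq1 _)).
have sPL : size (P \Po L) = size P by rewrite size_comp_poly2.
have cPL : (P \Po L)`_n = P`_n * bulk_rad n ^+ n.
  have [sn|sn] := leqP (size P) n; first by rewrite !nth_default ?mul0r// sPL.
  have sE : size P = n.+1 by apply/eqP; rewrite eqn_leq sP.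
  by have := lead_coef_comp P (_ : (1 < size L)%N); rewrite sL lL !lead_coefE sPL sE => ->.
have -> : \int[lebesgue_measure]_(x in `]0, +oo[) (bulk_fun n m x * P.[x] * x `^ a * expR (- x)) =
   chebInt (bulk_ctr n) (bulk_rad n) ((P \Po L) * cheb_outer n m).
  rewrite /chebInt -/(bulk_itv n) Rintegral_mkcond [RHS]Rintegral_mkcond.
  apply: eq_Rintegral => x _; rewrite !patchE.
  case: ifPn => [x0|x0].
    case: ifPn => [/set_mem xI|/negP xI]; last first.
      by rewrite bulk_fun_out ?mul0r// => /mem_set.
    by rewrite bulk_fun_mul// LE hornerM.
  case: ifPn => // /set_mem /bulk_itvP /andP[x1 _].
  by move: x0; rewrite mem_set//= in_itv/= andbT (lt_le_trans _ x1).
rewrite (chebInt_mul _ r0) ?sPL// cPL coef0_outer_poly mulr1.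
rewrite -!mulrA; congr (_ * _); rewrite mulrA -exprMn; congr (_ ^+ _ * _).
by rewrite /bulk_rad natrM mulrAC mulfV ?mul1r// pnatr_eq0.
Qed.

Lemma bulk_chebInt1 n : (0 < n)%N -> n%:R <= chebInt (bulk_ctr n) (bulk_rad n) 1.
Proof.
move=> n0; apply: le_trans (chebInt1 _ (bulk_rad_gt0 n0)).
by rewrite /bulk_rad natrM mulrAC mulfV ?mul1r// pnatr_eq0.
Qed.

End BulkFunction.

(** * Size of the Laguerre norms *)

Lemma powR_bernoulli (R : realType) (x t : R) : -1 < x -> 0 <= t <= 1 ->
  (1 + x) `^ t <= 1 + t * x.
Proof.
move=> x1 /andP[t0 t1]; have x0 : 0 <= 1 + x by lra.
move: t0; rewrite le_eqVlt => /predU1P[<-|t0]; first by rewrite powRr0 mul0r addr0.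
move: t1; rewrite le_eqVlt => /predU1P[->|t1]; first by rewrite powRr1// mul1r.
have u0 : 0 < 1 - t by lra.
(* Young's inequality with exponents 1/t and 1/(1-t), applied to (1 + x)^t and 1. *)
have := @conjugate_powR R ((1 + x) `^ t) 1 t^-1 (1 - t)^-1 (powR_ge0 _ _) ler01.
rewrite !invr_gt0 !invrK => /(_ t0 u0).
rewrite (_ : t + (1 - t) = 1); last by ring.
rewrite -powRrM mulfV ?gt_eqF// powRr1// powR1 mulr1 mul1r => /(_ erefl) h.
by apply: le_trans h _; apply: le_of_eq; ring.
Qed.

Section LagnAsymptotics.
Variable R : realType.

Definition power_like (a : R) (f : nat -> R) := exists2 cC : R * R,
  0 < cC.1 /\ 0 < cC.2 & forall n, (0 < n)%N ->
    cC.1 * n%:R `^ a <= f n <= cC.2 * n%:R `^ a.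

Lemma lagn_succ_param (a : R) n : -1 < a ->
  lagn (a + 1) n = (a + n%:R + 1) * lagn a n.
Proof.
move=> a1; rewrite /lagn mulrA; congr (_ / _).
by rewrite addrAC Gamma1_rec// gtN1_addn.
Qed.

Lemma lagn_succ (a : R) n : -1 < a ->
  lagn a n.+1 = (a + n.+1%:R) / n.+1%:R * lagn a n.
Proof.
move=> a1; rewrite /lagn factS natrM invfM.
rewrite -[in LHS]natr1 addrA Gamma1_rec ?gtN1_addn// -addrA natr1; ring.
Qed.

Lemma lagn_0 (a : R) : lagn a 0 = Gamma1 a.
Proof. by rewrite /lagn addr0 fact0 divr1. Qed.

(** Bernoulli's inequality places the quotient of consecutive terms, 1 + t/(n+2), between
    ((n+3)/(n+2))^t and ((n+2)/(n+1))^t, so both bounds propagate by induction. The two sides of the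
    induction hypothesis use bases shifted by one for this reason. *)
Lemma power_like_lagn01 (t : R) : 0 <= t <= 1 -> power_like t (lagn t).
Proof.
move=> t01; have /andP[t0 t1] := t01; have tN1 : -1 < t by lra.
have G0 := Gamma1_gt0 tN1.
exists (Gamma1 t, lagn t 1) => /=; first by split=> //; exact: lagn_gt0.
have nn0 n : 0 < n.+1%:R :> R by rewrite ltr0n.
suff h : forall n, Gamma1 t * n.+2%:R `^ t <= lagn t n.+1 <= lagn t 1 * n.+1%:R `^ t.
  case=> // n _; have /andP[h1 ->] := h n; rewrite andbT (le_trans _ h1)// ler_pM2l//.
  by rewrite ge0_ler_powR ?nnegrE// ler_nat.
have bern n : (n.+2%:R / n.+1%:R) `^ t <= (t + n.+1%:R) / n.+1%:R.
  have e : n.+2%:R / n.+1%:R = 1 + n.+1%:R^-1 :> R.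
    by rewrite -natr1; field; rewrite gt_eqF.
  rewrite e; apply: le_trans (powR_bernoulli _ t01) _.
    by rewrite (@lt_trans _ _ 0)// ?invr_gt0// ltrN10.
  by apply: le_of_eq; field; rewrite gt_eqF.
have bern2 n : (t + n.+2%:R) / n.+2%:R <= (n.+2%:R / n.+1%:R) `^ t.
  have e : n.+1%:R / n.+2%:R = 1 - n.+2%:R^-1 :> R.
    apply: (mulIf (lt0r_neq0 (nn0 n.+1))).
    by rewrite divfK ?gt_eqF// mulrBl mul1r mulVf ?gt_eqF// -[n.+2%:R]natr1 addrK.
  have i1 : n.+2%:R^-1 < 1 :> R by rewrite invf_lt1 ?ltr1n.
  have h : (n.+1%:R / n.+2%:R) `^ t <= 1 - t / n.+2%:R.
    rewrite e; apply: le_trans (powR_bernoulli _ t01) _; first by rewrite ltrN2.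
    by rewrite mulrN.
  have p0 : 0 < (n.+1%:R / n.+2%:R) `^ t :> R by rewrite powR_gt0// divr_gt0.
  have i0 : 0 < n.+2%:R^-1 :> R by rewrite invr_gt0.
  have -> : (n.+2%:R / n.+1%:R) `^ t = ((n.+1%:R / n.+2%:R) `^ t)^-1.
    by rewrite !powR_div// invf_div.
  rewrite -[leLHS]invrK lef_pV2 ?posrE ?invr_gt0//; last first.
    by rewrite divr_gt0// ltr_wpDl.
  apply: le_trans h _.
  rewrite -[leRHS]mul1r ler_pdivlMr ?divr_gt0 ?ltr_wpDl//.
  have -> : (t + n.+2%:R) / n.+2%:R = 1 + t / n.+2%:R by field; rewrite gt_eqF.
  by rewrite -subr_sqr expr1n gerBl sqr_ge0.
elim=> [|n /andP[h1 h2]].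
  rewrite powR1 mulr1 lexx andbT lagn_succ// lagn_0 mulrC ler_pM2r//.
  by have := bern 0%N; rewrite divr1.
rewrite lagn_succ//; apply/andP; split.
  apply: le_trans (_ : (n.+3%:R / n.+2%:R) `^ t * (Gamma1 t * n.+2%:R `^ t) <= _).
    rewrite powR_div//; apply: le_of_eq.
    by field; rewrite gt_eqF// powR_gt0.
  by apply: ler_pM; rewrite ?powR_ge0 ?mulr_ge0 ?powR_ge0 ?(ltW G0) ?bern.
apply: le_trans (_ : (n.+2%:R / n.+1%:R) `^ t * (lagn t 1 * n.+1%:R `^ t) <= _).
  apply: ler_pM; rewrite ?(ltW (lagn_gt0 _ _)) ?bern2//.
  by rewrite divr_ge0// addr_ge0.
rewrite powR_div//; apply: le_of_eq.
by field; rewrite gt_eqF// powR_gt0.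
Qed.

Lemma power_like_succ (a : R) : -1 < a ->
  power_like a (lagn a) <-> power_like (a + 1) (lagn (a + 1)).
Proof.
move=> a1; pose K := `|a| + 2.
have K0 : 0 < K by rewrite ltr_wpDl.
have kn n : (0 < n)%N -> n%:R <= a + n%:R + 1 <= K * n%:R.
  move=> n0; have n1 : 1 <= n%:R :> R by rewrite ler1n.
  have h := ler_norm a; have h0 := normr_ge0 a.
  by apply/andP; split; rewrite /K; nra.
have pw n : (0 < n)%N -> n%:R `^ (a + 1) = n%:R `^ a * n%:R :> R.
  by move=> n0; rewrite powRD ?powRr1// pnatr_eq0 -lt0n n0 implybT.
split=> -[[c C] /= [c0 C0] h].
  exists (c, C * K) => /=; first by split=> //; rewrite mulr_gt0.
  move=> n n0; have /andP[h1 h2] := h n n0; have /andP[k1 k2] := kn n n0.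
  have l0 := lagn_gt0 n a1; have p0 : 0 <= n%:R `^ a by exact: powR_ge0.
  rewrite lagn_succ_param// pw//; apply/andP; split.
    by rewrite mulrA mulrC ler_pM// mulr_ge0// ltW.
  have -> : C * K * (n%:R `^ a * n%:R) = (K * n%:R) * (C * n%:R `^ a) by ring.
  apply: ler_pM => //; last exact: ltW.
  by rewrite (le_trans _ k1).
exists (c / K, C) => /=; first by split=> //; rewrite divr_gt0.
move=> n n0; have /andP[h1 h2] := h n n0; have /andP[k1 k2] := kn n n0.
have n0' : 0 < n%:R :> R by rewrite ltr0n.
have l0 := lagn_gt0 n a1; have p0 : 0 <= n%:R `^ a by exact: powR_ge0.
have u0 : 0 < a + n%:R + 1 by exact: lt_le_trans k1.
rewrite lagn_succ_param// pw// in h1 h2; apply/andP; split.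
  rewrite mulrAC ler_pdivrMr// -(ler_pM2r n0') -[leLHS]mulrA (le_trans h1)//.
  by rewrite -mulrA mulrC ler_wpM2l// ltW.
rewrite -(ler_pM2r n0') -[leRHS]mulrA (le_trans _ h2)// mulrC ler_wpM2r//.
exact: ltW.
Qed.

(** Gamma(n + a + 1) / n! is of order n^a. Write a + 1 = t + k with 0 <= t <= 1, climb k unit steps
    from t, then descend one step, which also reaches negative a. *)
Lemma lagn_power_like (a : R) : -1 < a -> power_like a (lagn a).
Proof.
move=> a1; apply/(power_like_succ a1).
have b0 : 0 <= a + 1 by lra.
pose k := Num.trunc (a + 1); pose t := a + 1 - k%:R.
have /andP[k1 k2] : k%:R <= a + 1 < k.+1%:R by rewrite /k; exact: trunc_itv.
have -> : a + 1 = t + k%:R by rewrite /t subrK.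
have t01 : 0 <= t <= 1 by move: k2; rewrite -natr1 /t => k2; apply/andP; split; lra.
move: (t) t01 (k); clear=> u u01; elim=> [|k IH]; first by rewrite addr0; exact: power_like_lagn01.
have hk : -1 < u + k%:R by apply: gtN1_addn; case/andP: u01 => u0 _; lra.
by rewrite -natr1 addrA; apply/(power_like_succ hk).
Qed.

End LagnAsymptotics.

(** The first Pade bound exp y <= (2 + y) / (2 - y), accurate enough to give (1 + 1/m)^(m + 1/2) >=
    e, the monotonicity behind Stirling's formula with its factor sqrt n. *)
Lemma expR_half_le (R : realType) (y : R) : 0 <= y < 2 ->
  expR y * (2 - y) <= 2 + y.
Proof.
move=> /andP[y0 y2].
pose g t : R := 2 + t - expR t * (2 - t).
pose g' t : R := 1 - expR t * (1 - t).
have dg (t : R) : is_derive t 1 g (g' t).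
  have h1 : is_derive t (1 : R) (horner (2%:P + 'X)) (2%:P + 'X)^`().[t] by exact: is_derive_poly.
  have h2 : is_derive t (1 : R) (horner (2%:P - 'X)) (2%:P - 'X)^`().[t] by exact: is_derive_poly.
  have h3 := is_deriveM (is_derive_expR t) h2.
  have h4 := is_deriveB h1 h3.
  have eg : (fun x => (2%:P + 'X).[x] - expR x * (2%:P - 'X).[x]) = g.
    by apply/funext => x; rewrite !(hornerD, hornerN, hornerC, hornerX).
  move: h4; rewrite (_ : _ - _ = fun x => (2%:P + 'X).[x] - expR x * (2%:P - 'X).[x])// eg.
  move=> h4; apply: (@is_derive_eq _ _ _ _ _ _ _ _ h4).
  rewrite derivD derivB derivC derivX !(hornerD, hornerN, hornerC, hornerX) /GRing.scale /= /g'; ring.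
have g'0 (t : R) : 0 <= t -> 0 <= g' t.
  move=> t0; rewrite /g' subr_ge0.
  have [t1|t1] := ltP t 1; last first.
    by rewrite (@le_trans _ _ 0)// mulr_ge0_le0 ?expR_ge0// subr_le0.
  have : 1 - t <= expR (- t) by exact: expR_ge1Dx.
  by move=> /(ler_wpM2l (expR_ge0 t)); rewrite -expRD subrr expR0.
have : g 0 <= g y.
  apply: (@ger0_derive1_le_cc R g 0 y).
  - by move=> t _; have h := dg t; exact: ex_derive.
  - move=> t; rewrite in_itv /= => /andP[t0 _]; have h := dg t.
    by rewrite derive1E derive_val g'0// ltW.
  - apply: derivable_within_continuous => t _; have h := dg t; exact: ex_derive.
  - by rewrite in_itv /= lexx.
  - by rewrite in_itv /= lexx y0.
  - by [].
by rewrite /g expR0 !addr0 subr0 mul1r subrr subr_ge0.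
Qed.

Lemma stirling_upper (R : realType) (n : nat) : (0 < n)%N ->
  n`!%:R * expR n%:R <= expR 1 * n%:R ^+ n * Num.sqrt n%:R :> R.
Proof.
case: n => // n _; elim: n => [|n IH].
  by rewrite expr1 sqrtr1 !mulr1 mul1r.
set m := n.+1 in IH *.
have m0 : 0 < m%:R :> R by rewrite ltr0n.
have m1 : 0 < m.+1%:R :> R by rewrite ltr0n.
(* This value makes (2 + y) / (2 - y) equal to (m + 1) / m, and y (m + 1/2) = 1. *)
pose y : R := 2 / (2 * m%:R + 1).
have d0 : 0 < 2 * m%:R + 1 :> R by lra.
have y02 : 0 <= y < 2.
  rewrite /y divr_ge0 ?ltW//=; rewrite ltr_pdivrMr//; lra.
have hy : expR y <= m.+1%:R / m%:R.
  have y2 : 0 < 2 - y by case/andP: y02 => ? ?; lra.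
  rewrite -(ler_pM2r y2); apply: le_trans (expR_half_le y02) _.
  rewrite /y -natr1; apply: le_of_eq; field.
  by rewrite !gt_eqF.
have hh : expR 1 <= (m.+1%:R / m%:R) ^+ m * Num.sqrt (m.+1%:R / m%:R) :> R.
  have -> : expR 1 = expR y ^+ m * Num.sqrt (expR y) :> R.
    have -> : Num.sqrt (expR y) = expR (y / 2).
      rewrite -[RHS]ger0_norm ?expR_ge0// -sqrtr_sqr; congr Num.sqrt.
      by rewrite -expRM_natl; congr expR; field.
    by rewrite -expRM_natl -expRD; congr expR; rewrite /y; field; rewrite gt_eqF.
  apply: ler_pM; rewrite ?exprn_ge0 ?expR_ge0 ?sqrtr_ge0//.
    by apply: lerXn2r => //; rewrite nnegrE ?expR_ge0// divr_ge0// ltW.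
  exact: ler_wsqrtr.
rewrite factS natrM -[in expR _]natr1 expRD.
have -> : m.+1%:R * m`!%:R * (expR m%:R * expR 1) =
  m`!%:R * expR m%:R * (m.+1%:R * expR 1) :> R by ring.
apply: le_trans (_ : expR 1 * m%:R ^+ m * Num.sqrt m%:R *
   (m.+1%:R * ((m.+1%:R / m%:R) ^+ m * Num.sqrt (m.+1%:R / m%:R))) <= _).
  apply: ler_pM => //.
  by rewrite ler_pM2l.
have sq : Num.sqrt m%:R * Num.sqrt (m.+1%:R / m%:R) = Num.sqrt m.+1%:R :> R.
  by rewrite -sqrtrM ?ltW// mulrC divfK ?gt_eqF.
have pw : m%:R ^+ m * (m.+1%:R / m%:R) ^+ m = m.+1%:R ^+ m :> R.
  by rewrite -exprMn mulrC divfK ?gt_eqF.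
rewrite exprS -sq -pw; apply: le_of_eq; ring.
Qed.
(** * Test polynomials at a given scale *)

Section DifferenceClass.
Variable R : realType.
Implicit Types (b : int -> R) (t : int).

Definition dif b : int -> R := fun t => b (t + 1) - b t.
Definition difn i b : int -> R := iter i dif b.
Definition shr b : int -> R := fun t => b (t - 1).

Lemma difnS i b : difn i.+1 b = difn i (dif b).
Proof. by rewrite /difn iterSr. Qed.

Lemma difnSr i b t : difn i.+1 b t = difn i b (t + 1) - difn i b t.
Proof. by []. Qed.

Lemma eq_difn i b b' : b =1 b' -> difn i b =1 difn i b'.
Proof. by move=> /funext ->. Qed.

Lemma difnD i b b' t : difn i (fun t => b t + b' t) t = difn i b t + difn i b' t.
Proof. by elim: i t => [//|i IH] t; rewrite !difnSr !IH opprD addrACA. Qed.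

Lemma difnZ i (c : R) b t : difn i (fun t => c * b t) t = c * difn i b t.
Proof. by elim: i t => [//|i IH] t; rewrite !difnSr !IH mulrBr. Qed.

Lemma difn_shift i (u : int) b t : difn i (fun t => b (t + u)) t = difn i b (t + u).
Proof. by elim: i t => [//|i IH] t; rewrite !difnSr !IH addrAC. Qed.

(** Leibniz rule for an affine factor. At i = 0 the default value [i.-1] is harmless, since its term
    carries the factor i. *)
Lemma difn_affine i (a : nat) b t :
  difn i (fun t => (t%:~R + a%:R) * b t) t =
  (t%:~R + a%:R + i%:R) * difn i b t + i%:R * difn i.-1 b t.
Proof.
elim: i t => [|i IH] t; first by rewrite addr0 mul0r addr0.
rewrite difnSr !IH [difn i.+1 b t]difnSr /=.
have -> : i%:R * difn i.-1 b (t + 1) = i%:R * (difn i b t + difn i.-1 b t).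
  case: i {IH} => [|i]; first by rewrite !mul0r.
  by rewrite [difn i.+1 b t]difnSr subrK.
by rewrite intrD -[i.+1%:R]natr1; ring.
Qed.

(* Sequences that vary at scale [K], as [t |-> f (t / K)] does for a bump [f]. *)
Definition smooth_at (K j w : nat) (C : R) b :=
  (forall i, (i <= j)%N -> forall t, `|difn i b t| <= C / K%:R ^+ i) /\
  (forall t, (w * K < `|t|)%N -> b t = 0).

Lemma smooth_at_ge0 K j w C b : smooth_at K j w C b -> 0 <= C.
Proof.
by move=> [/(_ 0%N isT 0) h _]; rewrite expr0 divr1 in h; apply: le_trans h.
Qed.

Lemma difn_supp i (v : nat) b t : (forall t, (v < `|t|)%N -> b t = 0) ->
  (v + i < `|t|)%N -> difn i b t = 0.
Proof.
move=> hb; elim: i t => [|i IH] t h; first by apply: hb; lia.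
by rewrite difnSr !IH ?subrr//; lia.
Qed.

Variable K : nat.
Hypothesis K0 : (0 < K)%N.

Let KR : 0 < K%:R :> R. Proof. by rewrite ltr0n. Qed.

Lemma smooth_at_weaken j j' w w' C C' b : (j' <= j)%N -> (w <= w')%N -> C <= C' ->
  smooth_at K j w C b -> smooth_at K j' w' C' b.
Proof.
move=> jj ww CC [h1 h2]; split=> [i ij t|t ht].
  apply: le_trans (h1 i _ t) _; first exact: leq_trans jj.
  by rewrite ler_wpM2r// invr_ge0 exprn_ge0// ltW.
by apply: h2; apply: leq_ltn_trans ht; rewrite leq_mul2r ww orbT.
Qed.

Lemma smooth_at_dif j w C b : smooth_at K j.+1 w C b ->
  smooth_at K j w.+1 C (fun t => K%:R * dif b t).
Proof.
move=> [h1 h2]; split=> [i ij t|t ht].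
  rewrite difnZ -difnS normrM gtr0_norm//.
  apply: le_trans (_ : K%:R * (C / K%:R ^+ i.+1) <= _).
    by rewrite ler_pM2l// h1.
  by rewrite le_eqVlt exprS; apply/orP; left; apply/eqP; field; rewrite !gt_eqF ?exprn_gt0//.
by rewrite /dif !h2 ?subrr ?mulr0//; nia.
Qed.

Lemma smooth_at_shr j w C b : smooth_at K j w C b -> smooth_at K j w.+1 C (shr b).
Proof.
move=> [h1 h2]; split=> [i ij t|t ht]; first by rewrite /shr difn_shift h1.
by rewrite /shr h2//; nia.
Qed.

Lemma smooth_atD j w w' C C' b b' : smooth_at K j w C b -> smooth_at K j w' C' b' ->
  smooth_at K j (w + w') (C + C') (fun t => b t + b' t).
Proof.
move=> [h1 h2] [h3 h4]; split=> [i ij t|t ht].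
  by rewrite difnD (le_trans (ler_normD _ _))// mulrDl lerD ?h1 ?h3.
by rewrite h2 ?h4 ?addr0//; nia.
Qed.

Lemma smooth_atZ j w C (c c' : R) b : `|c| <= c' -> smooth_at K j w C b ->
  smooth_at K j w (c' * C) (fun t => c * b t).
Proof.
move=> cc [h1 h2]; split=> [i ij t|t ht]; last by rewrite h2 ?mulr0.
by rewrite difnZ normrM -mulrA ler_pM// h1.
Qed.

(** On a support of radius w K the factor (t + a) / K is bounded, and differencing it costs 1 / K:
    it is itself smooth at scale K. *)
Lemma smooth_at_affine j w C (a : nat) b : smooth_at K j w C b ->
  smooth_at K j w ((w + a + 3 * j)%:R * C) (fun t => (t%:~R + a%:R) / K%:R * b t).
Proof.
move=> hb; have C0 := smooth_at_ge0 hb.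
have [h1 h2] := hb; split=> [i ij t|t ht]; last by rewrite h2 ?mulr0.
have -> : difn i (fun t => (t%:~R + a%:R) / K%:R * b t) t =
    K%:R^-1 * difn i (fun t => (t%:~R + a%:R) * b t) t.
  by rewrite -difnZ; apply: eq_difn => u; ring.
rewrite difn_affine normrM gtr0_norm ?invr_gt0//.
have Ki0 : 0 < K%:R ^+ i :> R by rewrite exprn_gt0.
have ht1 : `|(t%:~R + a%:R + i%:R) * difn i b t| <=
    ((w + a + 2 * j) * K)%:R * (C / K%:R ^+ i).
  have [ht|ht] := ltnP (w * K + i) `|t|.
    by rewrite (difn_supp h2 ht) mulr0 normr0 mulr_ge0// divr_ge0// ltW.
  rewrite normrM ler_pM ?h1// (le_trans (ler_normD _ _))//.
  rewrite (le_trans (lerD (ler_normD _ _) (lexx _)))//.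
  rewrite -intr_norm -abszE !normr_nat -!natrD ler_nat.
  by nia.
have ht2 : `|i%:R * difn i.-1 b t| <= (j * K)%:R * (C / K%:R ^+ i).
  rewrite normrM normr_nat; case: i ij {Ki0 ht1} => [|i] ij.
    by rewrite mul0r mulr_ge0// divr_ge0// exprn_ge0.
  have := h1 i (ltnW ij) t => hi.
  apply: le_trans (_ : j%:R * (C / K%:R ^+ i) <= _).
    by rewrite ler_pM// ler_nat.
  rewrite natrM exprS; apply: le_of_eq.
  by field; rewrite !gt_eqF ?exprn_gt0//.
rewrite mulrC ler_pdivrMr//; apply: le_trans (ler_normD _ _) _.
apply: le_trans (lerD ht1 ht2) _; rewrite -mulrDl -natrD.
have -> : ((w + a + 2 * j) * K + j * K)%N = ((w + a + 3 * j) * K)%N by ring.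
by rewrite natrM; apply: le_of_eq; ring.
Qed.

Definition avg b : int -> R := fun t => K%:R^-1 * \sum_(l < K) b (t + l%:Z).

Lemma dif_avg b t : dif (avg b) t = K%:R^-1 * (b (t + K%:Z) - b t).
Proof.
rewrite /dif /avg -mulrBr; congr (_ * _).
case: K K0 => // k _; rewrite big_ord_recr [X in _ - X]big_ord_recl /=.
have -> : \sum_(i < k) b (t + 1 + i%:Z) = \sum_(i < k) b (t + (bump 0 i)%:Z).
  by apply: eq_bigr => i _; congr b; rewrite /bump /=; lia.
have -> : t + 1 + k%:Z = t + k.+1%:Z by lia.
by rewrite addr0; ring.
Qed.

Lemma smooth_at_avg j w C b : smooth_at K j w C b ->
  smooth_at K j.+1 w.+1 (2 * C) (avg b).
Proof.
move=> hb; have C0 := smooth_at_ge0 hb; have [h1 h2] := hb; split=> [[|i] ij t|t ht].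
- rewrite expr0 divr1 /= /avg normrM gtr0_norm ?invr_gt0//.
  rewrite mulrC ler_pdivrMr//; apply: le_trans (ler_norm_sum _ _ _) _.
  apply: le_trans (_ : \sum_(l < K) C <= _).
    by apply: ler_sum => l _; have := h1 0%N isT (t + l%:Z); rewrite expr0 divr1.
  rewrite sumr_const card_ord -[C *+ K]mulr_natr; apply: ler_wpM2r; first exact: ltW.
  by rewrite mulr_natl mulr2n lerDl.
- rewrite difnS (eq_difn _ (dif_avg b)) difnZ.
  have -> : difn i (fun t => b (t + K%:Z) - b t) t = difn i b (t + K%:Z) - difn i b t.
    rewrite -(difn_shift i K%:Z) -[X in _ - X]mul1r -mulNr -difnZ -difnD.
    by apply: eq_difn => u; rewrite mulN1r.
  rewrite normrM gtr0_norm ?invr_gt0// mulrC ler_pdivrMr//.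
  apply: le_trans (ler_normB _ _) _.
  apply: le_trans (lerD (h1 _ _ _) (h1 _ _ _)) _ => //.
  rewrite exprS; apply: le_of_eq.
  by field; rewrite !gt_eqF ?exprn_gt0//.
- rewrite /avg big1 ?mulr0// => l _; apply: h2.
  by have := ltn_ord l; nia.
Qed.

(** A discrete B-spline: m averages over windows of length K, each gaining one order of smoothness
    at scale K. The radius (m + 1) K of the initial indicator leaves the value 1 at 0 after all m
    averages. *)
Definition bump_seq (m : nat) : int -> R :=
  iter m avg (fun t => if (`|t| <= m.+1 * K)%N then 1 else 0).

Lemma smooth_at_bump m : smooth_at K m (m + m.+1) (2 ^+ m) (bump_seq m).
Proof.
suff h : forall c m', smooth_at K m' (m' + c) (2 ^+ m')
    (iter m' avg (fun t : int => if (`|t| <= c * K)%N then 1 else 0)).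
  exact: h.
move=> c; elim=> [|m' IH]; last by rewrite exprS; exact: smooth_at_avg.
split=> [i|t ht]; last by rewrite /= leqNgt ht.
rewrite leqn0 => /eqP-> t; rewrite !expr0 divr1 /=.
by case: ifP; rewrite ?normr1 ?normr0.
Qed.

Lemma bump_seq0 m : bump_seq m 0 = 1.
Proof.
rewrite /bump_seq; set c := m.+1.
suff h : forall m', (m' <= c)%N -> forall t : int, 0 <= t -> (`|t| <= (c - m') * K)%N ->
    iter m' avg (fun t : int => if (`|t| <= c * K)%N then 1 else 0) t = 1 :> R.
  by apply: h => //; rewrite /c.
elim=> [|m' IH] mc t t0 ht; first by rewrite /= (leq_trans ht)// subn0.
rewrite /= {1}/avg (eq_bigr (fun=> 1)).
  by rewrite sumr_const card_ord mulVf// gt_eqF.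
move=> l _; apply: IH; [exact: ltnW|lia|].
have := ltn_ord l; have : (c - m' = (c - m'.+1).+1)%N by lia.
by move=> -> hl; rewrite mulSn; lia.
Qed.

(** The linear factors put zeros at -1, ..., -J; dividing each by K keeps the product bounded at
    scale K, at the price of the value J! / K^J at 0. *)
Fixpoint bump_poly (m J : nat) : int -> R :=
  if J is J'.+1 then fun t => (t%:~R + J%:R) / K%:R * bump_poly m J' t
  else bump_seq m.

Lemma bump_poly_root m J i : (0 < i <= J)%N -> bump_poly m J (- i%:Z) = 0.
Proof.
elim: J => [|J IH] /andP[i0 iJ] /=; first by lia.
move: iJ; rewrite leq_eqVlt => /predU1P[->|iJ].
  by rewrite mulrNz addNr mul0r mul0r.
by rewrite IH ?mulr0// i0.
Qed.

Lemma bump_poly0 m J : bump_poly m J 0 = J`!%:R / K%:R ^+ J.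
Proof.
elim: J => [|J IH] /=; first by rewrite bump_seq0 fact0 expr0 divr1.
rewrite IH add0r factS exprS natrM; field.
by rewrite !gt_eqF ?exprn_gt0//.
Qed.

End DifferenceClass.

(** * Laguerre expansions around degree n and multiplication by X *)

Section LaguerreSeries.
Variables (R : realType) (A : R).
Implicit Types (b : int -> R) (t : int).

(* If [g] has coefficients [b (m - n) / lagn A m] in the basis [lag A m], this
   gives the coefficients of ['X * g]. *)
Definition mulXseq (n : nat) b : int -> R := fun t =>
  (2 * (n%:Z + t)%:~R + A + 1) * b t - ((n%:Z + t)%:~R + A) * b (t - 1)
  - ((n%:Z + t)%:~R + 1) * b (t + 1).

Lemma smooth_at_eq K j w (C : R) b b' : b =1 b' ->
  smooth_at K j w C b -> smooth_at K j w C b'.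
Proof. by move=> /funext ->. Qed.

Lemma mulXseqZ n (c : R) b t :
  mulXseq n (fun u => c * b u) t = c * mulXseq n b t.
Proof. by rewrite /mulXseq; ring. Qed.

Lemma mulXseq_supp n v b : (forall t, (v < `|t|)%N -> b t = 0) ->
  forall t, (v.+1 < `|t|)%N -> mulXseq n b t = 0.
Proof. by move=> hb t ht; rewrite /mulXseq !hb ?mulr0 ?subr0//; lia. Qed.

Lemma mulXseqE n K b t : (0 < K)%N -> (0 < n)%N ->
  let g := fun u => K%:R * dif b u in
  let h := shr (fun u => K%:R * dif g u) in
  K%:R ^+ 2 / n%:R * mulXseq n b t =
  (-1) * h t + ((- (K%:R / n%:R)) * ((t%:~R + 0%:R) / K%:R * h t) +
  (K%:R / n%:R * A * shr g t + (- (K%:R / n%:R)) * g t)).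
Proof.
move=> K0 n0 g h; rewrite /h /g /shr /dif /mulXseq subrK intrD.
have Kn : K%:R != 0 :> R by rewrite pnatr_eq0 -lt0n.
have nn : n%:R != 0 :> R by rewrite pnatr_eq0 -lt0n.
rewrite (_ : n%:Z%:~R = n%:R)//.
by field; rewrite Kn nn.
Qed.

Lemma smooth_at_mulXseq j w (C : R) : exists w' C', forall n K b,
  (0 < K)%N -> (K <= n)%N -> smooth_at K j.+2 w C b ->
  smooth_at K j w' C' (fun t => K%:R ^+ 2 / n%:R * mulXseq n b t).
Proof.
(* The new width and constant are left to unification with the closure lemmas below; being
   introduced before n and K, they cannot depend on them. *)
eexists; eexists => n K b K0 Kn hb.
have n0 : (0 < n)%N by exact: leq_trans Kn.
have q1 : `|- (K%:R / n%:R)| <= 1 :> R.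
  by rewrite normrN ger0_norm ?divr_ge0// ler_pdivrMr ?ltr0n// mul1r ler_nat.
have q2 : `|K%:R / n%:R * A| <= `|A|.
  by rewrite normrM ler_piMl// -normrN.
have hg := smooth_at_dif K0 hb.
have hg' := smooth_at_weaken (leqnSn j) (leqnn _) (lexx _) hg.
have hh := smooth_at_shr K0 (smooth_at_dif K0 hg).
have q0 : `|(-1 : R)| <= 1 by rewrite normrN1.
have h1 := smooth_atZ q0 hh.
have h2 := smooth_atZ q1 (smooth_at_affine K0 0 hh).
have h3 := smooth_atZ q2 (smooth_at_shr K0 hg').
have h4 := smooth_atZ q1 hg'.
have h5 := smooth_atD K0 h1 (smooth_atD K0 h2 (smooth_atD K0 h3 h4)).
by apply: (smooth_at_eq _ h5) => t; rewrite mulXseqE.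
Qed.

Lemma smooth_at_iter_mulXseq i j w (C : R) : exists w' C', forall n K b,
  (0 < K)%N -> (K <= n)%N -> smooth_at K (i.*2 + j) w C b ->
  smooth_at K j w' C' (fun t => (K%:R ^+ 2 / n%:R) ^+ i * iter i (mulXseq n) b t).
Proof.
elim: i j => [|i IH] j.
  exists w, C => n K b _ _ hb.
  by rewrite (_ : (fun t => _) = b)//; apply/funext => t; rewrite mul1r.
have [w1 [C1 h1]] := IH j.+2; have [w2 [C2 h2]] := smooth_at_mulXseq j w1 C1.
exists w2, C2 => n K b K0 Kn hb.
have := h2 n K _ K0 Kn (h1 n K b K0 Kn _).
rewrite (_ : (i.*2 + j.+2 = i.+1.*2 + j)%N); last by rewrite doubleS; lia.
move=> /(_ hb); congr smooth_at; apply/funext => t.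
by rewrite mulXseqZ mulrA -exprS.
Qed.

Lemma smooth_at_bump_poly m J : exists w C, forall K, (0 < K)%N ->
  smooth_at K m w C (bump_poly R K m J).
Proof.
elim: J => [|J [w [C IH]]].
  by exists (m + m.+1)%N, (2 ^+ m) => K K0; exact: smooth_at_bump.
by eexists; eexists => K K0; exact: (smooth_at_affine K0 J.+1 (IH K K0)).
Qed.

(** Dividing by [lagn A m] makes b (m - n) the pairing of the series with [lag A m], for m <= 2
    n. *)
Definition lag_series (n : nat) b : {poly R} :=
  \sum_(m < (2 * n).+1) (b (m%:Z - n%:Z) / lagn A m) *: lag A m.

Hypothesis A1 : -1 < A.

(** The three-term recurrence with indices shifted. The support condition kills the boundary terms
    at both ends of the sum, and [lagn_succ] converts the normalizations. *)
Lemma mulX_lag_series n v b : (v < n)%N -> (forall t, (v < `|t|)%N -> b t = 0) ->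
  'X * lag_series n b = lag_series n (mulXseq n b).
Proof.
move=> vn hb; rewrite /lag_series mulr_sumr.
pose c (m : nat) := b (m%:Z - n%:Z) / lagn A m.
have l0 m : lagn A m != 0 by rewrite gt_eqF ?lagn_gt0.
have e (m : nat) : 'X * (c m *: lag A m) =
    (c m * ((2 * m)%:R + 1 + A)) *: lag A m - (c m * m.+1%:R) *: lag A m.+1
    - (if m is k.+1 then (c m * (m%:R + A)) *: lag A k else 0).
  rewrite -scalerAr lag_rec !scalerBr !scalerA; congr (_ - _).
  by case: m => [|m]; rewrite ?scaler0// scalerA.
under eq_bigr do rewrite e.
rewrite !sumrB.
have e1 : \sum_(m < (2 * n).+1) (c m * m.+1%:R) *: lag A m.+1 =
    \sum_(m < (2 * n).+1) (if (m : nat) is k.+1 then c k * m%:R else 0) *: lag A m.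
  rewrite [LHS]big_ord_recr [RHS]big_ord_recl /= scale0r add0r.
  by rewrite /c hb ?mul0r ?scale0r ?addr0//; lia.
have e2 : \sum_(m < (2 * n).+1) (if (m : nat) is k.+1 then (c m * (m%:R + A)) *: lag A k else 0) =
    \sum_(m < (2 * n).+1) (c m.+1 * (m.+1%:R + A)) *: lag A m.
  rewrite [LHS]big_ord_recl [RHS]big_ord_recr /= add0r.
  rewrite [c (2 * n).+1]/c hb ?mul0r ?scale0r ?addr0//; last by lia.
rewrite e1 e2 -!sumrB; apply: eq_bigr => m _.
rewrite -!scalerBl; congr (_ *: _).
have mA k : A + k.+1%:R != 0.
  by rewrite gt_eqF// -natr1 addrCA ltr_wpDl// -ltrBlDr sub0r.
have en : n%:Z + (m%:Z - n%:Z) = m%:Z by lia.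
have -> : (if (m : nat) is k.+1 then c k * m%:R else 0) =
   (m%:R + A) * b (m%:Z - n%:Z - 1) / lagn A m.
  case: (m : nat) => [|k]; first by rewrite hb ?mulr0 ?mul0r//; lia.
  rewrite /c (_ : k.+1%:Z - n%:Z - 1 = k%:Z - n%:Z); last lia.
  have p0 : k.+1%:R != 0 :> R by rewrite pnatr_eq0.
  have q0 := mA k; rewrite lagn_succ//; move: (k.+1%:R : R) p0 q0 => p p0 q0.
  by field; rewrite l0 p0 q0.
have -> : c m.+1 * (m.+1%:R + A) = (m%:R + 1) * b (m%:Z - n%:Z + 1) / lagn A m.
  rewrite /c (_ : m.+1%:Z - n%:Z = m%:Z - n%:Z + 1); last lia.
  have p0 : m.+1%:R != 0 :> R by rewrite pnatr_eq0.
  have q0 := mA m; rewrite natr1 lagn_succ//; move: (m.+1%:R : R) p0 q0 => p p0 q0.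
  by field; rewrite l0 p0 q0.
rewrite /mulXseq en (_ : m%:Z%:~R = m%:R)// /c natrM.
by field; exact: l0.
Qed.

Lemma mulXn_lag_series n v b i : (v + i <= n)%N -> (forall t, (v < `|t|)%N -> b t = 0) ->
  'X^i * lag_series n b = lag_series n (iter i (mulXseq n) b) /\
  (forall t, (v + i < `|t|)%N -> iter i (mulXseq n) b t = 0).
Proof.
move=> vn hb; elim: i vn => [|i IH] vn.
  by rewrite mul1r; split=> // t; rewrite addn0; exact: hb.
have vn' : (v + i < n)%N by rewrite -addnS.
have [h1 h2] := IH (ltnW vn'); split.
  by rewrite exprS -mulrA h1 (mulX_lag_series vn' h2).
by move=> t; rewrite addnS; exact: mulXseq_supp.
Qed.

Lemma Lint_lag_series_lag n b (q : {poly R}) :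
  Lint A (lag_series n b * q) =
  \sum_(m < (2 * n).+1) b (m%:Z - n%:Z) / lagn A m * Lint A (lag A m * q).
Proof.
rewrite mulr_suml (Lint_sum A1); apply: eq_bigr => m _.
by rewrite -scalerAl (LintZ A1).
Qed.

Lemma Lint_lag_series_sqr n b :
  Lint A (lag_series n b * lag_series n b) =
  \sum_(m < (2 * n).+1) b (m%:Z - n%:Z) ^+ 2 / lagn A m.
Proof.
rewrite Lint_lag_series_lag; apply: eq_bigr => m _.
rewrite mulrC [lag A m * _]mulrC Lint_lag_series_lag (bigD1 m)//=.
rewrite big1 ?addr0; last first.
  by move=> k /eqP km; rewrite (Lint_lag_lag A1) ifN ?mulr0//; apply/eqP => /val_inj.
rewrite (Lint_lag_lag A1) eqxx; have l0 := lagn_gt0 m A1.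
by field; rewrite gt_eqF.
Qed.

Lemma sum_window (n v : nat) : (v <= n)%N ->
  \sum_(m < (2 * n).+1) (if (`|m%:Z - n%:Z| <= v)%N then 1 else 0) = (2 * v).+1%:R :> R.
Proof.
move=> vn.
rewrite -(big_mkord xpredT (fun m : nat => if (`|m%:Z - n%:Z| <= v)%N then 1 else 0 : R)).
rewrite (big_cat_nat (n := (n - v)))//=; last lia.
rewrite (big_cat_nat (m := (n - v)) (n := (n + v).+1))//=; [|lia|lia].
rewrite big_nat_cond big1 ?add0r; last by move=> m /andP[h _]; rewrite ifF//; lia.
rewrite [X in _ + X]big_nat_cond [X in _ + X]big1 ?addr0; last first.
  by move=> m /andP[h _]; rewrite ifF//; lia.
rewrite big_nat_cond (eq_bigr (fun=> 1)); last by move=> m /andP[h _]; rewrite ifT//; lia.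
rewrite -big_nat_cond sumr_const_nat; congr (_%:R); lia.
Qed.

(** Parseval over a window of 2 v + 1 indices. The condition 2 v <= n keeps m >= n / 2, where 1 /
    [lagn A m] is of order n^(-A). *)
Lemma lag_series_sqr_le (v n : nat) (C : R) b c :
  0 <= A -> 0 < c -> (forall m, (0 < m)%N -> c * m%:R `^ A <= lagn A m) ->
  (0 < n)%N -> (2 * v <= n)%N -> 0 <= C ->
  (forall t, `|b t| <= C) -> (forall t, (v < `|t|)%N -> b t = 0) ->
  Lint A (lag_series n b * lag_series n b) <=
  (2 * v).+1%:R * (C ^+ 2 * (2 `^ A / c) * n%:R `^ (- A)).
Proof.
move=> A0 c0 hc n0 vn C0 bC bv; rewrite Lint_lag_series_sqr.
have vn1 : (v <= n)%N by lia.
rewrite -(sum_window vn1) mulr_suml; apply: ler_sum => m _.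
case: leqP => hm; last by rewrite bv// expr0n mul0r mul0r.
rewrite mul1r.
have m0 : (0 < m)%N by lia.
have nm : n%:R / 2 <= m%:R :> R.
  by rewrite ler_pdivrMr// -natrM ler_nat; lia.
have lm : c * (n%:R / 2) `^ A <= lagn A m.
  apply: le_trans (hc m m0); rewrite ler_pM2l//.
  by apply: ge0_ler_powR => //; rewrite nnegrE// divr_ge0.
have n2 : 0 < c * (n%:R / 2) `^ A by rewrite mulr_gt0// powR_gt0// divr_gt0// ltr0n.
rewrite ler_pdivrMr ?lagn_gt0//.
apply: (@le_trans _ _ (C ^+ 2)).
  by rewrite -real_normK ?num_real// lerXn2r ?nnegrE.
apply: (@le_trans _ _ (C ^+ 2 * (2 `^ A / c) * n%:R `^ (- A) * (c * (n%:R / 2) `^ A))); last first.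
  rewrite ler_wpM2l// mulr_ge0 ?powR_ge0// mulr_ge0 ?sqr_ge0//.
  by rewrite divr_ge0 ?powR_ge0// ltW.
rewrite powRN powR_div//; apply: le_of_eq.
by field; rewrite !gt_eqF ?powR_gt0// ltr0n.
Qed.

(* Bandedness hypothesis on [q]: only the [J + 1] top coefficients of [q] in the
   basis [lag A] are nonzero. The factor [prod (m - n + i)] in the coefficients
   of [g] removes all of them but the leading one. *)
Lemma test_poly (J i0 : nat) : 0 <= A -> exists w C, 0 < C /\
  forall n K, (0 < K)%N -> (w * K <= n)%N -> exists g : {poly R},
  [/\ forall q : {poly R}, (size q <= n.+1)%N ->
        (forall m, (m + J < n)%N -> Lint A (lag A m * q) = 0) ->
        Lint A (g * q) = (-1) ^+ n * q`_n * n`!%:R,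
      Lint A (g * g) <= C * K%:R ^+ (2 * J).+1 * n%:R `^ (- A) &
      Lint A ('X^i0 * g * ('X^i0 * g)) <=
        C * (n%:R / K%:R ^+ 2) ^+ (2 * i0) * K%:R ^+ (2 * J).+1 * n%:R `^ (- A)].
Proof.
move=> A0.
have [w0 [C0 h0]] := smooth_at_bump_poly i0.*2 J.
have [w1 [C1 h1]] := smooth_at_iter_mulXseq i0 0 w0 C0.
have [[c c'] /= [c0 _] hc] := lagn_power_like A1.
have hc' m : (0 < m)%N -> c * m%:R `^ A <= lagn A m by move=> /hc/andP[].
pose D := fun w C : R => (2 * w + 1) * ((J`!%:R^-1 * C) ^+ 2 * (2 `^ A / c)).
have D0 w C : 0 <= w -> 0 <= D w C.
  move=> w0'; rewrite /D mulr_ge0//; first by move: w0' => ?; lra.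
  by rewrite mulr_ge0 ?sqr_ge0// divr_ge0 ?powR_ge0// ltW.
(* This factor keeps both windows, w0 K and w1 K, within n / 2 and leaves room for i0
   multiplications by X. *)
exists (2 * (w0 + w1 + i0)).+1%N, (D w0%:R C0 + D w1%:R C1 + 1); split.
  by rewrite ltr_wpDl// addr_ge0 ?D0.
move=> n K K0 wKn.
have Kn : (K <= n)%N by apply: leq_trans wKn; rewrite leq_pmull.
have n0 : (0 < n)%N by exact: leq_trans Kn.
have KR : 0 < K%:R :> R by rewrite ltr0n.
have nR : 0 < n%:R :> R by rewrite ltr0n.
have f0 : 0 < J`!%:R :> R by rewrite ltr0n fact_gt0.
(* The factor s restores the value 1 at 0 and is the source of K^(2J) in the bounds. The 2 i0 orders
   of smoothness are spent on i0 multiplications by X. *)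
pose B := bump_poly R K i0.*2 J; pose s : R := K%:R ^+ J / J`!%:R.
have s0 : 0 < s by rewrite divr_gt0 ?exprn_gt0.
pose b t := s * B t.
have sB : smooth_at K (i0.*2 + 0) w0 C0 B by rewrite addn0; exact: h0.
have [hB suppB] := sB.
have suppb t : (w0 * K < `|t|)%N -> b t = 0 by move=> /suppB; rewrite /b => ->; rewrite mulr0.
(* One estimate for both norms, used with i = 0 and i = i0. *)
have bnd (i w : nat) (C : R) : smooth_at K 0 w C
      (fun t => (K%:R ^+ 2 / n%:R) ^+ i * iter i (mulXseq n) B t) ->
    (2 * (w * K) <= n)%N ->
    Lint A (lag_series n (iter i (mulXseq n) b) * lag_series n (iter i (mulXseq n) b)) <=
    D w%:R C * (n%:R / K%:R ^+ 2) ^+ (2 * i) * K%:R ^+ (2 * J).+1 * n%:R `^ (- A).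
  move=> hsm wn; have C0' := smooth_at_ge0 hsm; have [/(_ 0%N isT) h hs] := hsm.
  have eb t : iter i (mulXseq n) b t = s * iter i (mulXseq n) B t.
    elim: i {hsm hs h} t => [//|i IH] t.
    by rewrite /= -mulXseqZ; congr mulXseq; apply/funext.
  have supp t : (w * K < `|t|)%N -> iter i (mulXseq n) b t = 0.
    move=> /hs /eqP; rewrite mulf_eq0 expf_eq0 mulf_eq0 invr_eq0 expf_eq0 /=.
    by rewrite (gt_eqF KR) (gt_eqF nR) andbF /= eb => /eqP->; rewrite mulr0.
  have hb t : `|iter i (mulXseq n) b t| <= s * (n%:R / K%:R ^+ 2) ^+ i * C.
    rewrite eb normrM gtr0_norm// -mulrA ler_pM2l//.
    have := h t; rewrite expr0 divr1 /difn /= normrM ger0_norm ?exprn_ge0 ?divr_ge0 ?exprn_ge0//.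
    rewrite -[n%:R / _]invf_div exprVn ler_pdivlMl//.
    by rewrite exprn_gt0// divr_gt0// exprn_gt0.
  apply: le_trans (lag_series_sqr_le A0 c0 hc' n0 wn _ hb supp) _.
    by rewrite !mulr_ge0 ?(ltW s0) ?exprn_ge0 ?divr_ge0 ?exprn_ge0.
  rewrite mulrA ler_wpM2r ?powR_ge0//.
  have hw : (2 * (w * K)).+1%:R <= (2 * w%:R + 1) * K%:R :> R.
    have -> : (2 * w%:R + 1) * K%:R = (2 * (w * K) + K)%:R :> R.
      by rewrite natrD !natrM; ring.
    by rewrite ler_nat; lia.
  have -> : D w%:R C * (n%:R / K%:R ^+ 2) ^+ (2 * i) * K%:R ^+ (2 * J).+1 =
    (2 * w%:R + 1) * K%:R * ((s * (n%:R / K%:R ^+ 2) ^+ i * C) ^+ 2 * (2 `^ A / c)).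
    have -> : (n%:R / K%:R ^+ 2) ^+ (2 * i) = ((n%:R / K%:R ^+ 2) ^+ i) ^+ 2 :> R.
      by rewrite mulnC exprM.
    have -> : K%:R ^+ (2 * J).+1 = K%:R * (K%:R ^+ J) ^+ 2 :> R.
      by rewrite exprS mulnC exprM.
    by rewrite /D /s; ring.
  by rewrite ler_wpM2r// mulr_ge0 ?sqr_ge0// divr_ge0 ?powR_ge0// ltW.
have DC0 : 0 <= D w0%:R C0 by exact: D0.
have DC1 : 0 <= D w1%:R C1 by exact: D0.
have ext (x y : R) : 0 <= y -> x <= D w0%:R C0 * y \/ x <= D w1%:R C1 * y ->
    x <= (D w0%:R C0 + D w1%:R C1 + 1) * y.
  by move=> y0 [] h; apply: le_trans h _; rewrite ler_wpM2r//; lra.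
exists (lag_series n b); split.
- move=> q sq hq; rewrite Lint_lag_series_lag.
  have n2 : (n < (2 * n).+1)%N by lia.
  rewrite (bigD1 (Ordinal n2))//= big1 ?addr0.
    rewrite subrr /b /B bump_poly0// mulrC [lag A n * q]mulrC (Lint_lagl A1)//.
    rewrite /s /lagn; have G0 := Gamma1_gt0 (gtN1_addn A1 n).
    by field; rewrite !gt_eqF ?exprn_gt0// ltr0n fact_gt0.
  move=> m /eqP mn; have mn' : m <> n :> nat by move=> e; apply: mn; exact: val_inj.
  have [mn1|mn1] := ltnP n m.
    rewrite [lag A m * q]mulrC (Lint_lagl A1); last by rewrite (leq_trans sq)// ltnS ltnW.
    by rewrite nth_default ?(leq_trans sq)// mulr0 mul0r mulr0.
  have [mJ|mJ] := ltnP (m + J) n; first by rewrite hq// mulr0.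
  rewrite /b (_ : m%:Z - n%:Z = - (n - m)%N%:Z); last lia.
  by rewrite /B bump_poly_root ?mulr0 ?mul0r//; lia.
- rewrite -mulrA; apply: ext; first by rewrite mulr_ge0 ?powR_ge0 ?exprn_ge0.
  left; have := bnd 0%N w0 C0; rewrite muln0 expr0 mulr1 mulrA; apply; last by nia.
  rewrite (_ : (fun t => _) = B); last by apply/funext => t; rewrite mul1r.
  apply: smooth_at_weaken sB => //; lia.
- have vn : (w0 * K + i0 <= n)%N by nia.
  rewrite (mulXn_lag_series vn suppb).1 -!mulrA; apply: ext.
    by rewrite !mulr_ge0 ?powR_ge0 ?exprn_ge0 ?divr_ge0 ?exprn_ge0.
  right; have := bnd i0 w1 C1; rewrite !mulrA; apply; last by nia.
  by apply: h1.
Qed.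

End LaguerreSeries.
Lemma continuous_powR_at (R : realType) (b x : R) : 0 < x ->
  {for x, continuous (fun t : R => t `^ b)}.
Proof.
move=> x0; have h := is_derive1_powR b x0.
by apply/differentiable_continuous/derivable1_diffP; exact: ex_derive.
Qed.

(** * Upper bounds for weighted norms *)

Section NormUpperBound.
Variable R : realType.
Local Notation mu := (@lebesgue_measure R).
Local Notation pos := (`]0, +oo[%classic : set (measurableTypeR R)).

Lemma measurable_pos : measurable pos.
Proof. exact: measurable_itv. Qed.

(** The density 1/x with cut-offs: constant below u, decaying like v / x^2 beyond v. Its mass is
    bounded when u = v, a single scale, and logarithmic when u = 1/n and v = n. *)
Definition rho (u v x : R) : R :=
  Num.min (Num.min u^-1 (x `^ (-1))) (v * x `^ (- 2)).

Lemma measurable_rho u v (D : set (measurableTypeR R)) : measurable_fun D (rho u v).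
Proof.
apply: (measurable_funS measurableT) => //.
apply: measurable_minr; last first.
  by apply: measurable_funM => //; exact: measurable_powR.
by apply: measurable_minr => //; exact: measurable_powR.
Qed.

Lemma rho_ge0 (u v x : R) : 0 < u -> 0 < v -> 0 <= rho u v x.
Proof.
move=> u0 v0.
by rewrite !le_min invr_ge0 (ltW u0) powR_ge0 mulr_ge0 ?powR_ge0 ?ltW.
Qed.

Lemma integral_inv_itv (u v : R) : 0 < u -> u < v ->
  (\int[mu]_(x in `[u, v]) (x `^ (-1))%:E)%E = (ln (v / u))%:E.
Proof.
move=> u0 uv; have v0 := lt_trans u0 uv.
have -> : ln (v / u) = ln v - ln u by rewrite lnM ?posrE ?invr_gt0// lnV ?posrE.
apply: (@FTC_itv R (@ln R) _ _ _ uv).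
- move=> x /andP[x1 _]; have x0 := lt_trans u0 x1.
  by rewrite powR_inv1 ?(ltW x0)//; exact: is_derive1_ln.
- by move=> x /andP[x1 _]; apply: continuous_ln; exact: lt_le_trans x1.
- move=> x /andP[x1 _]; apply: continuous_powR_at; exact: lt_le_trans x1.
Qed.

Lemma integral_powRN2 (v : R) : 0 < v ->
  (\int[mu]_(x in `[v, +oo[) (x `^ (- 2))%:E)%E = (v^-1)%:E.
Proof.
move=> v0.
rewrite (@ge0_continuous_FTC2y _ _ (fun x => - x `^ (-1)) v 0).
- by rewrite sub0e -EFinN opprK powR_inv1// ltW.
- by move=> x _; exact: powR_ge0.
- apply: continuous_subspace_itv => x; rewrite in_itv /= andbT => vx.
  by apply: continuous_powR_at; exact: lt_le_trans vx.
- rewrite -[X in _ --> X]oppr0; apply: cvgN.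
  apply: (@squeeze_cvgr _ _ _ _ (fun=> 0) (fun x => x^-1)).
  + near=> x; rewrite powR_ge0/= powR_inv1//.
  + exact: cvg_cst.
  + apply/(@gtr0_cvgV0 R R (pinfty_nbhs R) _ id); last exact: cvg_id.
    by near=> x; near: x; exact: nbhs_pinfty_gt.
- move=> x vx; have h := is_derive1_powR (- 1) (lt_trans v0 vx).
  by apply: derivableN; exact: ex_derive.
- by apply: cvgN; apply: cvg_at_right_filter; exact: (@continuous_powR_at R (-1) v v0).
- move=> x; rewrite in_itv /= andbT => vx.
  have h := is_derive1_powR (- 1) (lt_trans v0 vx).
  have h2 : is_derive x (1 : R) (fun x => - x `^ (-1)) (- (-1 * x `^ (-1 - 1))).
    exact: is_deriveN.
  by rewrite derive1E derive_val mulN1r opprK; congr (_ `^ _); ring.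
Unshelve. all: by end_near. Qed.

Lemma integral_rho (u v : R) : 0 < u -> u <= v ->
  (\int[mu]_(x in pos) (rho u v x)%:E <= (2 + ln (v / u))%:E)%E.
Proof.
move=> u0 uv; have v0 := lt_le_trans u0 uv.
have r0 x : (0 <= (rho u v x)%:E)%E by rewrite lee_fin rho_ge0.
have mr (D : set (measurableTypeR R)) : measurable_fun D (EFin \o rho u v).
  by apply/measurable_EFinP; exact: measurable_rho.
have -> : pos = `]0, u]%classic `|` `]u, v]%classic `|` `]v, +oo[%classic :> set _.
  apply/seteqP; split=> x /=; rewrite !in_itv /= !andbT.
    by move=> x0; have [xu|ux] := leP x u; [left; left; rewrite x0|have [xv|vx] := leP x v; [left; right|right]].
  by move=> [[/andP[]//|/andP[ux _]]|vx]; [exact: lt_trans ux|exact: lt_trans vx].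
have m1 : measurable (`]0, u]%classic : set (measurableTypeR R)) by exact: measurable_itv.
have m2 : measurable (`]u, v]%classic : set (measurableTypeR R)) by exact: measurable_itv.
have m3 : measurable (`]v, +oo[%classic : set (measurableTypeR R)) by exact: measurable_itv.
rewrite ge0_integral_setU//; last 2 first.
- exact: measurableU.
- apply/disj_setPLR => x /= [] /=; rewrite !in_itv /= andbT => /andP[_ h]; apply/negP.
    by rewrite -leNgt (le_trans h).
  by rewrite -leNgt.
rewrite ge0_integral_setU//; last first.
  by apply/disj_setPLR => x /=; rewrite !in_itv /= => /andP[_ h] /andP[]; rewrite ltNge h.
have b1 : (\int[mu]_(x in `]0%R, u]) (rho u v x)%:E <= 1%:E)%E.
  apply: (@le_trans _ _ (\int[mu]_(x in `]0%R, u]) (u^-1)%:E)%E).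
    apply: ge0_le_integral => //= x _.
    by rewrite lee_fin /rho !ge_min lexx.
  rewrite integral_cst//= lebesgue_measure_itv/= lte_fin u0 oppr0 adde0.
  by rewrite -EFinM mulVf// gt_eqF.
have b2 : (\int[mu]_(x in `]u, v]) (rho u v x)%:E <= (ln (v / u))%:E)%E.
  move: uv; rewrite le_eqVlt => /predU1P[uv|uv].
    rewrite uv divff ?gt_eqF// ln1 (_ : `]v, v]%classic = set0) ?integral_set0//.
    by apply/seteqP; split => x //=; rewrite in_itv/= => /andP[h1 h2]; have := lt_le_trans h1 h2; rewrite ltxx.
  rewrite -integral_inv_itv//.
  apply: (@le_trans _ _ (\int[mu]_(x in `]u, v]) (x `^ (-1))%:E)%E).
    apply: ge0_le_integral => //=.
      by apply/measurable_EFinP; exact: measurable_powR_on.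
    by move=> x _; rewrite lee_fin /rho !ge_min lexx orbT.
  apply: ge0_subset_integral => //=.
  - by apply/measurable_EFinP; exact: measurable_powR_on.
  - by move=> x _; rewrite lee_fin powR_ge0.
  - by move=> x /=; rewrite !in_itv /= => /andP[/ltW -> ->].
have b3 : (\int[mu]_(x in `]v, +oo[) (rho u v x)%:E <= 1%:E)%E.
  apply: (@le_trans _ _ (\int[mu]_(x in `]v, +oo[) (v%:E * (x `^ (-2))%:E))%E).
    apply: ge0_le_integral => //=.
      apply: measurable_funeM.
      by apply/measurable_EFinP; exact: measurable_powR_on.
    by move=> x _; rewrite -EFinM lee_fin /rho !ge_min lexx orbT.
  rewrite ge0_integralZl_EFin ?(ltW v0)//; last 2 first.
  - by move=> x _; rewrite lee_fin powR_ge0.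
  - by apply/measurable_EFinP; exact: measurable_powR_on.
  rewrite integral_itv_obnd_cbnd; last first.
    by apply/measurable_EFinP; exact: measurable_powR_on.
  by rewrite integral_powRN2// -EFinM mulfV// gt_eqF.
apply: le_trans (leeD (leeD b1 b2) b3) _.
by rewrite -!EFinD lee_fin; apply: le_of_eq; ring.
Qed.

(** Young's inequality for the exponents 2/r and 2/(2-r), with constants 1. The two terms agree at a
    = b = Y^(-1/(2-r)); below b the second dominates a^r, above b the first does. *)
Lemma powR_young (r a Y : R) : 1 <= r < 2 -> 0 <= a -> 0 < Y ->
  a `^ r <= a ^+ 2 * Y + Y `^ (- (r / (2 - r))).
Proof.
move=> /andP[r1 r2] a0 Y0; have d0 : 0 < 2 - r by rewrite subr_gt0.
have r0 : 0 < r by exact: lt_le_trans r1.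
pose b := Y `^ (- (2 - r)^-1); have b0 : 0 < b by rewrite powR_gt0.
have br : b `^ r = Y `^ (- (r / (2 - r))).
  by rewrite /b -powRrM; congr (_ `^ _); rewrite mulNr mulrC.
have [ab|ba] := leP a b.
  rewrite (@le_trans _ _ (b `^ r))//; first by rewrite ge0_ler_powR ?nnegrE ?(ltW r0) ?(ltW b0).
  by rewrite br lerDr mulr_ge0 ?sqr_ge0 ?ltW.
have a0' : 0 < a by exact: lt_trans ba.
rewrite (@le_trans _ _ (a ^+ 2 * Y)) ?lerDl ?powR_ge0//.
have -> : a ^+ 2 = a `^ r * a `^ (2 - r).
  by rewrite -(powRD_gt0 _ _ a0')// addrCA subrr addr0 powR_mulrn.
rewrite -mulrA ler_peMr ?powR_ge0//.
have : b `^ (2 - r) <= a `^ (2 - r) by rewrite ge0_ler_powR ?nnegrE ?(ltW d0) ?(ltW b0) ?(ltW ba).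
rewrite /b -powRrM mulNr mulVf ?gt_eqF// powR_inv1 ?(ltW Y0)// => h.
by rewrite -ler_pdivrMr// div1r.
Qed.

Variables (alpha e : R).

(** The weight is split into a factor raised to the power r and a fixed x^e. For r = 2 the product
    is the Laguerre weight whatever e is ([sqr_wgt]), so both choices of beta rest on the same L^2
    information. *)
Definition wgt (x : R) : R := x `^ ((alpha - e) / 2) * expR (- (x / 2)).

Definition pnorm (r : R) (h : R -> R) : \bar R :=
  (\int[mu]_(x in pos) ((`|h x| * wgt x) `^ r * x `^ e)%:E)%E.

Lemma wgt_ge0 x : 0 <= wgt x. Proof. by rewrite mulr_ge0 ?powR_ge0 ?expR_ge0. Qed.

Lemma measurable_wgt (D : set (measurableTypeR R)) : measurable_fun D wgt.
Proof.
apply: (measurable_funS measurableT) => //.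
apply: measurable_funM; first exact: measurable_powR.
apply: measurableT_comp => //; apply: measurableT_comp => //.
exact: measurable_funM.
Qed.

Lemma sqr_wgt x : 0 < x -> wgt x ^+ 2 * x `^ e = x `^ alpha * expR (- x).
Proof.
move=> x0; rewrite /wgt exprMn -expRM_natl -powR_mulrn ?powR_ge0// -powRrM.
rewrite divfK ?pnatr_eq0// mulrAC -(powRD_gt0 _ _ x0)// subrK.
by congr (_ * expR _); field.
Qed.

Lemma measurable_pnorm_integrand r (h : R -> R) (D : set (measurableTypeR R)) :
  measurable_fun D h ->
  measurable_fun D (fun x : R => (`|h x| * wgt x) `^ r * x `^ e).
Proof.
move=> mh; apply: measurable_funM; last first.
  by exact: measurable_powR_on.
apply: (@measurableT_comp _ _ _ _ _ _ (fun x => x `^ r)); first exact: measurable_powR.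
apply: measurable_funM; last exact: measurable_wgt.
exact: measurableT_comp.
Qed.

(* Weighted Hoelder: [|F|^r <= F^2 Y + Y^(-r/(2-r))] pointwise, with [Y = l V]. *)
Lemma pnorm_weight_le (r : R) (J : nat) (F Pt : {poly R}) (V rh : R -> R) (B D : R) :
  -1 < alpha -> 1 <= r < 2 -> 0 < B -> 0 < D ->
  measurable_fun pos V -> measurable_fun pos rh ->
  (forall x, 0 < x -> 0 < V x) -> (forall x, 0 < x -> 0 <= rh x) ->
  (forall x, 0 < x -> F.[x] ^+ 2 * V x <= Pt.[x] * x ^+ J) ->
  (forall x, 0 < x -> V x `^ (- (r / (2 - r))) * x `^ e <= rh x) ->
  Lint (alpha + J%:R) Pt <= B ->
  (\int[mu]_(x in pos) (rh x)%:E <= D%:E)%E ->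
  (pnorm r (horner F) <= (2 * (B `^ (r / 2) * D `^ (1 - r / 2)))%:E)%E.
Proof.
move=> a1 r12 B0 D0 mV mrh V0 rh0 FV Vrh PB rhD.
have /andP[r1 r2] := r12; have d0 : 0 < 2 - r by rewrite subr_gt0.
have A1 : -1 < alpha + J%:R by exact: gtN1_addn.
(* This l balances the two terms: l B and l^(-k) D both equal B^(r/2) D^(1 - r/2). *)
pose k := r / (2 - r); pose l := (D / B) `^ ((2 - r) / 2).
have l0 : 0 < l by rewrite powR_gt0// divr_gt0.
have e1 : 1 - r / 2 = (2 - r) / 2 by field.
have split_powR (z : R) : 0 < z -> z = z `^ (r / 2) * z `^ ((2 - r) / 2).
  move=> z0; rewrite -(powRD_gt0 _ _ z0)// -mulrDl addrC subrK.
  by rewrite divff ?pnatr_eq0// powRr1 ?(ltW z0).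
have lB : l * B = B `^ (r / 2) * D `^ (1 - r / 2).
  rewrite /l powR_div ?(ltW D0) ?(ltW B0)// e1 [X in _ * X](split_powR _ B0).
  by field; rewrite gt_eqF ?powR_gt0.
have lk : l `^ (- k) * D = B `^ (r / 2) * D `^ (1 - r / 2).
  have -> : l `^ (- k) = B `^ (r / 2) / D `^ (r / 2).
    rewrite /l -powRrM (_ : _ * - k = - (r / 2)); last first.
      by rewrite /k; field; rewrite gt_eqF.
    rewrite powRN powR_div ?(ltW D0) ?(ltW B0)//.
    by field; rewrite !gt_eqF ?powR_gt0.
  rewrite e1 [X in _ * X](split_powR _ D0).
  by field; rewrite gt_eqF ?powR_gt0.
have mP : measurable_fun pos (fun x : R => Pt.[x] * (x `^ (alpha + J%:R) * expR (- x))).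
  apply: measurable_funM; last exact: measurable_powR_expRN.
  by exact: measurable_horner.
have P0 x : 0 < x -> 0 <= Pt.[x] * (x `^ (alpha + J%:R) * expR (- x)).
  move=> x0; apply: mulr_ge0; last by rewrite mulr_ge0 ?powR_ge0 ?expR_ge0.
  rewrite -(pmulr_lge0 _ (exprn_gt0 J x0)).
  by apply: le_trans (FV x x0); rewrite mulr_ge0 ?sqr_ge0// ltW// V0.
apply: (@le_trans _ _ (\int[mu]_(x in pos)
    (l%:E * (Pt.[x] * (x `^ (alpha + J%:R) * expR (- x)))%:E +
     (l `^ (- k))%:E * (rh x)%:E))%E).
  apply: ge0_le_integral => //.
  - by move=> x _; rewrite lee_fin mulr_ge0 ?powR_ge0.
  - apply/measurable_EFinP; apply: measurable_pnorm_integrand.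
    by exact: measurable_horner.
  - by apply: emeasurable_funD; apply: measurable_funeM; exact/measurable_EFinP.
  - move=> x; rewrite /= in_itv /= andbT => x0.
    rewrite -!EFinM -EFinD lee_fin.
    have a0 : 0 <= `|F.[x]| * wgt x by rewrite mulr_ge0// wgt_ge0.
    have Y0 : 0 < l * V x by rewrite mulr_gt0// V0.
    have h := powR_young r12 a0 Y0.
    apply: le_trans (_ : ((`|F.[x]| * wgt x) ^+ 2 * (l * V x) + (l * V x) `^ (- k)) * x `^ e <= _).
      by rewrite ler_wpM2r ?powR_ge0.
    rewrite mulrDl; apply: lerD.
      have -> : (`|F.[x]| * wgt x) ^+ 2 * (l * V x) * x `^ e =
          l * (F.[x] ^+ 2 * V x * (wgt x ^+ 2 * x `^ e)).
        by rewrite exprMn real_normK ?num_real//; ring.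
      rewrite sqr_wgt// ler_pM2l// (powRD_gt0 _ _ x0)// powR_mulrn ?(ltW x0)//.
      have -> : Pt.[x] * (x `^ alpha * x ^+ J * expR (- x)) =
        Pt.[x] * x ^+ J * (x `^ alpha * expR (- x)) by ring.
      by rewrite ler_wpM2r ?FV// mulr_ge0 ?powR_ge0 ?expR_ge0.
    rewrite (powRM _ (ltW l0) (ltW (V0 x x0))) -mulrA ler_wpM2l ?powR_ge0//.
    exact: Vrh.
rewrite ge0_integralD//; first last.
- by apply: measurable_funeM; exact/measurable_EFinP.
- by move=> x /=; rewrite in_itv/= andbT => x0; rewrite -EFinM lee_fin mulr_ge0 ?powR_ge0 ?rh0.
- by apply: measurable_funeM; exact/measurable_EFinP.
- by move=> x /=; rewrite in_itv/= andbT => x0; rewrite -EFinM lee_fin mulr_ge0 ?P0 ?(ltW l0).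
rewrite ge0_integralZl_EFin ?(ltW l0)//; first last.
- exact/measurable_EFinP.
- by move=> x /=; rewrite in_itv/= andbT => x0; rewrite lee_fin P0.
rewrite ge0_integralZl_EFin ?powR_ge0//; first last.
- exact/measurable_EFinP.
- by move=> x /=; rewrite in_itv/= andbT => x0; rewrite lee_fin rh0.
have -> : (\int[mu]_(x in pos) (Pt.[x] * (x `^ (alpha + J%:R) * expR (- x)))%:E)%E =
    (Lint (alpha + J%:R) Pt)%:E.
  rewrite /Lint /Rintegral fineK//.
  exact: (integrable_fin_num measurable_pos (integrable_poly Pt A1)).
apply: (@le_trans _ _ (l%:E * B%:E + (l `^ (- k))%:E * D%:E)%E).
  apply: leeD; first by rewrite -!EFinM lee_fin ler_pM2l.
  by apply: lee_wpmul2l => //; rewrite lee_fin powR_ge0.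
rewrite -!EFinM -EFinD lB lk lee_fin; apply: le_of_eq; ring.
Qed.

End NormUpperBound.

(** * Test functions at one scale *)

Section TestFunctions.
Variable R : realType.
Local Notation mu := (@lebesgue_measure R).
Local Notation pos := (`]0, +oo[%classic : set (measurableTypeR R)).

(** A penalty of order 1 near y = 1 and large far from it. With y = x / s, the square of x^J g times
    this penalty is a combination of the two squares that [test_poly] controls ([scaled_sqr]); this
    expresses the concentration of x^J g near x = s. *)
Definition scale_wgt (J J' : nat) (y : R) : R := (y ^+ J)^-1 + y ^+ J'.

Lemma scale_wgt_ge1 J J' y : 0 < y -> 1 <= scale_wgt J J' y.
Proof.
move=> y0; have [y1|y1] := leP y 1.
  apply: (@le_trans _ _ (y ^+ J)^-1); last by rewrite lerDl exprn_ge0// ltW.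
  by rewrite invf_ge1 ?exprn_gt0// exprn_ile1// ltW.
apply: (@le_trans _ _ (y ^+ J')); first by rewrite exprn_ege1// ltW.
by rewrite lerDr invr_ge0 exprn_ge0// ltW.
Qed.

Lemma scale_wgt_inv_le (e y : R) J J' : -1 < e -> 0 < y -> (0 < J)%N -> e + 2 <= J'%:R ->
  (scale_wgt J J' y)^-1 * y `^ e <= rho 1 1 y.
Proof.
move=> e1 y0 J0 J'e; have w0 : 0 < scale_wgt J J' y.
  exact: lt_le_trans (scale_wgt_ge1 J J' y0).
have yn : y != 0 by rewrite gt_eqF.
have [y1|y1] := leP y 1.
  apply: (@le_trans _ _ 1); last first.
    have p1 b : b <= 0 -> 1 <= y `^ b by rewrite -(powRr0 y) => b0; rewrite ger_powR ?y0.
    by rewrite /rho invr1 mul1r !le_min lexx /= !p1 ?oppr_le0.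
  apply: (@le_trans _ _ (y `^ (J%:R + e))).
    rewrite powRD ?yn ?implybT// powR_mulrn ?(ltW y0)// ler_wpM2r ?powR_ge0//.
    rewrite -[X in _ <= X]invrK lef_pV2 ?posrE ?invr_gt0 ?exprn_gt0//.
    by rewrite lerDl exprn_ge0// ltW.
  have p1 b : 0 <= b -> y `^ b <= 1 by rewrite -(powRr0 y) => b0; rewrite ger_powR ?y0.
  apply: p1; have : 1 <= J%:R :> R by rewrite ler1n.
  by move: e1 => ? ?; lra.
apply: (@le_trans _ _ (y `^ (- 2))); last first.
  have p1 b : b <= 0 -> y `^ b <= 1 by rewrite -(powRr0 y) => b0; rewrite ler_powR ?(ltW y1).
  by rewrite /rho invr1 mul1r !le_min lexx andbT p1 ?oppr_le0// ler_powR ?(ltW y1)//; lra.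
apply: (@le_trans _ _ (y `^ (- J'%:R + e))); last by rewrite ler_powR ?(ltW y1)//; lra.
rewrite powRD ?yn ?implybT// ler_wpM2r ?powR_ge0// powRN powR_mulrn ?(ltW y0)//.
by rewrite lef_pV2 ?posrE ?exprn_gt0// lerDr invr_ge0 exprn_ge0// ltW.
Qed.

Lemma rho_scale (s x : R) : 0 < s -> 0 < x -> rho s s x = s^-1 * rho 1 1 (x / s).
Proof.
move=> s0 x0; have xs0 : 0 < x / s by rewrite divr_gt0.
have si : 0 <= s^-1 by rewrite invr_ge0 ltW.
rewrite /rho !minr_pMr// invr1 mulr1 mul1r !powR_inv1 ?(ltW x0) ?(ltW xs0)//.
rewrite !powRN !powR_mulrn ?(ltW x0) ?(ltW xs0)//.
by congr (Num.min (Num.min _ _) _); field; rewrite ?gt_eqF.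
Qed.

Definition scaled_sqr (s : R) (J i0 : nat) (g : {poly R}) : {poly R} :=
  s ^+ J *: (g * g) + (s ^+ (2 * i0 - J))^-1 *: ('X^i0 * g * ('X^i0 * g)).

Lemma scaled_sqrE s J i0 g x : 0 < s -> 0 < x -> (J <= 2 * i0)%N ->
  ('X^J * g).[x] ^+ 2 * scale_wgt J (2 * i0 - J) (x / s) = (scaled_sqr s J i0 g).[x] * x ^+ J.
Proof.
move=> s0 x0 Ji; rewrite /scaled_sqr /scale_wgt !(hornerD, hornerZ, hornerM, hornerXn).
have -> : x ^+ i0 * g.[x] * (x ^+ i0 * g.[x]) = x ^+ J * x ^+ (2 * i0 - J) * g.[x] ^+ 2.
  by rewrite -exprD subnKC// mul2n -addnn exprD; ring.
rewrite !expr_div_n; set u := x ^+ J; set v := x ^+ _; set z := s ^+ J; set t := s ^+ _.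
by field; rewrite !gt_eqF ?exprn_gt0.
Qed.

Lemma Lint_scaled_sqr (A s b : R) J i0 g : -1 < A -> 0 < s -> (J <= 2 * i0)%N ->
  Lint A (g * g) <= b -> Lint A ('X^i0 * g * ('X^i0 * g)) <= s ^+ (2 * i0) * b ->
  Lint A (scaled_sqr s J i0 g) <= 2 * (s ^+ J * b).
Proof.
move=> A1 s0 Ji gb g'b; rewrite /scaled_sqr (LintD A1) !(LintZ A1).
rewrite -[2](_ : 1 + 1 = _)// mulrDl !mul1r; apply: lerD.
  by rewrite ler_pM2l// exprn_gt0.
rewrite mulrC ler_pdivrMr ?exprn_gt0//; apply: le_trans g'b _.
by rewrite -{1}(subnKC Ji) exprD; apply: le_of_eq; ring.
Qed.

Lemma scaled_bound (alpha s C : R) (n K J : nat) : (0 < n)%N -> (0 < K)%N ->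
  s = n%:R / K%:R ^+ 2 ->
  s ^+ J * (C * K%:R ^+ (2 * J).+1 * n%:R `^ (- (alpha + J%:R))) =
  C * K%:R * n%:R `^ (- alpha).
Proof.
move=> n0 K0 ->.
have n0' : 0 < n%:R :> R by rewrite ltr0n.
have K0' : 0 < K%:R :> R by rewrite ltr0n.
rewrite opprD (powRD_gt0 _ _ n0')// !powRN powR_mulrn ?(ltW n0')//.
rewrite expr_div_n -exprM exprS; set u := n%:R ^+ J; set v := _ ^+ (2 * J); set z := _ `^ _.
by field; rewrite !gt_eqF ?exprn_gt0 ?powR_gt0.
Qed.

Variables (alpha e : R).
Hypotheses (a1 : -1 < alpha) (e1 : -1 < e).

(** Hoelder at a single scale. As [scale_wgt] >= 1 and r/(2-r) >= 1, its negative power is at most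
    its inverse, which [rho] dominates; by scaling the mass is at most 2 s^(e+1). *)
Lemma pnorm_scaled (r s B : R) J i0 (g : {poly R}) : 1 <= r < 2 -> 0 < s -> 0 < B ->
  (0 < J)%N -> (J <= 2 * i0)%N -> e + 2 <= (2 * i0 - J)%:R ->
  Lint (alpha + J%:R) (scaled_sqr s J i0 g) <= B ->
  (pnorm alpha e r (horner ('X^J * g)) <=
   (2 * (B `^ (r / 2) * (2 * s `^ (e + 1)) `^ (1 - r / 2)))%:E)%E.
Proof.
move=> r12 s0 B0 J0 Ji Je LB.
have se0 : 0 < s `^ (e + 1) by rewrite powR_gt0.
have xs0 x : 0 < x -> 0 < x / s by move=> x0; rewrite divr_gt0.
have W1 x : 0 < x -> 1 <= scale_wgt J (2 * i0 - J) (x / s).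
  by move=> x0; exact/scale_wgt_ge1/xs0.
have W0 x : 0 < x -> 0 < scale_wgt J (2 * i0 - J) (x / s).
  by move=> x0; exact: lt_le_trans (W1 x x0).
apply: (@pnorm_weight_le _ _ _ r J _ (scaled_sqr s J i0 g)
  (fun x => scale_wgt J (2 * i0 - J) (x / s)) (fun x => s `^ (e + 1) * rho s s x)) => //.
- by rewrite mulr_gt0.
- apply: measurable_funD.
    apply: (eq_measurable_fun (fun x : R => (x / s) `^ (- J%:R))).
      move=> x; rewrite inE /= in_itv/= andbT => x0.
      by rewrite powRN powR_mulrn ?(ltW (xs0 x x0)).
    apply: (measurable_funS measurableT) => //.
    apply: (@measurableT_comp _ _ _ _ _ _ (fun x => x `^ (- J%:R))); first exact: measurable_powR.
    exact: measurable_funM.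
  by apply: (measurable_funS measurableT) => //; apply: measurable_funX; exact: measurable_funM.
- by apply: measurable_funM => //; exact: measurable_rho.
- by move=> x x0; rewrite mulr_ge0 ?rho_ge0// ltW.
- by move=> x x0; rewrite scaled_sqrE.
- move=> x x0; rewrite rho_scale// (powRD_gt0 _ _ s0)// powRr1 ?(ltW s0)//.
  have -> : s `^ e * s * (s^-1 * rho 1 1 (x / s)) = s `^ e * rho 1 1 (x / s).
    by field; rewrite gt_eqF.
  have -> : x `^ e = s `^ e * (x / s) `^ e.
    by rewrite -powRM ?(ltW s0) ?(ltW (xs0 x x0))//; congr (_ `^ _); field; rewrite gt_eqF.
  rewrite mulrCA ler_pM2l ?powR_gt0//.
  apply: le_trans (scale_wgt_inv_le e1 (xs0 x x0) J0 Je).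
  rewrite ler_wpM2r ?powR_ge0// -(powR_inv1 (ltW (W0 x x0))) ler_powR ?W1//.
  case/andP: r12 => r1 r2; rewrite lerN2 ler_pdivlMr ?subr_gt0//; lra.
- rewrite (_ : (fun x => _) = fun x => ((s `^ (e + 1))%:E * (rho s s x)%:E)%E)//.
  rewrite ge0_integralZl_EFin ?(ltW se0)//; first last.
  + by apply/measurable_EFinP; exact: measurable_rho.
  + by move=> x _; rewrite lee_fin rho_ge0.
  rewrite EFinM muleC; apply: lee_wpmul2r; first by rewrite lee_fin ltW.
  by apply: le_trans (integral_rho s0 (lexx _)) _; rewrite divff ?gt_eqF// ln1 addr0.
Qed.
Definition coef_dual (J n : nat) (g : {poly R}) := forall q : {poly R}, (size q <= n.+1)%N ->
  (forall m, (m + J < n)%N -> Lint (alpha + J%:R) (lag (alpha + J%:R) m * q) = 0) ->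
  Lint (alpha + J%:R) (g * q) = (-1) ^+ n * q`_n * n`!%:R.

(* Up to sign, [X^J g] pairs with [q_n] to [n!] times its leading coefficient;
   [rate n] bounds the size of [X^J g]. *)
Definition dual_family (r : R) (J : nat) (rate : nat -> R) := exists C, 0 < C /\
  forall n, (0 < n)%N -> exists g, coef_dual J n g /\
    (pnorm alpha e r (horner ('X^J * g)) <= ((C * rate n) `^ r)%:E)%E.

(** The finitely many n below the threshold are absorbed into the constant, one at a time. *)
Lemma from_eventually (P : nat -> R -> Prop) (w : nat) :
  (forall n c c', 0 < c -> c <= c' -> P n c -> P n c') ->
  (forall n, (0 < n)%N -> exists c, 0 < c /\ P n c) ->
  (exists C, 0 < C /\ forall n, (0 < n)%N -> (w <= n)%N -> P n C) ->
  exists C, 0 < C /\ forall n, (0 < n)%N -> P n C.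
Proof.
move=> mono each; elim: w => [|w ih] [C [C0 hC]].
  by exists C; split=> // n n0; exact: hC.
apply: ih; case: (posnP w) => [w0|w0].
  by exists C; split=> // n n0 _; apply: hC; rewrite ?w0.
have [c [c0 hc]] := each w w0.
exists (Num.max C c); split; first by rewrite lt_max C0.
move=> n n0; rewrite leq_eqVlt => /predU1P[<-|wn].
  by apply: mono hc => //; rewrite le_max lexx orbT.
by apply: (mono _ _ _ C0 _ (hC n n0 wn)); rewrite le_max lexx.
Qed.

Lemma exists_large_power (J : nat) :
  exists i0, [/\ (J <= 2 * i0)%N, e + 2 <= (2 * i0 - J)%:R & (3 <= 2 * i0 - J)%N].
Proof.
pose m := Num.Def.archi_bound `|e + 2|; exists (m + J + 2)%N; split; [lia| |lia].
have h : e + 2 <= m%:R by rewrite (le_trans (ler_norm _))// ltW// archi_boundP.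
by apply: le_trans h _; rewrite ler_nat; lia.
Qed.

Lemma alphaJ_gt0 J : (0 < J)%N -> 0 < alpha + J%:R.
Proof.
by rewrite -(ler1n R) => h; rewrite -[0](subrr 1) addrC ltr_leD// -[X in _ < X]opprK ltrN2.
Qed.

Lemma powR_rootM (r c z : R) : 1 <= r -> 0 <= c -> 0 <= z -> (c `^ r^-1 * z) `^ r = c * z `^ r.
Proof.
move=> r1 c0 z0; have r0 : 0 < r by exact: lt_le_trans r1.
by rewrite powRM ?powR_ge0// -powRrM mulVf ?gt_eqF// powRr1.
Qed.

Lemma pnorm_XnM_fin (r : R) J (g : {poly R}) : 1 <= r < 2 -> (0 < J)%N ->
  exists y, 0 < y /\ (pnorm alpha e r (horner ('X^J * g)) <= (y `^ r)%:E)%E.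
Proof.
move=> r12 J0; have r0 : 0 < r by case/andP: r12 => r1 _; exact: lt_le_trans r1.
have [i0 [Ji Je _]] := exists_large_power J.
pose B := `|Lint (alpha + J%:R) (scaled_sqr 1 J i0 g)| + 1.
have B0 : 0 < B by rewrite ltr_wpDl.
pose y := 2 * (B `^ (r / 2) * (2 * 1 `^ (e + 1)) `^ (1 - r / 2)).
have y0 : 0 < y by rewrite !mulr_gt0 ?powR_gt0// mulr_gt0// powR_gt0.
exists (y `^ r^-1); split; first by rewrite powR_gt0.
rewrite -powRrM mulVf ?gt_eqF// powRr1 ?(ltW y0)//.
apply: (pnorm_scaled r12 ltr01 B0 J0 Ji Je).
by rewrite /B ler_wpDr// ler_norm.
Qed.

Lemma dual_family_from_eventually (r : R) (J w : nat) (rate : nat -> R) :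
  1 <= r < 2 -> (0 < J)%N -> (forall n, (0 < n)%N -> 0 < rate n) ->
  (exists C, 0 < C /\ forall n, (0 < n)%N -> (w <= n)%N -> exists g, coef_dual J n g /\
    (pnorm alpha e r (horner ('X^J * g)) <= ((C * rate n) `^ r)%:E)%E) ->
  dual_family r J rate.
Proof.
move=> r12 J0 rate0; have /andP[r1 _] := r12.
have r0 : 0 < r by exact: lt_le_trans r1.
have A1 : -1 < alpha + J%:R by exact: gtN1_addn.
pose P n C := (0 < n)%N -> exists g, coef_dual J n g /\
    (pnorm alpha e r (horner ('X^J * g)) <= ((C * rate n) `^ r)%:E)%E.
move=> H; have [] := @from_eventually P w.
- move=> n c c' c0 cc' + n0 => /(_ n0)[g [h1 h2]]; exists g; split=> //.
  have n1 := rate0 n n0.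
  apply: le_trans h2 _; rewrite lee_fin ge0_ler_powR ?nnegrE ?(ltW r0)//.
  - by rewrite mulr_ge0 ?ltW.
  - by rewrite mulr_ge0 ?(ltW n1)// ltW// (lt_le_trans c0).
  - by rewrite ler_pM2r.
- move=> n n0; have rn := rate0 n n0.
  have G0 : 0 < Gamma1 (alpha + J%:R + n%:R) by apply: Gamma1_gt0; exact: gtN1_addn.
  (* For a single n, one rescaled Laguerre polynomial already has the required pairing; its norm
     only has to be finite. *)
  pose g := (n`!%:R / Gamma1 (alpha + J%:R + n%:R)) *: lag (alpha + J%:R) n.
  have [y [y0 hy]] := pnorm_XnM_fin g r12 J0.
  exists (y / rate n); split; first exact: divr_gt0.
  move=> _; exists g; split; last by rewrite divfK ?gt_eqF.
  move=> q sq _; rewrite mulrC /g -scalerAr (LintZ A1) (Lint_lagl A1)//.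
  by field; rewrite gt_eqF.
- by have [C [C0 hC]] := H; exists C; split=> // n n0 wn _; exact: hC.
- by move=> C [C0 hC]; exists C; split=> // n n0; exact: hC.
Qed.

Lemma dual_family_power (r : R) (J : nat) : 1 <= r < 2 -> (0 < J)%N ->
  dual_family r J (fun n => n%:R `^ ((1 - alpha) / 2 - (e + 1) * (r^-1 - 2^-1))).
Proof.
move=> r12 J0; have /andP[r1 r2] := r12.
have r0 : 0 < r by exact: lt_le_trans r1.
have A0 := alphaJ_gt0 J0; have A1 : -1 < alpha + J%:R by exact: gtN1_addn.
have [i0 [Ji Je _]] := exists_large_power J.
have [w [C [C0 hC]]] := test_poly A1 J i0 (ltW A0).
apply: (@dual_family_from_eventually r J w.+1) => //.
  by move=> n n0; rewrite powR_gt0// ltr0n.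
pose c := 2 * ((2 * C) `^ (r / 2) * (2 * (4 * w.+1%:R ^+ 2) `^ (e + 1)) `^ (1 - r / 2)).
have c0 : 0 <= c by rewrite !mulr_ge0 ?powR_ge0.
have c0' : 0 < c by rewrite !mulr_gt0 ?powR_gt0 ?mulr_gt0 ?powR_gt0 ?mulr_gt0 ?exprn_gt0.
exists (c `^ r^-1); split; first by rewrite powR_gt0.
(* K is of order n, so s = n / K^2 is of order 1/n: the squared norm becomes n^(1-alpha) and the
   mass n^(-(e+1)), up to constants. *)
move=> n n0 wn; pose K := (n %/ w.+1)%N.
have K0 : (0 < K)%N by rewrite divn_gt0.
have wK : (w * K <= n)%N.
  by rewrite (leq_trans _ (leq_trunc_div n w.+1))// mulnC leq_mul2l leqnSn orbT.
have Kn : (K <= n)%N by exact: leq_div.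
have nK : (n <= 2 * w.+1 * K)%N.
  apply: leq_trans (ltnW (ltn_ceil n (ltn0Sn w))) _.
  by rewrite mulnAC leq_mul2r mul2n -addnn -[K.+1]addn1 leq_add2l K0 orbT.
have n0' : 0 < n%:R :> R by rewrite ltr0n.
have K0' : 0 < K%:R :> R by rewrite ltr0n.
have [g [gd g1 g2]] := hC n K K0 wK.
exists g; split; first exact: gd.
pose s : R := n%:R / K%:R ^+ 2.
have s0 : 0 < s by rewrite divr_gt0// exprn_gt0.
have sle : s <= 4 * w.+1%:R ^+ 2 * n%:R^-1.
  rewrite /s ler_pdivrMr ?exprn_gt0// mulrAC ler_pdivlMr//.
  have h : n%:R <= 2 * w.+1%:R * K%:R :> R by rewrite -!natrM ler_nat.
  have -> : 4 * w.+1%:R ^+ 2 * K%:R ^+ 2 = (2 * w.+1%:R * K%:R) ^+ 2 :> R by ring.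
  by rewrite -expr2; apply: lerXn2r => //; rewrite nnegrE ?mulr_ge0// ltW.
have B0 : 0 < 2 * C * n%:R `^ (1 - alpha) by rewrite !mulr_gt0// powR_gt0.
apply: le_trans (@pnorm_scaled r s _ J i0 g r12 s0 B0 J0 Ji Je _) _.
  apply: le_trans (Lint_scaled_sqr (b := C * K%:R ^+ (2 * J).+1 * n%:R `^ (- (alpha + J%:R))) A1 s0 Ji g1 _) _.
    by apply: le_trans g2 _; rewrite /s; apply: le_of_eq; ring.
  rewrite (scaled_bound alpha C J n0 K0 erefl) -[2 * C * _]mulrA ler_pM2l//.
  rewrite -[C * _ * _]mulrA ler_pM2l//.
  rewrite (powRD_gt0 _ _ n0')// powRr1 ?(ltW n0')// ler_wpM2r ?powR_ge0//.
  by rewrite ler_nat.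
rewrite lee_fin powR_rootM ?powR_ge0// /c -[X in _ <= X]mulrA ler_pM2l//.
have -> : (2 * C * n%:R `^ (1 - alpha)) `^ (r / 2) =
    (2 * C) `^ (r / 2) * n%:R `^ ((1 - alpha) * (r / 2)).
  by rewrite [LHS]powRM ?powR_ge0 ?mulr_ge0 ?(ltW C0)// -[in LHS]powRrM.
apply: (@le_trans _ _ ((2 * C) `^ (r / 2) * n%:R `^ ((1 - alpha) * (r / 2)) *
   ((2 * (4 * w.+1%:R ^+ 2) `^ (e + 1)) `^ (1 - r / 2) * n%:R `^ (- ((e + 1) * (1 - r / 2)))))).
  apply: ler_wpM2l; first by rewrite mulr_ge0 ?powR_ge0.
  have -> : n%:R `^ (- ((e + 1) * (1 - r / 2))) = ((n%:R^-1) `^ (e + 1)) `^ (1 - r / 2).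
    by rewrite -powRrM powRN -[n%:R^-1]powR_inv1 ?(ltW n0')// -powRrM mulN1r powRN.
  have p0 (z : R) : 0 <= 2 * z `^ (e + 1) by apply: mulr_ge0 (powR_ge0 _ _).
  rewrite -(powRM _ (p0 _) (powR_ge0 _ _)); apply: ge0_ler_powR.
  - by move: r2 => ?; lra.
  - by rewrite nnegrE p0.
  - by rewrite nnegrE mulr_ge0 ?powR_ge0.
  rewrite -mulrA ler_pM2l// -powRM ?invr_ge0 ?(ltW n0') ?mulr_ge0 ?exprn_ge0//.
  rewrite ge0_ler_powR ?nnegrE ?(ltW s0) ?mulr_ge0 ?exprn_ge0 ?invr_ge0 ?(ltW n0')//.
  by move: e1 => ?; lra.
apply: le_of_eq.
have -> : n%:R `^ ((1 - alpha) / 2 - (e + 1) * (r^-1 - 2^-1)) `^ r =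
    n%:R `^ ((1 - alpha) * (r / 2)) * n%:R `^ (- ((e + 1) * (1 - r / 2))).
  rewrite -powRrM -(powRD_gt0 _ _ n0')//; congr (_ `^ _).
  by field; rewrite gt_eqF.
ring.
Qed.

(** * The critical exponent: superposing dyadic scales *)

Definition hyp_wgt (y : R) : R := y + y^-1.

Lemma hyp_wgt_gt0 y : 0 < y -> 0 < hyp_wgt y.
Proof. by move=> y0; rewrite addr_gt0 ?invr_gt0. Qed.

Lemma hyp_wgt_ge1 y : 0 < y -> 1 <= hyp_wgt y.
Proof.
move=> y0; have [y1|y1] := leP 1 y.
  by rewrite ler_wpDr// invr_ge0 ltW.
by rewrite ler_wpDl ?(ltW y0)// invf_ge1// ltW.
Qed.

(* [(y + 1/y)^-1 <= psi (4 y) - psi y] with [psi y = 7/3 * y / (y + 1)], so the sum telescopes. *)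
Lemma sum_hyp_wgt_inv (t : R) m : 0 < t ->
  \sum_(0 <= k < m) (hyp_wgt (4 ^+ k * t))^-1 <= 7 / 3.
Proof.
move=> t0; pose psi (k : nat) : R := 7 / 3 * (4 ^+ k * t / (4 ^+ k * t + 1)).
have y0 k : 0 < 4 ^+ k * t by rewrite mulr_gt0// exprn_gt0.
apply: (@le_trans _ _ (\sum_(0 <= k < m) (psi k.+1 - psi k))).
  apply: ler_sum => k _; rewrite /psi exprS -[4 * _ * t]mulrA; move: (y0 k).
  set y := _ * t => y00.
  have q1 : 0 < y + 1 by rewrite addr_gt0.
  have q2 : 0 < 4 * y + 1 by rewrite addr_gt0// mulr_gt0.
  have q3 : 0 < y ^+ 2 + 1 by rewrite ltr_wpDl// sqr_ge0.
  rewrite -mulrBr -subr_ge0.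
  have -> : 7 / 3 * (4 * y / (4 * y + 1) - y / (y + 1)) - (hyp_wgt y)^-1 =
     y * (3 * y ^+ 2 - 5 * y + 6) / ((4 * y + 1) * (y + 1) * (y ^+ 2 + 1)).
    by rewrite /hyp_wgt; field; rewrite !gt_eqF.
  apply: divr_ge0; last by rewrite ltW// !mulr_gt0.
  rewrite pmulr_rge0//; have := sqr_ge0 (y - 1); clear -y00; nra.
rewrite telescope_sumr// /psi.
have h k : 0 <= 4 ^+ k * t / (4 ^+ k * t + 1) <= 1.
  have h1 : 0 < 4 ^+ k * t + 1 by rewrite addr_gt0.
  apply/andP; split; first by apply: divr_ge0; exact: ltW.
  by rewrite ler_pdivrMr// mul1r lerDl.
by have /andP[? ?] := h m; have /andP[? ?] := h 0%N; lra.
Qed.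

(** Weighted Cauchy-Schwarz, from a completed square. With [hyp_wgt] as weight, whose inverses have
    bounded sum over the scales, it replaces orthogonality between scales. *)
Lemma sqr_sum_le (f u : nat -> R) (c : R) m : 0 < c -> (forall k, 0 < u k) ->
  \sum_(0 <= k < m) (u k)^-1 <= c ->
  (\sum_(0 <= k < m) f k) ^+ 2 <= c * \sum_(0 <= k < m) f k ^+ 2 * u k.
Proof.
move=> c0 u0 uc; set F := \sum_(0 <= k < m) f k.
have h : 0 <= \sum_(0 <= k < m) u k * (f k - F / c * (u k)^-1) ^+ 2.
  by apply: sumr_ge0 => k _; rewrite mulr_ge0 ?sqr_ge0// ltW.
have e2 : \sum_(0 <= k < m) u k * (f k - F / c * (u k)^-1) ^+ 2 =
  \sum_(0 <= k < m) f k ^+ 2 * u k - 2 * (F / c) * F + (F / c) ^+ 2 * \sum_(0 <= k < m) (u k)^-1.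
  rewrite /F !mulr_sumr -sumrB -big_split /=; apply: eq_bigr => k _.
  by field; rewrite !gt_eqF.
rewrite -ler_pdivrMl// mulrC; move: h; rewrite e2.
have : (F / c) ^+ 2 * \sum_(0 <= k < m) (u k)^-1 <= (F / c) ^+ 2 * c.
  by rewrite ler_wpM2l ?sqr_ge0.
have -> : (F / c) ^+ 2 * c = F ^+ 2 / c by field; rewrite gt_eqF.
have -> : 2 * (F / c) * F = 2 * (F ^+ 2 / c) by field; rewrite gt_eqF.
by move=> ? ?; lra.
Qed.

(** The left side is 1 / (x^2 / s + s); its denominator is at least u, x and x^2 / v. *)
Lemma rho_ge (u v s x : R) : 0 < u -> 0 < v -> 0 < s -> 0 < x -> u <= s -> s <= v ->
  (x * hyp_wgt (x / s))^-1 <= rho u v x.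
Proof.
move=> u0 v0 s0 x0 us sv.
have y0 : 0 < x / s by rewrite divr_gt0.
have h0 := hyp_wgt_gt0 y0; have h1 := hyp_wgt_ge1 y0.
have yi : 0 < (x / s)^-1 by rewrite invr_gt0.
rewrite /rho !le_min powR_inv1 ?(ltW x0)// powRN powR_mulrn ?(ltW x0)//.
apply/andP; split; first (apply/andP; split).
- rewrite lef_pV2 ?posrE ?mulr_gt0//; apply: le_trans us _.
  rewrite /hyp_wgt mulrDr invf_div mulrC -[x * (s / x)]mulrC divfK ?gt_eqF//.
  by rewrite lerDr !mulr_ge0 ?invr_ge0 ?ltW.
- by rewrite lef_pV2 ?posrE ?mulr_gt0// ler_peMr// ltW.
- rewrite -[X in X <= _]mul1r ler_pdivrMr ?mulr_gt0//.
  have -> : v / x ^+ 2 * (x * hyp_wgt (x / s)) = v / s + v / x * (x / s)^-1.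
    by rewrite /hyp_wgt; field; rewrite !gt_eqF.
  apply: (@le_trans _ _ (v / s)); first by rewrite ler_pdivlMr// mul1r.
  by rewrite lerDl mulr_ge0 ?(ltW yi)// divr_ge0 ?ltW.
Qed.

Lemma hyp_wgt_scale_wgt J J' y : 0 < y -> (2 <= J)%N -> (3 <= J')%N ->
  y `^ 2^-1 * hyp_wgt y ^+ 2 <= 4 * scale_wgt J J' y.
Proof.
move=> y0 J2 J3; have yi0 : 0 < y^-1 by rewrite invr_gt0.
have p0 : 0 <= y ^+ J' by rewrite exprn_ge0// ltW.
have q0 : 0 <= (y ^+ J)^-1 by rewrite invr_ge0 exprn_ge0// ltW.
have [y1|y1] := leP y 1.
  have hy : y `^ 2^-1 <= 1.
    have := @ger_powR R y; rewrite y0 y1 => /(_ isT) => h.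
    by have := h 0 2^-1; rewrite powRr0; apply; rewrite invr_ge0.
  have hw : hyp_wgt y <= 2 * y^-1.
    by rewrite /hyp_wgt mulr_natl mulr2n lerD2r (le_trans y1)// invf_ge1.
  have hh : hyp_wgt y ^+ 2 <= 4 * (y ^+ J)^-1.
    apply: (@le_trans _ _ ((2 * y^-1) ^+ 2)).
      by apply: lerXn2r hw; rewrite nnegrE ltW ?hyp_wgt_gt0// mulr_gt0.
    have -> : (2 * y^-1) ^+ 2 = 4 * (y ^+ 2)^-1 by field; rewrite gt_eqF.
    rewrite ler_pM2l// lef_pV2 ?posrE ?exprn_gt0//.
    by rewrite ler_wiXn2l ?(ltW y0).
  apply: (@le_trans _ _ (1 * (4 * (y ^+ J)^-1))).
    by rewrite ler_pM ?powR_ge0 ?sqr_ge0.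
  by rewrite mul1r ler_pM2l// lerDl.
have hy : y `^ 2^-1 <= y.
  rewrite -[X in _ <= X](powRr1 (ltW y0)) ler_powR ?(ltW y1)//.
  by rewrite invf_le1// ler1n.
have hw : hyp_wgt y <= 2 * y.
  rewrite /hyp_wgt mulr_natl mulr2n lerD2l (le_trans _ (ltW y1))// invf_le1// ltW//.
have hh : hyp_wgt y ^+ 2 <= 4 * y ^+ 2.
  have -> : 4 * y ^+ 2 = (2 * y) ^+ 2 by ring.
  by apply: lerXn2r hw; rewrite nnegrE ltW ?hyp_wgt_gt0// mulr_gt0.
apply: (@le_trans _ _ (y * (4 * y ^+ 2))).
  by rewrite ler_pM ?powR_ge0 ?sqr_ge0.
have -> : y * (4 * y ^+ 2) = 4 * y ^+ 3 by ring.
rewrite ler_pM2l// (@le_trans _ _ (y ^+ J'))//; last by rewrite lerDr.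
by rewrite ler_weXn2l// ltW.
Qed.

(* Normalized so that [log_wgt^(-r/(2-r)) * x^e = rho] at the critical exponent,
   where [r/(2-r) = 2 e + 2]. *)
Definition log_wgt (u v x : R) : R := (x `^ e / rho u v x) `^ (2 * e + 2)^-1.

Lemma rho_gt0 (u v x : R) : 0 < u -> 0 < v -> 0 < x -> 0 < rho u v x.
Proof.
by move=> u0 v0 x0; rewrite /rho !lt_min invr_gt0 u0 powR_gt0//= mulr_gt0// powR_gt0.
Qed.

(** The penalty of each single scale pays for the weight common to all scales and for the [hyp_wgt]
    lost in [sqr_sum_le]. By [rho_ge], [log_wgt] is at most x^(1/2) [hyp_wgt] (x / s), where 1/2 =
    (e + 1) / (2 e + 2). *)
Lemma log_wgt_le (u v s x : R) J J' : - 2^-1 < e -> 0 < u -> 0 < s -> 0 < x ->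
  u <= s -> s <= v -> (2 <= J)%N -> (3 <= J')%N ->
  hyp_wgt (x / s) * log_wgt u v x <= 4 * s `^ 2^-1 * scale_wgt J J' (x / s).
Proof.
move=> e12 u0 s0 x0 us sv J2 J3.
have v0 : 0 < v by rewrite (lt_le_trans s0).
have y0 : 0 < x / s by rewrite divr_gt0.
have h0 := hyp_wgt_gt0 y0; have h1 := hyp_wgt_ge1 y0.
have k1 : 1 < 2 * e + 2 by move: e12 => ?; lra.
have k0 : 0 < 2 * e + 2 by exact: lt_trans k1.
have r0 := rho_gt0 u0 v0 x0.
have le1 : log_wgt u v x <= x `^ 2^-1 * hyp_wgt (x / s).
  apply: (@le_trans _ _ ((x `^ (e + 1) * hyp_wgt (x / s)) `^ (2 * e + 2)^-1)).
    rewrite ge0_ler_powR ?nnegrE ?invr_ge0 ?(ltW k0)//.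
    - by rewrite divr_ge0 ?powR_ge0// ltW.
    - by rewrite mulr_ge0 ?powR_ge0// ltW.
    rewrite (powRD_gt0 _ _ x0)// powRr1 ?(ltW x0)// -mulrA ler_pM2l ?powR_gt0//.
    by rewrite invf_ple ?posrE ?mulr_gt0// rho_ge.
  rewrite powRM ?powR_ge0 ?(ltW h0)// -powRrM.
  have -> : (e + 1) * (2 * e + 2)^-1 = 2^-1.
    by field; rewrite gt_eqF//; move: k0 => ?; lra.
  rewrite ler_wpM2l ?powR_ge0// -[X in _ <= X](powRr1 (ltW h0)) ler_powR//.
  by rewrite invf_le1// ltW.
apply: (@le_trans _ _ (hyp_wgt (x / s) * (x `^ 2^-1 * hyp_wgt (x / s)))).
  by rewrite ler_pM2l.
have -> : x `^ 2^-1 = s `^ 2^-1 * (x / s) `^ 2^-1.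
  by rewrite -powRM ?(ltW s0) ?(ltW y0)//; congr (_ `^ _); field; rewrite gt_eqF.
have -> : hyp_wgt (x / s) * (s `^ 2^-1 * (x / s) `^ 2^-1 * hyp_wgt (x / s)) =
  s `^ 2^-1 * ((x / s) `^ 2^-1 * hyp_wgt (x / s) ^+ 2) by ring.
rewrite [4 * _]mulrC -[X in _ <= X]mulrA ler_pM2l ?powR_gt0//.
exact: hyp_wgt_scale_wgt.
Qed.
Lemma coef_dual_avg J n m (g : nat -> {poly R}) : (0 < m)%N ->
  (forall k, (k < m)%N -> coef_dual J n (g k)) ->
  coef_dual J n (m%:R^-1 *: \sum_(0 <= k < m) g k).
Proof.
move=> m0 hg q sq bq; have A1 : -1 < alpha + J%:R by exact: gtN1_addn.
rewrite -scalerAl (LintZ A1) mulr_suml (Lint_sum A1).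
rewrite (eq_big_nat _ _ (F2 := fun=> (-1) ^+ n * q`_n * n`!%:R)); last first.
  by move=> k /andP[_ km]; exact: hg.
set v := (-1) ^+ n * q`_n * n`!%:R.
by rewrite sumr_const_nat subn0 -(mulr_natl v) mulKf// pnatr_eq0 -lt0n.
Qed.

(** Hoelder with one weight for the average of m scales: after [sqr_sum_le] the squares merely add
    up, so the averaged squared norm is of order c / m, while [rho] with cut-offs 1/n and n has mass
    at most 2 + 2 ln n. *)
Lemma pnorm_log (r c : R) J i0 n m (sc : nat -> R) (g : nat -> {poly R}) :
  - 2^-1 < e -> r = (4 * e + 4) / (2 * e + 3) -> (0 < n)%N -> (0 < m)%N -> 0 < c ->
  (2 <= J)%N -> (3 <= 2 * i0 - J)%N ->
  (forall k, sc k = n%:R / 4 ^+ k) ->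
  (forall k, (k < m)%N -> n%:R^-1 <= sc k /\
    sc k `^ 2^-1 * Lint (alpha + J%:R) (scaled_sqr (sc k) J i0 (g k)) <= c) ->
  (pnorm alpha e r (horner ('X^J * (m%:R^-1 *: \sum_(0 <= k < m) g k))) <=
    (2 * ((28 / 3 * c / m%:R) `^ (r / 2) * (2 + 2 * ln n%:R) `^ (1 - r / 2)))%:E)%E.
Proof.
move=> e12 rE n0 m0 c0 J2 J3 scE hsc.
have Ji : (J <= 2 * i0)%N by clear -J3; lia.
have A1 : -1 < alpha + J%:R by exact: gtN1_addn.
have n1 : 1 <= n%:R :> R by rewrite ler1n.
have n0' : 0 < n%:R :> R by rewrite ltr0n.
have m0' : 0 < m%:R :> R by rewrite ltr0n.
have ni0 : 0 < n%:R^-1 :> R by rewrite invr_gt0.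
have d3 : 0 < 2 * e + 3 by move: e12 => ?; lra.
have k0 : 0 < 2 * e + 2 by move: e12 => ?; lra.
have r12 : 1 <= r < 2.
  by rewrite rE ler_pdivlMr// ltr_pdivrMr//; move: e12 => ?; apply/andP; split; lra.
have kE : r / (2 - r) = 2 * e + 2.
  by rewrite rE; field; rewrite !gt_eqF//; lra.
(* 28/3 is 4 times 7/3, the constants of [log_wgt_le] and [sum_hyp_wgt_inv]. *)
pose Pt : {poly R} := \sum_(0 <= k < m)
  (28 / 3 * (m%:R^-1) ^+ 2 * sc k `^ 2^-1) *: scaled_sqr (sc k) J i0 (g k).
have lnn : 0 <= ln n%:R :> R by rewrite ln_ge0.
apply: (@pnorm_weight_le _ _ _ r J _ Pt (log_wgt n%:R^-1 n%:R) (rho n%:R^-1 n%:R)) => //.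
- by rewrite divr_gt0 ?mulr_gt0.
- by rewrite ltr_pwDl// mulr_ge0.
- pose V' (x : R) := x `^ e * Num.max (Num.max n%:R^-1 x) (n%:R^-1 * x ^+ 2).
  apply: (eq_measurable_fun (fun x : R => (V' x) `^ (2 * e + 2)^-1)).
    move=> x; rewrite inE /= in_itv/= andbT => x0; rewrite /log_wgt /V'; congr ((_ * _) `^ _).
    rewrite /rho invrK powR_inv1 ?(ltW x0)// powRN powR_mulrn ?(ltW x0)//.
    have x20 : 0 < n%:R / x ^+ 2 by rewrite divr_gt0// exprn_gt0.
    have inv_min (a b : R) : 0 < a -> 0 < b -> (Num.min a b)^-1 = Num.max a^-1 b^-1.
      move=> a0 b0; have [ab|ba] := leP a b.
        by rewrite max_l// lef_pV2 ?posrE.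
      by rewrite max_r// lef_pV2 ?posrE// ltW.
    rewrite !inv_min ?lt_min ?invr_gt0 ?n0' ?x0// !invrK.
    by congr (Num.max _ _); rewrite invf_div mulrC.
  apply: (measurable_funS measurableT) => //.
  apply: (@measurableT_comp _ _ _ _ _ _ (fun x => x `^ (2 * e + 2)^-1)); first exact: measurable_powR.
  apply: measurable_funM; first exact: measurable_powR.
  apply: measurable_maxr; first exact: measurable_maxr.
  by apply: measurable_funM => //; exact: measurable_funX.
- exact: measurable_rho.
- by move=> x x0; rewrite powR_gt0// divr_gt0 ?powR_gt0// rho_gt0.
- by move=> x x0; rewrite rho_ge0.
- move=> x x0.
  have V0 : 0 < log_wgt n%:R^-1 n%:R x by rewrite powR_gt0// divr_gt0 ?powR_gt0// rho_gt0.
  have -> : ('X^J * (m%:R^-1 *: \sum_(0 <= k < m) g k)).[x] ^+ 2 =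
    m%:R^-1 ^+ 2 * (\sum_(0 <= k < m) ('X^J * g k).[x]) ^+ 2.
    rewrite -scalerAr hornerZ mulr_sumr exprMn; congr (_ * _ ^+ 2).
    exact: horner_sum.
  have -> : Pt.[x] * x ^+ J = \sum_(0 <= k < m) (28 / 3 * m%:R^-1 ^+ 2 * sc k `^ 2^-1) *
      ((scaled_sqr (sc k) J i0 (g k)).[x] * x ^+ J).
    rewrite /Pt horner_sum mulr_suml; apply: eq_bigr => k _.
    by set a := 28 / 3 * _ * _; rewrite hornerZ -mulrA.
  have s0 k : 0 < sc k by rewrite scE divr_gt0// exprn_gt0.
  have y0 k : 0 < x / sc k by rewrite divr_gt0.
  have hS : (\sum_(0 <= k < m) ('X^J * g k).[x]) ^+ 2 <=
      7 / 3 * \sum_(0 <= k < m) ('X^J * g k).[x] ^+ 2 * hyp_wgt (x / sc k).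
    apply: sqr_sum_le => [|k|]; [by rewrite divr_gt0|exact: hyp_wgt_gt0|].
    rewrite (eq_bigr (fun k => (hyp_wgt (4 ^+ k * (x / n%:R)))^-1)).
      by apply: sum_hyp_wgt_inv; rewrite divr_gt0.
    by move=> k _; rewrite scE; congr ((hyp_wgt _)^-1); field; rewrite !gt_eqF ?exprn_gt0.
  apply: (@le_trans _ _ (m%:R^-1 ^+ 2 * (7 / 3 *
     (\sum_(0 <= k < m) ('X^J * g k).[x] ^+ 2 * hyp_wgt (x / sc k))) * log_wgt n%:R^-1 n%:R x)).
    by rewrite ler_pM2r// ler_wpM2l// exprn_ge0// invr_ge0.
  rewrite -!mulrA !(mulr_suml, mulr_sumr) big_nat_cond [X in _ <= X]big_nat_cond.
  apply: ler_sum => k; rewrite andbT => /andP[_ km]; have [ns _] := hsc k km.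
  have sn : sc k <= n%:R by rewrite scE ler_pdivrMr ?exprn_gt0// ler_peMr ?exprn_ege1 ?ler1n.
  rewrite -(scaled_sqrE (g k) (s0 k) x0 Ji).
  have := log_wgt_le e12 ni0 (s0 k) x0 ns sn J2 J3.
  set G := ('X^J * g k).[x]; set W := scale_wgt _ _ _; set H := hyp_wgt _; set Z := log_wgt _ _ _.
  move=> HZ; apply: (@le_trans _ _ (m%:R^-1 ^+ 2 * (7 / 3) * G ^+ 2 * (H * Z))).
    by apply: le_of_eq; field; rewrite gt_eqF.
  apply: (@le_trans _ _ (m%:R^-1 ^+ 2 * (7 / 3) * G ^+ 2 * (4 * sc k `^ 2^-1 * W))).
    apply: ler_wpM2l => //; apply: mulr_ge0; last exact: sqr_ge0.
    by apply: mulr_ge0; [exact: sqr_ge0|rewrite divr_ge0].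
  by apply: le_of_eq; field; rewrite gt_eqF.
- move=> x x0; rewrite kE /log_wgt -powRrM (_ : (2 * e + 2)^-1 * _ = -1); last first.
    by rewrite mulrN mulVf// gt_eqF.
  have r0 := rho_gt0 ni0 n0' x0; have xe0 : 0 < x `^ e by rewrite powR_gt0.
  rewrite powR_inv1 ?divr_ge0 ?(ltW r0) ?(ltW xe0)// invf_div divfK//.
  by rewrite gt_eqF.
- rewrite /Pt (Lint_sum A1).
  apply: (@le_trans _ _ (\sum_(0 <= k < m) 28 / 3 * m%:R^-1 ^+ 2 * c)); last first.
    rewrite sumr_const_nat subn0 -mulr_natl; apply: le_of_eq.
    by field; rewrite gt_eqF.
  rewrite big_nat_cond [X in _ <= X]big_nat_cond.
  apply: ler_sum => k; rewrite andbT => /andP[_ km]; have [_ hk] := hsc k km.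
  have b0 : 0 <= 28 / 3 * m%:R^-1 ^+ 2 :> R by rewrite mulr_ge0 ?sqr_ge0 ?divr_ge0.
  by move: b0; set b := _ * _ ^+ 2 => b0; rewrite (LintZ A1) -[b * _ * _]mulrA ler_wpM2l.
- apply: le_trans (@integral_rho R n%:R^-1 n%:R ni0 _) _.
    by rewrite (le_trans _ n1)// invf_le1.
  by rewrite lee_fin invrK lnM ?posrE// mulr_natl mulr2n.
Qed.

(** With L = ln(n+1), the squared norm is of order n^(1/2-alpha) / L and the mass of order L, so the
    L^r norm contributes L^(1/r - 1), and 1/r - 1 = -(2 e + 1) / (4 e + 4). The condition e > -1/2
    says r > 1. *)
Lemma dual_family_log (J : nat) : - 2^-1 < e -> (2 <= J)%N ->
  dual_family ((4 * e + 4) / (2 * e + 3)) J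
    (fun n => n%:R `^ (4^-1 - alpha / 2) * ln (n.+1)%:R `^ (- ((2 * e + 1) / (4 * e + 4)))).
Proof.
move=> e12 J2; have [r rE] : exists r : R, r = (4 * e + 4) / (2 * e + 3) by eexists.
rewrite -rE.
have J0 : (0 < J)%N by exact: ltnW.
have A0 := alphaJ_gt0 J0; have A1 : -1 < alpha + J%:R by exact: gtN1_addn.
have d3 : 0 < 2 * e + 3 by move: e12 => ?; lra.
have d4 : 0 < 4 * e + 4 by move: e12 => ?; lra.
have r12 : 1 <= r < 2.
  by rewrite rE ler_pdivlMr// ltr_pdivrMr//; move: e12 => ?; apply/andP; split; lra.
have /andP[r1 r2] := r12; have r0 : 0 < r by exact: lt_le_trans r1.
have [i0 [Ji _ J3]] := exists_large_power J.
have [w [C [C0 hC]]] := test_poly A1 J i0 (ltW A0).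
have L0 n : (0 < n)%N -> 0 < ln (n.+1)%:R :> R by move=> n0; rewrite ln_gt0// ltr1n.
have e2 : 1 - r / 2 = (2 - r) / 2 by field.
apply: (@dual_family_from_eventually r J w.+1) => //.
  by move=> n n0; rewrite mulr_gt0 ?powR_gt0 ?ltr0n// L0.
pose b := 28 / 3 * (2 * C) * w.+2%:R.
have b0 : 0 < b by rewrite !mulr_gt0// ?invr_gt0// ltr0n.
pose c := 2 * (b `^ (r / 2) * 6 `^ (1 - r / 2)).
have c0 : 0 < c by rewrite !mulr_gt0 ?powR_gt0.
exists (c `^ r^-1); split; first by rewrite powR_gt0.
(* m counts the k with (w + 1) 2^k <= n, the dyadic scales admissible for [test_poly]. *)
move=> n n0 wn; pose m := (trunc_log 2 (n %/ w.+1)).+1.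
have n0' : 0 < n%:R :> R by rewrite ltr0n.
have nw : (0 < n %/ w.+1)%N by rewrite divn_gt0.
have mK k : (k < m)%N -> (w.+1 * 2 ^ k <= n)%N.
  move=> km; apply: leq_trans (leq_trunc_div n w.+1); rewrite mulnC leq_mul2r.
  by rewrite (leq_trans _ (trunc_logP (isT : (1 < 2)%N) nw)) ?orbT// leq_exp2l.
have ex k : exists g, (k < m)%N -> [/\ coef_dual J n g,
    Lint (alpha + J%:R) (g * g) <= C * (2 ^ k)%:R ^+ (2 * J).+1 * n%:R `^ (- (alpha + J%:R)) &
    Lint (alpha + J%:R) ('X^i0 * g * ('X^i0 * g)) <=
      C * (n%:R / (2 ^ k)%:R ^+ 2) ^+ (2 * i0) * (2 ^ k)%:R ^+ (2 * J).+1 * n%:R `^ (- (alpha + J%:R))].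
  have [km|km] := ltnP k m; last by exists 0.
  have [g hg] := hC n (2 ^ k)%N (expn_gt0 2 k) (leq_trans (leq_mul (leqnSn w) (leqnn _)) (mK k km)).
  by exists g => _.
have [g hg] := choice ex.
exists (m%:R^-1 *: \sum_(0 <= k < m) g k); split.
  by apply: coef_dual_avg => // k km; have [] := hg k km.
pose sc k : R := n%:R / 4 ^+ k.
have K2 k : ((2 ^ k)%:R : R) ^+ 2 = 4 ^+ k.
  by rewrite natrX exprAC -natrX.
have s0 k : 0 < sc k by rewrite divr_gt0// exprn_gt0.
(* Independent of k: the L^2 bound grows like 2^k while sc(k)^(1/2) = n^(1/2) / 2^k, so all scales
   weigh the same. This is what makes the exponent critical. *)
pose c1 := 2 * C * n%:R `^ (2^-1 - alpha).
have c10 : 0 < c1 by rewrite !mulr_gt0// powR_gt0.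
apply: le_trans (@pnorm_log r c1 J i0 n m sc g e12 rE n0 isT c10 J2 J3 (fun=> erefl) _) _.
  move=> k km; have [_ g1 g2] := hg k km; have hK := mK k km.
  split.
    rewrite /sc ler_pdivlMr ?exprn_gt0// ler_pdivrMl// -expr2 -K2.
    apply: lerXn2r; rewrite ?nnegrE// ler_nat.
    by apply: leq_trans hK; rewrite leq_pmull.
  have K0 : (0 < 2 ^ k)%N by rewrite expn_gt0.
  apply: (@le_trans _ _ (sc k `^ 2^-1 * (2 * (C * (2 ^ k)%:R * n%:R `^ (- alpha))))).
    rewrite ler_pM2l ?powR_gt0//.
    rewrite -(scaled_bound alpha C J n0 K0 (erefl (n%:R / (2 ^ k)%:R ^+ 2))) K2.
    apply: Lint_scaled_sqr => //.
    by apply: le_trans g2 _; rewrite K2 /sc; apply: le_of_eq; ring.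
  have -> : sc k `^ 2^-1 = n%:R `^ 2^-1 / (2 ^ k)%:R.
    rewrite /sc -K2 powR_div ?(ltW n0') ?exprn_ge0// -powR_mulrn// -powRrM mulfV ?pnatr_eq0//.
    by rewrite powRr1.
  rewrite /c1 (powRD_gt0 _ _ n0')//; apply: le_of_eq.
  by field; rewrite pnatr_eq0 -lt0n.
rewrite lee_fin powR_rootM ?(ltW c0) ?mulr_ge0 ?powR_ge0//.
set L := ln (n.+1)%:R; have L0' : 0 < L by exact: L0.
have ln2 : 2^-1 <= ln 2 :> R.
  have h : ln (1 - 2^-1) <= - 2^-1 :> R by apply: le_ln1Dx; lra.
  move: h; rewrite (_ : 1 - 2^-1 = 2^-1 :> R); last by field.
  by rewrite lnV ?posrE// lerN2.
have mL : m%:R^-1 <= w.+2%:R / L.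
  rewrite ler_pdivlMr// mulrC ler_pdivrMr ?ltr0n//.
  have h1 : (n.+1 <= 2 ^ m * w.+1)%N.
    apply: leq_trans (ltn_ceil n (ltn0Sn w)) _.
    by rewrite leq_mul2r orbC trunc_log_ltn.
  apply: (@le_trans _ _ (ln (2 ^+ m * w.+1%:R))).
    by rewrite ler_ln ?posrE ?mulr_gt0 ?exprn_gt0 ?ltr0n// -natrX -natrM ler_nat.
  rewrite lnM ?posrE ?exprn_gt0 ?ltr0n// lnXn//.
  have h2 : ln 2 <= 1 :> R by apply: le_trans (@le_ln1Dx R 1 _) _; lra.
  have h3 : ln w.+1%:R <= w%:R :> R.
    by rewrite -natr1 addrC; apply: le_ln1Dx; rewrite (lt_le_trans (ltrN10 R)).
  apply: (@le_trans _ _ (m%:R + w%:R)).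
    by apply: lerD => //; exact: ler_wMn2r.
  by rewrite -natrD -natrM ler_nat mulSn leq_add// -[X in (X <= _)%N]muln1 leq_mul.
have DL : 2 + 2 * ln n%:R <= 6 * L.
  have h1 : ln n%:R <= L by rewrite ler_ln ?posrE ?ltr0n// ler_nat.
  have h2 : ln 2 <= L by rewrite ler_ln ?posrE ?ltr0n// ler_nat.
  by move: h1 h2 ln2; clear; move=> ? ? ?; lra.
rewrite /c -[X in _ <= X]mulrA ler_pM2l//.
apply: (@le_trans _ _ ((b * n%:R `^ (2^-1 - alpha) / L) `^ (r / 2) * (6 * L) `^ (1 - r / 2))).
  apply: ler_pM; rewrite ?powR_ge0//.
    have h1 : 0 <= 28 / 3 * c1 / m%:R by rewrite divr_ge0// mulr_ge0 ?divr_ge0// ltW.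
    have h2 : 0 <= b * n%:R `^ (2^-1 - alpha) / L.
      by apply: divr_ge0 (ltW L0'); apply: mulr_ge0 (powR_ge0 _ _); exact: ltW.
    rewrite ge0_ler_powR ?nnegrE//; first by rewrite divr_ge0// ltW.
    rewrite -[X in X <= _]mulrA; apply: (@le_trans _ _ (28 / 3 * (c1 * (w.+2%:R / L)))).
      by rewrite !ler_pM2l// divr_gt0.
    by rewrite /c1 /b; apply: le_of_eq; ring.
  rewrite ge0_ler_powR ?nnegrE//; first by move: r2 => ?; lra.
  - by rewrite addr_ge0// mulr_ge0// ln_ge0// ler1n.
  - by rewrite mulr_ge0// ltW.
apply: le_of_eq.
have p0 := powR_ge0.
rewrite powR_div ?(ltW L0')//; last by apply: mulr_ge0 (p0 _ _ _); exact: ltW.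
rewrite [(b * _) `^ _]powRM ?(ltW b0) ?p0// [(6 * L) `^ _]powRM ?(ltW L0')//.
rewrite [(n%:R `^ _ * _) `^ r]powRM ?p0// -!powRrM -powRN.
have -> : (2^-1 - alpha) * (r / 2) = (4^-1 - alpha / 2) * r by field.
have -> : - ((2 * e + 1) / (4 * e + 4)) * r = - (r / 2) + (1 - r / 2).
  rewrite rE; field; do ?[apply/andP; split].
    by move: d3; clear => ?; rewrite gt_eqF//; lra.
  by move: d4; clear => ?; rewrite gt_eqF//; lra.
rewrite [X in _ = _ * (_ * X)](powRD_gt0 _ _ L0')//; ring.
Qed.

End TestFunctions.
(** * Orthonormal polynomials, norms and duality *)

Lemma powR_ratio_le (R : realType) (a k m n : R) : 0 < m -> m <= n -> n <= k * m ->
  m `^ a <= k `^ `|a| * n `^ a.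
Proof.
move=> m0 mn nkm; have n0 : 0 < n by exact: lt_le_trans mn.
have nm1 : 1 <= n / m by rewrite ler_pdivlMr// mul1r.
have k1 : n / m <= k by rewrite ler_pdivrMr.
rewrite -ler_pdivrMr ?powR_gt0//.
have -> : m `^ a / n `^ a = (n / m) `^ (- a).
  rewrite powRN powR_div ?(ltW m0) ?(ltW n0)// invf_div//.
apply: (@le_trans _ _ ((n / m) `^ `|a|)).
  by rewrite ler_powR// -normrN ler_norm.
by rewrite ge0_ler_powR ?nnegrE//; [|apply: le_trans k1]; apply: le_trans nm1.
Qed.

Lemma fact_ratio_ge (n k : nat) : (n`! * n.+1 ^ k <= (n + k)`!)%N.
Proof.
elim: k => [|k IH]; first by rewrite expn0 muln1 addn0.
rewrite addnS factS expnSr mulnA mulnC leq_mul//.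
by rewrite ltnS leq_addr.
Qed.

Section SobolevOrthonormal.
Variables (R : realType) (a : R) (N : nat) (M : 'I_N.+1 -> R).
Hypotheses (a1 : -1 < a) (hM : forall j, 0 <= M j).
Variables (L Q : nat -> {poly R}).
Hypotheses (hL : laguerre_polys a L) (hQ : sobolev_polys a M L Q).
Local Notation q := (sobolev_orthonormal a M Q).
Local Notation sf := (sform a M).

(** With m = n - N - 1, the bound of [sobolev_poly_le] is a multiple of (m!/n!)^2 [lagn] (a + 2 N +
    2) m, and n! >= m! m^(N+1) absorbs the surplus power m^(2N+2). *)
Lemma sobolev_norm_le : exists C, 0 < C /\ forall n, (0 < n)%N ->
  sf (Q n) (Q n) <= C * n%:R `^ a.
Proof.
apply: (@from_eventually R (fun n C => sf (Q n) (Q n) <= C * n%:R `^ a) N.+2).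
- move=> n c c' c0 cc' h; apply: le_trans h _.
  by rewrite ler_wpM2r ?powR_ge0.
- move=> n n0; have p0 : 0 < n%:R `^ a by rewrite powR_gt0// ltr0n.
  exists (sf (Q n) (Q n) / n%:R `^ a); split.
    by rewrite divr_gt0// (sobolev_poly_gt0 a1 hM hQ).
  by rewrite divfK// gt_eqF.
have a2 : -1 < a + (2 * N.+1)%:R by exact: gtN1_addn.
have [[c C] /= [_ C0] hC] := lagn_power_like a2.
have G0 := Gamma1_gt0 a1.
pose D := (Gamma1 a)^-1 * C * (N.+2%:R `^ `|a|).
exists D; split; first by rewrite !mulr_gt0 ?invr_gt0 ?powR_gt0 ?ltr0n.
move=> n n0 Nn; apply: le_trans (sobolev_poly_le a1 hM hL hQ (ltnW Nn)) _.
pose m := (n - N.+1)%N; have m0 : (0 < m)%N by rewrite subn_gt0.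
have nE : n = (m + N.+1)%N by rewrite subnK// ltnW.
have m0' : 0 < m%:R :> R by rewrite ltr0n.
have f0 k : 0 < k`!%:R :> R by rewrite ltr0n fact_gt0.
rewrite -/m.
have -> : Gamma1 (a + (n + N.+1)%:R) = lagn (a + (2 * N.+1)%:R) m * m`!%:R.
  rewrite /lagn divfK ?(lt0r_neq0 (f0 m))//; congr (Gamma1 _).
  by rewrite -addrA -natrD; congr (_ + _%:R); rewrite nE; lia.
have /andP[_ hm] := hC m m0.
have hf : m`!%:R * m%:R ^+ N.+1 <= n`!%:R :> R.
  rewrite -natrX -natrM ler_nat [in leqRHS]nE.
  apply: leq_trans (fact_ratio_ge m N.+1).
  by rewrite leq_mul// leq_exp2r.
have -> : D * n%:R `^ a = (Gamma1 a)^-1 * (C * N.+2%:R `^ `|a| * n%:R `^ a) by rewrite /D; ring.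
rewrite ler_pM2l ?invr_gt0//.
apply: (@le_trans _ _ (m`!%:R / n`!%:R ^+ 2 * (C * m%:R `^ (a + (2 * N.+1)%:R) * m`!%:R))).
  by rewrite ler_pM2l ?divr_gt0 ?exprn_gt0// ler_pM2r.
apply: (@le_trans _ _ (C * m%:R `^ a)); last first.
  rewrite -[X in _ <= X]mulrA ler_pM2l//; apply: powR_ratio_le => //.
    by rewrite ler_nat leq_subr.
  by rewrite -natrM ler_nat nE; nia.
rewrite (powRD_gt0 _ _ m0')// powR_mulrn ?(ltW m0')//.
have -> : m`!%:R / n`!%:R ^+ 2 * (C * (m%:R `^ a * m%:R ^+ (2 * N.+1)) * m`!%:R) =
  C * m%:R `^ a * ((m`!%:R * m%:R ^+ N.+1) / n`!%:R) ^+ 2.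
  rewrite mulnC exprM expr_div_n exprMn; field; rewrite gt_eqF//.
rewrite ler_piMr ?mulr_ge0 ?powR_ge0 ?(ltW C0)//.
rewrite exprn_ile1// ?divr_ge0 ?mulr_ge0 ?exprn_ge0//.
by rewrite ler_pdivrMr// mul1r.
Qed.

Lemma orthonormalE n : q n = (sf (Q n) (Q n)) `^ (- 2^-1) *: Q n.
Proof. by rewrite /sobolev_orthonormal sobolev_dot_poly. Qed.

Lemma size_orthonormal n : size (q n) = n.+1.
Proof.
rewrite orthonormalE size_scale ?(size_sobolev_poly hQ)//.
by rewrite gt_eqF// powR_gt0// (sobolev_poly_gt0 a1 hM hQ).
Qed.

Lemma orthonormal_low n (P : {poly R}) : (size P <= n)%N -> sf P (q n) = 0.
Proof.
move=> sP; rewrite orthonormalE sformC (sformZ M a1) (sformC a M (Q n) P).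
by rewrite (sobolev_poly_low a1 hQ sP) mulr0.
Qed.

(** Since [Q n] has leading coefficient (-1)^n / n!, this is the inverse of its Sobolev norm. *)
Definition norm_lead n : R := n`!%:R * `|(q n)`_n|.

Lemma norm_lead_gt0 n : 0 < norm_lead n.
Proof.
rewrite mulr_gt0 ?ltr0n ?fact_gt0// normr_gt0.
have := lead_coef_eq0 (q n); rewrite lead_coefE size_orthonormal /= => ->.
by rewrite -size_poly_eq0 size_orthonormal.
Qed.

Lemma norm_lead_ge : exists c, 0 < c /\ forall n, (0 < n)%N ->
  c * n%:R `^ (- (a / 2)) <= norm_lead n.
Proof.
have [C [C0 hC]] := sobolev_norm_le.
exists (C `^ (- 2^-1)); split; first by rewrite powR_gt0.
move=> n n0; have s0 := sobolev_poly_gt0 a1 hM hQ n.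
have f0 : 0 < n`!%:R :> R by rewrite ltr0n fact_gt0.
have n0' : 0 < n%:R :> R by rewrite ltr0n.
have -> : norm_lead n = sf (Q n) (Q n) `^ (- 2^-1).
  rewrite /norm_lead orthonormalE coefZ.
  have -> : (Q n)`_n = (-1) ^+ n / n`!%:R.
    by rewrite -(lead_sobolev_poly a1 hL hQ) lead_coefE (size_sobolev_poly hQ).
  rewrite !normrM normfV normrX normrN1 expr1n mul1r (ger0_norm (powR_ge0 _ _)).
  by rewrite (gtr0_norm f0) mulrC divfK// gt_eqF.
have -> : C `^ (- 2^-1) * n%:R `^ (- (a / 2)) = (C * n%:R `^ a) `^ (- 2^-1).
  by rewrite powRM ?(ltW C0) ?powR_ge0// -powRrM mulrN.
rewrite !powRN lef_pV2 ?posrE ?powR_gt0 ?mulr_gt0 ?powR_gt0//.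
rewrite ge0_ler_powR ?nnegrE ?(ltW s0) ?invr_ge0//; last exact: hC.
by rewrite mulr_ge0 ?powR_ge0 ?(ltW C0).
Qed.

Lemma Lint_coef_dual J n g : (N < J)%N -> coef_dual a J n g ->
  `|Lint (a + J%:R) (g * q n)| = norm_lead n.
Proof.
move=> NJ gd; have G0 := Gamma1_gt0 a1.
rewrite gd ?size_orthonormal//; last first.
  move=> m mJ; have := @orthonormal_low n ('X^J * lag (a + J%:R) m).
  rewrite sform_XnM// => h.
  have : (Gamma1 a)^-1 * Lint (a + J%:R) (lag (a + J%:R) m * q n) = 0.
    apply: h; rewrite mulrC size_mulXn -?size_poly_eq0 (size_lag _ _).1//.
    by rewrite addnS addnC.
  by move/eqP; rewrite mulf_eq0 invr_eq0 (gt_eqF G0) => /eqP.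
by rewrite /norm_lead !normrM normrX normrN1 expr1n mul1r mulrC normr_nat.
Qed.

End SobolevOrthonormal.
Lemma normc_ge0 (R : realType) (z : R[i]) : 0 <= normc z.
Proof. by case: z => x y; exact: sqrtr_ge0. Qed.

Lemma complex_phase (R : realType) (z : R[i]) :
  exists w, normc w = 1 /\ complex.Re (w * z) = normc z.
Proof.
have [->|z0] := eqVneq z 0.
  by exists 1; rewrite normc1 mulr0 normc0.
case: z z0 => x y z0; set s := normc _.
have s0 : s != 0 by apply: contra z0 => /eqP /eq0_normc ->.
have sE : x ^+ 2 + y ^+ 2 = s ^+ 2 by rewrite /s /= sqr_sqrtr// addr_ge0 ?sqr_ge0.
exists ((x / s) +i* (- y / s))%C; split.
  rewrite /= !exprMn sqrrN -mulrDl sE exprVn mulfV ?sqrtr1// expf_neq0//.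
rewrite /= -[RHS](mulfK s0) -expr2 -sE; field.
exact: s0.
Qed.

(** * From complex sums to real polynomials *)

Section ComplexSum.
Variables (R : realType) (n : nat) (z : nat -> R[i]) (q : nat -> {poly R}).

Definition csum (x : R) : R[i] := \sum_(k < n.+1) z k * ((q k).[x])%:C%C.

Definition csum_re (w : R[i]) : {poly R} := \sum_(k < n.+1) complex.Re (w * z k) *: q k.

Lemma csum_reE w x : (csum_re w).[x] = complex.Re (w * csum x).
Proof.
rewrite /csum_re /csum horner_sum mulr_sumr.
have ReD (u v : R[i]) : complex.Re (u + v) = complex.Re u + complex.Re v by case: u v => ? ? [].
rewrite (big_morph (@complex.Re R) ReD (erefl _)); apply: eq_bigr => k _.
by rewrite hornerZ mulrA [w * z k * _]mulrC complexRe_realM mulrC.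
Qed.

Lemma Re_csum x : complex.Re (csum x) = (csum_re 1).[x].
Proof. by rewrite csum_reE mul1r. Qed.

Lemma Im_csum x : complex.Im (csum x) = (csum_re (0 -i* 1)%C).[x].
Proof. by rewrite csum_reE; case: (csum x) => u v /=; rewrite mul0r sub0r mulN1r opprK. Qed.

Hypothesis sq : forall k, size (q k) = k.+1.

Lemma size_csum_re w : (size (csum_re w) <= n.+1)%N.
Proof.
apply: leq_trans (size_sum _ _ _) _; apply/bigmax_leqP => k _.
apply: leq_trans (size_scale_leq _ _) _.
by rewrite sq ltn_ord.
Qed.

Lemma coef_csum_re w : (csum_re w)`_n = complex.Re (w * z n) * (q n)`_n.
Proof.
rewrite /csum_re coef_sum big_ord_recr /= coefZ big1 ?add0r// => k _.
by rewrite coefZ [(q k)`_n]nth_default ?mulr0// sq.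
Qed.

(** Rotating the sum by the phase of its last coefficient and taking real parts keeps the full
    modulus of the top term and can only decrease absolute values pointwise. *)
Lemma csum_re_lead : exists P : {poly R}, [/\ (size P <= n.+1)%N,
  P`_n = normc (z n) * (q n)`_n & forall x, `|P.[x]| <= normc (csum x)].
Proof.
have [w [w1 wz]] := complex_phase (z n).
exists (csum_re w); split; [exact: size_csum_re|by rewrite coef_csum_re wz|].
by move=> x; rewrite csum_reE (le_trans (normr_Re_le _))// normcM w1 mul1r.
Qed.

End ComplexSum.

(** * The norms of the statement, and functions flat at 0 *)

Section NormLink.
Variable R : realType.
Local Notation mu := (@lebesgue_measure R).
Local Notation pos := (`]0, +oo[%classic : set (measurableTypeR R)).

Lemma measurable_normc (f : R -> R[i]) (D : set (measurableTypeR R)) :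
  measurable_fun D (Re_fun f) -> measurable_fun D (Im_fun f) ->
  measurable_fun D (fun x => normc (f x)).
Proof.
move=> mR mI.
rewrite (_ : (fun x => _) = (fun x => Num.sqrt (Re_fun f x ^+ 2 + Im_fun f x ^+ 2))); last first.
  by apply/funext => x; rewrite /Re_fun /Im_fun; case: (f x).
apply: (@measurableT_comp _ _ _ _ _ _ (@Num.sqrt R)).
  by apply: continuous_measurable_fun; exact: sqrt_continuous.
by apply: measurable_funD; exact: measurable_funX.
Qed.

Variables (alpha : R) (b : beta_choice).
Hypothesis a1 : -1 < alpha.

(* For both choices, [beta = e + p (alpha - e) / 2] with [e = wexp]. *)
Definition wexp : R := if b is BetaAlpha then alpha else 0.
Local Notation w := (wgt alpha wexp).
Local Notation pn := (pnorm alpha wexp).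

Lemma pnorm_ge0 r h : (0 <= pn r h)%E.
Proof. by apply: integral_ge0 => x _; rewrite lee_fin mulr_ge0 ?powR_ge0. Qed.

Lemma Lp_norm_fin r f :
  Lp_norm alpha b r%:E f = (pn r (fun x => normc (f x)) `^ r^-1)%E.
Proof.
rewrite /Lp_norm /pnorm; congr (_ `^ _)%E; apply: eq_integral => x.
rewrite inE /= in_itv /= andbT => x0; congr (_%:E).
rewrite (ger0_norm (normc_ge0 _)) /wgt mulNr.
have -> : (if b is BetaAlpha then alpha else r * alpha / 2) = (alpha - wexp) / 2 * r + wexp.
  by rewrite /wexp; case: b; field.
rewrite (powRD_gt0 _ _ x0)// powRrM mulrA; congr (_ * _).
by rewrite -powRM ?mulr_ge0 ?powR_ge0 ?expR_ge0 ?normc_ge0//; congr (_ `^ _); ring.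
Qed.

Lemma Lp_norm_fin_ge r (f : R -> R[i]) (h : R -> R) z : 0 < r -> 0 <= z ->
  ((z `^ r)%:E <= pn r h)%E -> (pn r h <= pn r (fun x => normc (f x)))%E ->
  (z%:E <= Lp_norm alpha b r%:E f)%E.
Proof.
move=> r0 z0 zh hf; rewrite Lp_norm_fin.
have -> : z%:E = ((z `^ r)%:E `^ r^-1)%E.
  by rewrite poweR_EFin -powRrM mulfV ?powRr1// gt_eqF.
have ri : 0 <= r^-1 by rewrite invr_ge0 ltW.
apply: (gt0_ler_poweR ri) (le_trans zh hf).
- by rewrite in_itv /= leey lee_fin powR_ge0.
- by rewrite in_itv /= leey pnorm_ge0.
Qed.

Lemma Lp_norm_fin_le r f z : 0 < r -> 0 <= z ->
  (pn r (fun x => normc (f x)) <= (z `^ r)%:E)%E -> (Lp_norm alpha b r%:E f <= z%:E)%E.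
Proof.
move=> r0 z0 fz; rewrite Lp_norm_fin.
have -> : z%:E = ((z `^ r)%:E `^ r^-1)%E.
  by rewrite poweR_EFin -powRrM mulfV ?powRr1// gt_eqF.
have ri : 0 <= r^-1 by rewrite invr_ge0 ltW.
apply: (gt0_ler_poweR ri) fz.
- by rewrite in_itv /= leey pnorm_ge0.
- by rewrite in_itv /= leey lee_fin powR_ge0.
Qed.

(** For e = alpha the power of x in [wgt] disappears, for e = 0 it is x^(alpha/2): the two
    conventions at p = oo. *)
Lemma Lp_norm_infty f : Lp_norm alpha b +oo%E f =
  ess_sup (mrestr mu (measurable_itv `]0%R, +oo[)) (fun x => (normc (f x) * w x)%:E).
Proof.
rewrite /Lp_norm; congr ess_sup; apply/funext => x; congr (_%:E).
rewrite /wgt /wexp mulNr -mulrA; congr (_ * _); case: b.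
  by rewrite subrr mul0r powRr0 mul1r mulr1.
by rewrite subr0 mulrC.
Qed.

Lemma le_pnorm r (h h' : R -> R) : 0 <= r -> measurable_fun pos h -> measurable_fun pos h' ->
  (forall x, 0 < x -> `|h x| <= `|h' x|) -> (pn r h <= pn r h')%E.
Proof.
move=> r0 mh mh' hh; apply: ge0_le_integral => //.
- by move=> x _; rewrite lee_fin mulr_ge0 ?powR_ge0.
- by apply/measurable_EFinP; exact: measurable_pnorm_integrand.
- by apply/measurable_EFinP; exact: measurable_pnorm_integrand.
- move=> x /=; rewrite in_itv /= andbT => x0; rewrite lee_fin ler_wpM2r ?powR_ge0//.
  have w0 := wgt_ge0 alpha wexp x; apply: ge0_ler_powR => //.
  - by rewrite nnegrE; exact: mulr_ge0.
  - by rewrite nnegrE; exact: mulr_ge0.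
  - by apply: ler_wpM2r => //; exact: hh.
Qed.

Section Op.
Variables (N : nat) (M : 'I_N.+1 -> R).
Hypothesis hM : forall j, 0 <= M j.

Definition valid_exponent (p : \bar R) := p = +oo%E \/ exists2 r, 1 <= r & p = r%:E.

Lemma S_norm_ge p f : valid_exponent p -> (Lp_norm alpha b p f <= S_norm alpha M b p f)%E.
Proof.
case=> [->|[r r1 ->]]; first by rewrite /S_norm le_max lexx.
have r0 : 0 < r by exact: lt_le_trans r1.
set l := Lp_norm _ _ _ _.
have l0 : (0 <= l)%E by rewrite /l Lp_norm_fin poweR_ge0.
rewrite -/l /S_norm -/l.
have s0 : (0 <= (\sum_(j < N.+1) M j * normc (derivC0 f j) `^ r)%:E)%E.
  by rewrite lee_fin; apply: sumr_ge0 => j _; rewrite mulr_ge0 ?powR_ge0.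
clearbody l; apply: (@le_trans _ _ ((l `^ r) `^ r^-1)%E).
  by rewrite -poweRrM mulfV ?gt_eqF// poweRe1.
apply: gt0_ler_poweR; rewrite ?invr_ge0 ?(ltW r0)//.
- by rewrite in_itv /= leey poweR_ge0.
- by rewrite in_itv /= leey adde_ge0 ?poweR_ge0.
- by rewrite leeDl.
Qed.

Definition flat0 (u : R -> R) := exists (P : {poly R}) (d : R),
  [/\ 0 < d, forall y, 0 <= y < d -> u y = P.[y] & forall j, (j <= N)%N -> P^`(j).[0] = 0].

Lemma flat0_deriven u j : flat0 u -> (j <= N)%N -> hl_deriven j u 0 = 0.
Proof.
move=> [P [d [d0 uP P0]]] jN; rewrite (@hl_deriven_poly R P u d j uP) ?lexx//.
exact: P0.
Qed.

Lemma Im_fun_real (u : R -> R) : Im_fun (fun x => (u x)%:C%C) = horner (0 : {poly R}).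
Proof. by apply/funext => x; rewrite horner0. Qed.

Lemma derivC0_flat u j : flat0 u -> (j <= N)%N -> derivC0 (fun x => (u x)%:C%C) j = 0.
Proof.
move=> fu jN; rewrite /derivC0 Im_fun_real hl_deriven_horner linear0 horner0.
rewrite (_ : Re_fun _ = u)//.
by rewrite (flat0_deriven fu jN).
Qed.

Lemma S_norm_flat_le p u y : valid_exponent p -> flat0 u -> 0 <= y ->
  (Lp_norm alpha b p (fun x => (u x)%:C%C) <= y%:E)%E ->
  (S_norm alpha M b p (fun x => (u x)%:C%C) <= y%:E)%E.
Proof.
move=> vp fu y0 Ly.
have d0 (j : 'I_N.+1) : derivC0 (fun x => (u x)%:C%C) j = 0.
  by apply: derivC0_flat => //; rewrite -ltnS.
case: vp Ly => [->|[r r1 ->]] Ly.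
  rewrite /S_norm ge_max Ly andTb; elim/big_ind : _ => //.
  - by move=> ? ? h1 h2; rewrite ge_max h1.
  - by move=> j _; rewrite d0 normc0.
have r0 : 0 < r by exact: lt_le_trans r1.
rewrite /S_norm big1 ?adde0; last by move=> j _; rewrite d0 normc0 powR0 ?mulr0// gt_eqF.
by rewrite -poweRrM mulfV ?gt_eqF// poweRe1// Lp_norm_fin poweR_ge0.
Qed.

Lemma flat0_S_space p (u : R -> R) y : valid_exponent p -> measurable_fun (setT : set (measurableTypeR R)) u ->
  flat0 u -> 0 <= y -> (Lp_norm alpha b p (fun x => (u x)%:C%C) <= y%:E)%E ->
  S_space alpha M b p (fun x => (u x)%:C%C).
Proof.
move=> vp mu fu y0 Ly; split.
- split; first by apply: (measurable_funS measurableT) => //.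
  by rewrite Im_fun_real; exact: measurable_horner.
- move=> k kN; split.
    have [P [d [d0 uP _]]] := fu.
    by apply: (@hl_nderivable_poly R P u d k uP); rewrite lexx.
  by rewrite Im_fun_real; apply: (@hl_nderivable_poly R 0 _ 1); rewrite ?lexx ?ltr01.
- by apply: le_lt_trans (S_norm_flat_le vp fu y0 Ly) _; rewrite ltry.
Qed.

(** For a function flat at 0 the denominator reduces to the L^p norm; in the numerator, dropping the
    derivative terms only lowers the quotient. *)
Lemma op_norm_ge p (T : (R -> R[i]) -> (R -> R[i])) (u : R -> R) y z : valid_exponent p ->
  measurable_fun (setT : set (measurableTypeR R)) u -> flat0 u -> 0 < y -> 0 <= z ->
  (Lp_norm alpha b p (fun x => (u x)%:C%C) <= y%:E)%E ->
  (0 < Lp_norm alpha b p (fun x => (u x)%:C%C))%E ->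
  (z%:E <= Lp_norm alpha b p (T (fun x => (u x)%:C%C)))%E ->
  ((z / y)%:E <= op_norm alpha M b p T)%E.
Proof.
move=> vp mu fu y0 z0 Ly L0 Tz.
set f := fun x => (u x)%:C%C in Ly L0 Tz *.
have Sy := S_norm_flat_le vp fu (ltW y0) Ly.
have S0 : (0 < S_norm alpha M b p f)%E by exact: lt_le_trans L0 (S_norm_ge _ vp).
apply: (@le_trans _ _ (S_norm alpha M b p (T f) / S_norm alpha M b p f)%E); last first.
  apply: ereal_sup_ubound; exists f => //; split; last by rewrite gt_eqF.
  by apply: flat0_S_space (ltW y0) Ly.
have zS : (z%:E <= S_norm alpha M b p (T f))%E by exact: le_trans Tz (S_norm_ge _ vp).
move: Sy S0; rewrite -/f; case: (S_norm alpha M b p f) => [s| |]//.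
rewrite lee_fin lte_fin => sy s0; rewrite inver gt_eqF// EFinM.
apply: (@le_trans _ _ (z%:E * (s^-1)%:E)%E).
  by rewrite -!EFinM lee_fin ler_wpM2l// lef_pV2.
by apply: lee_wpmul2r => //; rewrite lee_fin invr_ge0 ltW.
Qed.

End Op.
End NormLink.

(** * Lower bounds for norms by duality *)

Section Duality.
Variable R : realType.
Local Notation mu := (@lebesgue_measure R).
Local Notation pos := (`]0, +oo[%classic : set (measurableTypeR R)).
Variables (alpha : R) (b : beta_choice).
Local Notation e := (wexp alpha b).
Local Notation w := (wgt alpha e).
Local Notation pn := (pnorm alpha e).

(** Taken with absolute values and in the extended reals, so that the duality inequalities hold
    without integrability assumptions. *)
Definition pairing (h F : R -> R) : \bar R :=
  (\int[mu]_(x in pos) (`|h x * F x| * (x `^ alpha * expR (- x)))%:E)%E.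

Lemma normr_Rintegral_le (h F : R -> R) : measurable_fun pos h -> measurable_fun pos F ->
  (`|\int[mu]_(x in pos) (h x * F x * (x `^ alpha * expR (- x)))|%:E <= pairing h F)%E.
Proof.
move=> mh mF.
have m1 : measurable_fun pos (fun x : R => h x * F x * (x `^ alpha * expR (- x))).
  by apply: measurable_funM; [exact: measurable_funM|exact: measurable_powR_expRN].
have h1 : (`|\int[mu]_(x in pos) (h x * F x * (x `^ alpha * expR (- x)))%:E| <= pairing h F)%E.
  apply: le_trans (le_abse_integral _ _ _) _ => //; first exact/measurable_EFinP.
  rewrite /pairing; apply: le_of_eq; apply: eq_integral => x _.
  by rewrite abse_EFin normrM (ger0_norm (powR_expRN_ge0 _ _)).
apply: le_trans h1; rewrite /Rintegral.
by case: (\int[mu]_(x in pos) _)%E => [z| |] //=; rewrite normr0 leey.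
Qed.

Lemma pairing_le (h F : R -> R) (k : R -> \bar R) :
  measurable_fun pos h -> measurable_fun pos F -> measurable_fun pos k ->
  (forall x, 0 < x -> (((`|h x| * w x) * (`|F x| * w x) * x `^ e)%:E <= k x)%E) ->
  (pairing h F <= \int[mu]_(x in pos) k x)%E.
Proof.
move=> mh mF mk hk; apply: ge0_le_integral => //.
- by move=> x _; rewrite lee_fin; apply: mulr_ge0 => //; exact: powR_expRN_ge0.
- apply/measurable_EFinP; apply: measurable_funM; last exact: measurable_powR_expRN.
  by apply: measurableT_comp => //; exact: measurable_funM.
- move=> x /=; rewrite in_itv/= andbT => x0; apply: le_trans (hk x x0).
  rewrite -(sqr_wgt alpha e x0) lee_fin normrM; apply: le_of_eq; ring.
Qed.

Lemma measurable_wgt_norm (h : R -> R) : measurable_fun pos h ->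
  measurable_fun pos (fun x : R => `|h x| * w x).
Proof.
by move=> mh; apply: measurable_funM; [exact: measurableT_comp|exact: measurable_wgt].
Qed.

(** Hoelder against a function of size B on a set of mass W, obtained by splitting at a level so
    that r = 1 is included; the splitting costs the factor 2. *)
Lemma pnorm_ge_bounded (G F k : R -> R) (r Z B W : R) : 1 <= r -> 0 < Z -> 0 < B -> 0 < W ->
  measurable_fun pos G -> measurable_fun pos F -> measurable_fun pos k ->
  (forall x, 0 < x -> 0 <= k x <= 1) ->
  (forall x, 0 < x -> `|G x| * w x <= B * k x) ->
  (\int[mu]_(x in pos) (k x * x `^ e)%:E <= W%:E)%E ->
  (Z%:E <= pairing G F)%E ->
  (((Z / (2 * B)) `^ r * W `^ (1 - r))%:E <= pn r F)%E.
Proof.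
move=> r1 Z0 B0 W0 mG mF mk k01 Gk kW ZP.
have r0 : 0 < r by exact: lt_le_trans r1.
(* Where |F| w <= d, the contribution to the pairing is at most B d W = Z / 2; elsewhere |F| w is at
   most d^(1-r) (|F| w)^r. *)
pose d := Z / (2 * B * W); have d0 : 0 < d by rewrite divr_gt0// !mulr_gt0.
have B20 : 0 < Z / (2 * B) by rewrite divr_gt0// mulr_gt0.
have me : measurable_fun pos (fun x : R => x `^ e).
  by exact: measurable_powR_on.
have mpn : measurable_fun pos (fun x : R => (`|F x| * w x) `^ r * x `^ e).
  exact: measurable_pnorm_integrand.
have bound : (pairing G F <= (B * d)%:E * W%:E + (B * d `^ (1 - r))%:E * pn r F)%E.
  apply: (@le_trans _ _ (\int[mu]_(x in pos) ((B * d)%:E * (k x * x `^ e)%:E +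
     (B * d `^ (1 - r))%:E * ((`|F x| * w x) `^ r * x `^ e)%:E))%E).
    apply: pairing_le => //.
      apply: emeasurable_funD; apply: measurable_funeM; apply/measurable_EFinP => //.
      exact: measurable_funM.
    move=> x x0; have /andP[k0 k1] := k01 x x0.
    have A0 : 0 <= `|F x| * w x by rewrite mulr_ge0// wgt_ge0.
    rewrite -!EFinM -EFinD lee_fin -[X in _ + X]mulrA.
    have -> : B * d * (k x * x `^ e) + B * (d `^ (1 - r) * ((`|F x| * w x) `^ r * x `^ e)) =
      B * (d * k x + d `^ (1 - r) * (`|F x| * w x) `^ r) * x `^ e by ring.
    rewrite ler_wpM2r ?powR_ge0//.
    apply: (@le_trans _ _ (B * k x * (`|F x| * w x))); first by rewrite ler_wpM2r// Gk.
    rewrite -mulrA ler_pM2l//; move: A0; set A := `|F x| * w x => A0.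
    have [Ad|dA] := leP A d.
      apply: (@le_trans _ _ (d * k x)); first by rewrite mulrC ler_wpM2r.
      by rewrite lerDl mulr_ge0 ?powR_ge0.
    apply: (@le_trans _ _ A); first by rewrite ler_piMl.
    apply: (@le_trans _ _ (d `^ (1 - r) * A `^ r)); last first.
      by rewrite lerDr mulr_ge0// ltW.
    have A0' : 0 < A by exact: lt_trans dA.
    rewrite -[X in X <= _](powRr1 A0) -[X in _ `^ X](subrK r 1).
    rewrite (powRD_gt0 _ _ A0')// ler_wpM2r ?powR_ge0//.
    rewrite -[1 - r]opprB !powRN lef_pV2 ?posrE ?powR_gt0//.
    by rewrite ge0_ler_powR ?nnegrE ?subr_ge0 ?(ltW d0) ?(ltW dA).
  have c1 : 0 <= B * d by apply: mulr_ge0; exact: ltW.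
  have c2 : 0 <= B * d `^ (1 - r) by rewrite mulr_ge0 ?powR_ge0// ltW.
  rewrite ge0_integralD//; first last.
  - by apply: measurable_funeM; exact/measurable_EFinP.
  - by move=> x _; apply: mule_ge0; rewrite lee_fin// mulr_ge0 ?powR_ge0.
  - by apply: measurable_funeM; apply/measurable_EFinP; exact: measurable_funM.
  - move=> x /=; rewrite in_itv/= andbT => x0; have /andP[k0 _] := k01 x x0.
    by apply: mule_ge0; rewrite lee_fin// mulr_ge0 ?powR_ge0.
  rewrite ge0_integralZl_EFin//; first last.
  - by apply/measurable_EFinP; exact: measurable_funM.
  - move=> x /=; rewrite in_itv/= andbT => x0; have /andP[k0 _] := k01 x x0.
    by rewrite lee_fin mulr_ge0 ?powR_ge0.
  rewrite ge0_integralZl_EFin//; first last.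
  - exact/measurable_EFinP.
  - by move=> x _; rewrite lee_fin mulr_ge0 ?powR_ge0.
  by apply: leeD => //; apply: lee_wpmul2l.
have := le_trans ZP bound; have := pnorm_ge0 alpha b r F.
case: (pn r F) => [X| |] //; last by move=> *; rewrite leey.
rewrite lee_fin -!EFinM -EFinD !lee_fin => X0.
have -> : B * d * W = Z / 2 by rewrite /d; field; rewrite !gt_eqF.
have -> : (Z / (2 * B)) `^ r * W `^ (1 - r) = (Z / (2 * B)) * d `^ (r - 1).
  have -> : d = Z / (2 * B) * W^-1 by rewrite /d; field; rewrite !gt_eqF.
  rewrite [X in _ = _ * X]powRM ?invr_ge0 ?(ltW W0) ?(ltW B20)// -[W^-1]powR_inv1 ?(ltW W0)//.
  rewrite -[X in _ = _ * (_ * X)]powRrM mulN1r opprB.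
  rewrite mulrA -[X in _ = X * _ * _](powRr1 (ltW B20)) -(powRD_gt0 _ _ B20)//.
  by rewrite [1 + (r - 1)]addrC subrK.
move=> h.
have h2 : Z / 2 <= B * d `^ (1 - r) * X by move: h; clear; move=> ?; lra.
rewrite -[r - 1]opprB powRN ler_pdivrMr ?powR_gt0//.
have -> : Z / (2 * B) = Z / 2 / B by field; rewrite gt_eqF.
by rewrite ler_pdivrMr//; apply: le_trans h2 _; apply: le_of_eq; ring.
Qed.

(** Young's inequality with constants 1, by comparing x with y^(r-1). *)
Lemma young_split (r x y : R) : 1 < r -> 0 <= x -> 0 <= y -> x * y <= x `^ (r / (r - 1)) + y `^ r.
Proof.
move=> r1 x0 y0; have r10 : 0 < r - 1 by rewrite subr_gt0.
have [->|xn] := eqVneq x 0; first by rewrite mul0r addr_ge0 ?powR_ge0.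
have [->|yn] := eqVneq y 0; first by rewrite mulr0 addr_ge0 ?powR_ge0.
have xp : 0 < x by rewrite lt0r xn.
have yp : 0 < y by rewrite lt0r yn.
have [h|h] := leP x (y `^ (r - 1)).
  apply: (@le_trans _ _ (y `^ r)); last by rewrite lerDr powR_ge0.
  rewrite -[X in _ `^ X](subrK 1 r) powRD ?yn ?implybT// powRr1//.
  by rewrite ler_pM2r.
apply: (@le_trans _ _ (x `^ (r / (r - 1)))); last by rewrite lerDl powR_ge0.
have -> : r / (r - 1) = 1 + (r - 1)^-1 by field; rewrite gt_eqF.
rewrite powRD ?xn ?implybT// powRr1// ler_pM2l//.
rewrite -[X in X <= _](powRr1 y0) -[X in _ `^ X](@divff _ (r - 1)) ?gt_eqF// powRrM.
by rewrite ge0_ler_powR ?nnegrE ?invr_ge0 ?powR_ge0 ?(ltW r10) ?(ltW h).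
Qed.

Lemma pnorm_dual_ge (h F : R -> R) (r y Z : R) : 1 < r -> 0 < y -> 0 < Z ->
  measurable_fun pos h -> measurable_fun pos F ->
  (pn r F <= (y `^ r)%:E)%E -> (Z%:E <= pairing h F)%E ->
  (((Z / (2 * y)) `^ (r / (r - 1)))%:E <= pn (r / (r - 1)) h)%E.
Proof.
move=> r1 y0 Z0 mh mF Fy ZP; have r10 : 0 < r - 1 by rewrite subr_gt0.
have r0 : 0 < r by exact: lt_trans r1.
have Z20 : 0 < Z / 2 by rewrite divr_gt0.
set P := r / (r - 1); have P0 : 0 < P by rewrite divr_gt0.
(* Scaling h by t and F by 1/t makes the F-term of Young's inequality at most Z / 2. *)
pose t := y * (Z / 2) `^ (- r^-1); have t0 : 0 < t by rewrite mulr_gt0// powR_gt0.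
have tr : t `^ (- r) * y `^ r = Z / 2.
  rewrite /t powRM ?(ltW y0) ?powR_ge0// -powRrM mulrNN mulVf ?gt_eqF// powRr1 ?(ltW Z20)//.
  by rewrite powRN mulrAC mulVf ?mul1r// gt_eqF// powR_gt0.
have mph : measurable_fun pos (fun x : R => (`|h x| * w x) `^ P * x `^ e).
  exact: measurable_pnorm_integrand.
have mpF : measurable_fun pos (fun x : R => (`|F x| * w x) `^ r * x `^ e).
  exact: measurable_pnorm_integrand.
have bound : (pairing h F <= (t `^ P)%:E * pn P h + (t `^ (- r))%:E * pn r F)%E.
  apply: (@le_trans _ _ (\int[mu]_(x in pos) ((t `^ P)%:E * ((`|h x| * w x) `^ P * x `^ e)%:E +
     (t `^ (- r))%:E * ((`|F x| * w x) `^ r * x `^ e)%:E))%E).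
    apply: pairing_le => //.
      by apply: emeasurable_funD; apply: measurable_funeM; exact/measurable_EFinP.
    move=> x x0.
    have A0 : 0 <= `|F x| * w x by rewrite mulr_ge0// wgt_ge0.
    have H0 : 0 <= `|h x| * w x by rewrite mulr_ge0// wgt_ge0.
    move: A0 H0; set A := `|F x| * w x; set H := `|h x| * w x => A0 H0; clearbody A H.
    rewrite -!EFinM -EFinD lee_fin !mulrA -mulrDl ler_wpM2r ?powR_ge0//.
    have -> : t `^ (- r) = (t^-1) `^ r by rewrite -[t^-1]powR_inv1 ?(ltW t0)// -powRrM mulN1r.
    rewrite -!powRM ?invr_ge0 ?(ltW t0)//.
    have -> : H * A = t * H * (t^-1 * A) by clear -t0; clearbody t; field; rewrite gt_eqF.
    by apply: young_split => //; rewrite mulr_ge0 ?invr_ge0 ?(ltW t0).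
  rewrite ge0_integralD//; first last.
  - by apply: measurable_funeM; exact/measurable_EFinP.
  - by move=> x _; rewrite -EFinM lee_fin !mulr_ge0 ?powR_ge0.
  - by apply: measurable_funeM; exact/measurable_EFinP.
  - by move=> x _; rewrite -EFinM lee_fin !mulr_ge0 ?powR_ge0.
  rewrite ge0_integralZl_EFin ?powR_ge0//; first last.
  - exact/measurable_EFinP.
  - by move=> x _; rewrite lee_fin mulr_ge0 ?powR_ge0.
  rewrite ge0_integralZl_EFin ?powR_ge0//; first last.
  - exact/measurable_EFinP.
  - by move=> x _; rewrite lee_fin mulr_ge0 ?powR_ge0.
have bound2 : (Z%:E <= (t `^ P)%:E * pn P h + (Z / 2)%:E)%E.
  apply: le_trans ZP _; apply: le_trans bound _; apply: leeD => //.
  by rewrite -tr EFinM; apply: lee_wpmul2l => //; rewrite lee_fin powR_ge0.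
move: bound2; have := pnorm_ge0 alpha b P h.
case: (pn P h) => [X| |] //; last by move=> *; rewrite leey.
rewrite lee_fin -!EFinM -EFinD !lee_fin => X0 hZ.
have h2 : Z / 2 <= t `^ P * X by move: hZ; clear; move=> ?; lra.
have -> : (Z / (2 * y)) `^ P = Z / 2 / t `^ P.
  have tP : t `^ P = y `^ P * ((Z / 2) `^ (P / r))^-1.
    rewrite [LHS]powRM ?(ltW y0) ?powR_ge0// -[X in _ * X]powRrM -powRN.
    by congr (_ * _ `^ _); rewrite mulNr mulrC.
  have ZP2 : (Z / 2) `^ P = Z / 2 * (Z / 2) `^ (P / r).
    rewrite -[X in _ = X * _](powRr1 (ltW Z20)) -[RHS](powRD_gt0 _ _ Z20)//.
    by congr (_ `^ _); rewrite /P; field; rewrite !gt_eqF.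
  have -> : Z / (2 * y) = Z / 2 / y by field; rewrite gt_eqF.
  rewrite powR_div ?(ltW Z20) ?(ltW y0)// tP ZP2; set u := (Z / 2) `^ _; set v := y `^ _.
  by field; rewrite !gt_eqF ?powR_gt0.
rewrite ler_pdivrMr; last exact: powR_gt0.
by rewrite [X * _]mulrC.
Qed.

Lemma ess_sup_pairing_ge (h F : R -> R) (y Z : R) : 0 < y -> 0 < Z ->
  measurable_fun pos h -> measurable_fun pos F ->
  (pn 1 F <= y%:E)%E -> (Z%:E <= pairing h F)%E ->
  ((Z / (2 * y))%:E <= ess_sup (mrestr mu (measurable_itv `]0%R, +oo[))
     (fun x => (`|h x| * w x)%:E))%E.
Proof.
move=> y0 Z0 mh mF Fy ZP; rewrite leNgt; apply/negP => K.
set S := ess_sup _ _ in K.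
have d0 : 0 < Z / (2 * y) by rewrite divr_gt0// mulr_gt0.
have [k [k0 kS]] : exists k, [/\ 0 <= k, (S <= k%:E)%E & k * y < Z].
  have dy : Z / (2 * y) * y < Z.
    rewrite (_ : Z / (2 * y) * y = Z / 2); last by field; rewrite gt_eqF.
    by move: Z0; clear=> ?; lra.
  by exists (Z / (2 * y)); split=> //; [exact: ltW|exact: ltW].
apply/negP; rewrite -leNgt -lee_fin; apply: le_trans ZP _.
have mF1 : measurable_fun pos (fun x : R => `|F x| * w x * x `^ e).
  apply: measurable_funM; first exact: measurable_wgt_norm.
  by exact: measurable_powR_on.
have ae1 : {ae mu, forall x, pos x -> `|h x| * w x <= k}.
  have := ess_sup_ge (mrestr mu (measurable_itv `]0%R, +oo[)) (fun x => (`|h x| * w x)%:E).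
  rewrite -/S => -[A [mA A0 hA]].
  exists (A `&` pos); split => //; first exact: measurableI.
  move=> x /= /not_implyP [px hx]; split=> //; apply: hA => /= hS; apply: hx.
  by rewrite -lee_fin; apply: le_trans kS.
apply: (@le_trans _ _ (\int[mu]_(x in pos) (k%:E * (`|F x| * w x * x `^ e)%:E))%E).
  apply: ae_ge0_le_integral => //.
  - by move=> x _; rewrite lee_fin; apply: mulr_ge0 => //; exact: powR_expRN_ge0.
  - apply/measurable_EFinP; apply: measurable_funM; last exact: measurable_powR_expRN.
    by apply: measurableT_comp => //; exact: measurable_funM.
  - by move=> x _; rewrite -EFinM lee_fin !mulr_ge0 ?powR_ge0 ?wgt_ge0.
  - by apply: measurable_funeM; exact/measurable_EFinP.
  - move: ae1; apply: filterS => x hx px; have := hx px.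
    move: px; rewrite /= in_itv/= andbT => x0 hk.
    rewrite -EFinM lee_fin -(sqr_wgt alpha e x0) normrM.
    have -> : `|h x| * `|F x| * (w x ^+ 2 * x `^ e) = `|h x| * w x * (`|F x| * w x * x `^ e) by ring.
    by apply: ler_wpM2r => //; rewrite !mulr_ge0 ?powR_ge0 ?wgt_ge0.
rewrite ge0_integralZl_EFin//; first last.
- exact/measurable_EFinP.
- by move=> x _; rewrite lee_fin !mulr_ge0 ?powR_ge0 ?wgt_ge0.
rewrite EFinM; apply: lee_wpmul2l; first by rewrite lee_fin.
apply: le_trans Fy; rewrite /pnorm; apply: le_of_eq.
by apply: eq_integral => x _; rewrite powRr1// mulr_ge0// wgt_ge0.
Qed.

(** Exponents p > 2 are handled through their conjugate r < 2, for which [dual_family] is available;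
    p = oo corresponds to r = 1. *)
Definition dual_exponent (p : \bar R) (r : R) := (p = +oo%E /\ r = 1) \/
  (1 < r /\ p = (r / (r - 1))%:E).

Lemma dual_exponent_valid p r : dual_exponent p r -> valid_exponent p.
Proof.
case=> [[-> _]|[r1 ->]]; first by left.
by right; exists (r / (r - 1)) => //; rewrite ler_pdivlMr ?subr_gt0// mul1r gerBl.
Qed.

Lemma Lp_norm_dual_ge p r (f : R -> R[i]) (h F : R -> R) (y Z : R) : dual_exponent p r ->
  0 < y -> 0 < Z -> measurable_fun pos h -> measurable_fun pos F ->
  (forall x, normc (f x) = `|h x|) ->
  (pn r F <= (y `^ r)%:E)%E -> (Z%:E <= pairing h F)%E ->
  ((Z / (2 * y))%:E <= Lp_norm alpha b p f)%E.
Proof.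
move=> pr y0 Z0 mh mF fh Fy ZP.
have d0 : 0 < Z / (2 * y) by rewrite divr_gt0// mulr_gt0.
case: pr Fy => [[-> ->]|[r1 ->]] Fy.
  rewrite Lp_norm_infty (_ : (fun x => _) = (fun x => (`|h x| * w x)%:E)); last first.
    by apply/funext => x; rewrite fh.
  by apply: ess_sup_pairing_ge ZP => //; rewrite -[y](powRr1 (ltW y0)).
have P0 : 0 < r / (r - 1) by rewrite divr_gt0 ?subr_gt0// (lt_trans ltr01).
apply: (Lp_norm_fin_ge P0 (ltW d0) (pnorm_dual_ge r1 y0 Z0 mh mF Fy ZP)).
by rewrite /pnorm; under [in leRHS]eq_integral do rewrite fh normr_id.
Qed.

Lemma Lp_norm_bounded_le p r (u k : R -> R) (B W : R) : dual_exponent p r ->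
  0 < B -> 0 < W -> measurable_fun pos u -> measurable_fun pos k ->
  (forall x, 0 < x -> 0 <= k x <= 1) ->
  (forall x, 0 < x -> `|u x| * w x <= B * k x) ->
  (\int[mu]_(x in pos) (k x * x `^ e)%:E <= W%:E)%E ->
  (Lp_norm alpha b p (fun x => (u x)%:C%C) <= (B * W `^ (1 - r^-1))%:E)%E.
Proof.
move=> pr B0 W0 mu' mk k01 uk kW.
have nu x : normc ((u x)%:C%C) = `|u x| by rewrite /= expr0n addr0 sqrtr_sqr.
case: pr => [[-> ->]|[r1 ->]].
  rewrite invr1 subrr powRr0 mulr1 Lp_norm_infty; apply/ess_supP.
  exists (~` pos); split; first exact: measurableC.
    rewrite [LHS](_ : _ = mu (~` pos `&` pos))//.
    by rewrite setICl measure0.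
  move=> x hx px; apply: hx; rewrite /mkset nu lee_fin.
  have x0 : 0 < x by move: px; rewrite /= in_itv/= andbT.
  have /andP[_ k1] := k01 x x0.
  by apply: le_trans (uk x x0) _; rewrite ler_piMr// ltW.
set P := r / (r - 1); have P0 : 0 < P.
  by rewrite divr_gt0 ?subr_gt0// (lt_trans ltr01).
have P1 : 1 <= P by rewrite ler_pdivlMr ?subr_gt0// mul1r gerBl.
have rP : 1 - r^-1 = P^-1.
  by rewrite /P invf_div; field; rewrite gt_eqF// (lt_trans ltr01).
have h1 : (pn P (fun x => normc ((u x)%:C%C)) <= (B `^ P * W)%:E)%E.
  apply: (@le_trans _ _ (\int[mu]_(x in pos) ((B `^ P)%:E * (k x * x `^ e)%:E))%E).
    apply: ge0_le_integral => //.
    - by move=> x _; rewrite lee_fin mulr_ge0 ?powR_ge0.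
    - apply/measurable_EFinP; apply: measurable_pnorm_integrand.
      rewrite (_ : (fun x => _) = (fun x => `|u x|)); first exact: measurableT_comp.
      by apply/funext => x; rewrite nu.
    - apply: measurable_funeM; apply/measurable_EFinP; apply: measurable_funM => //.
      by exact: measurable_powR_on.
    - move=> x px; have x0 : 0 < x by move: px; rewrite /= in_itv/= andbT.
      have /andP[k0 k1] := k01 x x0.
      rewrite -EFinM lee_fin nu normr_id [X in _ <= X]mulrA ler_wpM2r ?powR_ge0//.
      apply: (@le_trans _ _ ((B * k x) `^ P)).
        have w0 := wgt_ge0 alpha e x; apply: ge0_ler_powR; rewrite ?(ltW P0)//.
        - by rewrite nnegrE; exact: mulr_ge0.
        - by rewrite nnegrE mulr_ge0// ltW.
        - exact: uk.
      rewrite powRM ?(ltW B0)// ler_wpM2l ?powR_ge0//.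
      have [->|kn] := eqVneq (k x) 0; first by rewrite powR0// gt_eqF.
      have kp : 0 < k x by rewrite lt0r kn.
      by rewrite -[X in _ <= X](powRr1 k0) ger_powR ?kp.
  rewrite ge0_integralZl_EFin ?powR_ge0//; first last.
  - apply/measurable_EFinP; apply: measurable_funM => //.
    by exact: measurable_powR_on.
  - move=> x /=; rewrite in_itv/= andbT => x0; have /andP[k0 k1] := k01 x x0.
    by rewrite lee_fin mulr_ge0 ?powR_ge0.
  by rewrite EFinM; apply: lee_wpmul2l => //; rewrite lee_fin powR_ge0.
rewrite rP; apply: Lp_norm_fin_le => //; first by rewrite mulr_ge0 ?powR_ge0// ltW.
rewrite powRM ?powR_ge0 ?(ltW B0)// -[(W `^ _) `^ P]powRrM mulVf ?gt_eqF// powRr1//.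
exact: ltW.
Qed.

End Duality.
(** * Lower bounds for the operator norm *)

Section OperatorBounds.
Variable R : realType.
Local Notation mu := (@lebesgue_measure R).
Local Notation pos := (`]0, +oo[%classic : set (measurableTypeR R)).

Lemma bulk_mass (e : R) : -1 < e -> exists C, 0 < C /\ forall n, (0 < n)%N ->
  (\int[mu]_(x in pos) (\1_(`[1%R, 4 * n%:R + 1]%classic) x * x `^ e)%:E <=
   (C * n%:R `^ (e + 1))%:E)%E.
Proof.
move=> e1; have e0 : 0 < e + 1 by rewrite -ltrBlDr sub0r.
exists (5 `^ (e + 1) / (e + 1)); split; first by rewrite divr_gt0// powR_gt0.
move=> n n0; have n1 : 1 <= n%:R :> R by rewrite ler1n.
set I := `[1%R, 4 * n%:R + 1]%classic.
have mI : measurable (I : set (measurableTypeR R)) by exact: measurable_itv.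
have I1 x : I x -> 1 <= x by rewrite /I /= in_itv /= => /andP[].
have -> : (\int[mu]_(x in pos) (\1_I x * x `^ e)%:E = \int[mu]_(x in I) (x `^ e)%:E)%E.
  have pI : pos `&` I = I.
    by apply/setIidr => x /I1 x1; rewrite /= in_itv/= andbT (lt_le_trans ltr01).
  rewrite -[in RHS]pI integral_mkcondr; apply: eq_integral => x _.
  by rewrite patchE indicE; case: (x \in I); rewrite ?mul1r ?mul0r.
have nn : 1 < 4 * n%:R + 1 :> R by move: n1; clear => ?; lra.
have -> : (\int[mu]_(x in I) (x `^ e)%:E = (((4 * n%:R + 1) `^ (e + 1) / (e + 1)) - 1 `^ (e + 1) / (e + 1))%:E)%E.
  apply: (@FTC_itv R (fun x => x `^ (e + 1) / (e + 1)) _ _ _ nn).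
  - move=> x /andP[x1 _]; have x0 : 0 < x by exact: lt_trans x1.
    have h := is_derive1_powR (e + 1) x0.
    have h2 : is_derive x (1 : R) ((e + 1)^-1 \*: (fun x => x `^ (e + 1))) ((e + 1)^-1 *: ((e + 1) * x `^ (e + 1 - 1))).
      exact: is_deriveZ.
    have -> : x `^ e = (e + 1)^-1 *: ((e + 1) * x `^ (e + 1 - 1)).
      by rewrite addrK /GRing.scale/= mulKf// gt_eqF.
    by rewrite (_ : (fun x => _) = ((e + 1)^-1 \*: (fun x => x `^ (e + 1))))//; apply/funext => t; rewrite mulrC.
  - move=> x /andP[x1 _]; have x0 : 0 < x by exact: lt_le_trans x1.
    by move=> ?; apply: cvgMl; exact: continuous_powR_at.
  - by move=> x /andP[x1 _]; apply: continuous_powR_at; exact: lt_le_trans x1.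
rewrite lee_fin powR1 mulrAC -powRM ?(le_trans ler01 n1)//.
apply: (@le_trans _ _ ((4 * n%:R + 1) `^ (e + 1) / (e + 1))).
  by rewrite gerBl divr_ge0// ltW.
rewrite ler_pM2r ?invr_gt0// ge0_ler_powR ?nnegrE ?(ltW e0)//; move: n1; clear=> ?; lra.
Qed.

Variables (alpha : R) (b : beta_choice).
Local Notation e := (wexp alpha b).
Local Notation w := (wgt alpha e).
Local Notation pn := (pnorm alpha e).
Hypothesis a1 : -1 < alpha.

Lemma wexp_gtN1 : -1 < e.
Proof. by rewrite /wexp; case: b => //; exact: ltrN10. Qed.

Lemma pairing_bulk_ge n m (P : {poly R}) : (0 < n)%N -> (size P <= n.+1)%N ->
  ((`|P`_n| * n%:R ^+ n.+1)%:E <= pairing alpha (bulk_fun alpha n m) (horner P))%E.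
Proof.
move=> n0 sP.
have mG : measurable_fun pos (bulk_fun alpha n m).
  by apply: (measurable_funS measurableT) => //; exact: measurable_bulk_fun.
have h := normr_Rintegral_le alpha mG (@measurable_horner R P pos).
apply: le_trans h.
rewrite (_ : \int[mu]_(x in pos) _ = P`_n * (n%:R ^+ n * chebInt (bulk_ctr R n) (bulk_rad R n) 1)).
  rewrite lee_fin normrM ler_wpM2l// exprSr normrM normrX normr_nat ler_wpM2l ?exprn_ge0//.
  by rewrite (le_trans (bulk_chebInt1 R n0))// ler_norm.
rewrite -(bulk_fun_pair alpha m n0 sP); apply: eq_Rintegral => x _.
by rewrite mulrA.
Qed.

Lemma pairing_XnM_ge J (g q : {poly R}) :
  (`|Lint (alpha + J%:R) (g * q)|%:E <= pairing alpha (horner q) (horner ('X^J * g)))%E.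
Proof.
have h := normr_Rintegral_le alpha (@measurable_horner R q pos) (@measurable_horner R ('X^J * g) pos).
apply: le_trans h.
rewrite -(LintXn) lee_fin; apply: le_of_eq; congr (`|_|).
by apply: eq_Rintegral => x _; rewrite !hornerM; ring.
Qed.
Definition bulk_bound (B : R) (n : nat) : R :=
  B * (expR n%:R * n%:R `^ (- ((alpha + e) / 2))).

Lemma bulk_bound_gt0 B n : 0 < B -> (0 < n)%N -> 0 < bulk_bound B n.
Proof. by move=> B0 n0; rewrite !mulr_gt0 ?expR_gt0 ?powR_gt0// ltr0n. Qed.

Local Notation bulk_ind n := (\1_(`[1%R, 4 * n%:R + 1]%classic) : R -> R).

Lemma measurable_bulk_ind n : measurable_fun pos (bulk_ind n).
Proof. by apply: measurable_indic; exact: measurable_itv. Qed.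

Lemma bulk_ind01 n (x : R) : 0 <= bulk_ind n x <= 1.
Proof. by rewrite indicE; case: (x \in _); rewrite ?lexx ?ler01. Qed.

Lemma bulk_fun_ind_le : exists Bm : R * nat, 0 < Bm.1 /\ forall n x, (0 < n)%N ->
  `|bulk_fun alpha n Bm.2 x| * w x <= bulk_bound Bm.1 n * bulk_ind n x.
Proof.
have [[B m] /= B0 h] := bulk_fun_le alpha e.
exists (B, m); split=> //= n x n0.
have [xI|xI] := pselect (bulk_itv n x); last first.
  rewrite bulk_fun_out// normr0 mul0r; apply: mulr_ge0.
    exact: ltW (bulk_bound_gt0 B0 n0).
  by rewrite indicE; case: (x \in _).
have /andP[x1 x2] := bulk_itvP xI.
rewrite indicE mem_set ?mulr1; last by rewrite /= in_itv /= x1.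
exact: h.
Qed.

(** [op_norm] ranges over functions of nonzero norm. Positivity comes from pairing with the bulk
    function of the same degree, which detects the leading coefficient. *)
Lemma pnorm_poly_gt0 r (P : {poly R}) : 1 <= r -> (1 < size P)%N -> (0 < pn r (horner P))%E.
Proof.
move=> r1 sP; have [[B m] /= [B0 hB]] := bulk_fun_ind_le.
have [C [C0 hC]] := bulk_mass wexp_gtN1.
pose n := (size P).-1; have n0 : (0 < n)%N by rewrite /n -subn1 subn_gt0.
have sn : size P = n.+1 by rewrite /n prednK// (leq_trans _ sP).
have Pn : P`_n != 0 by rewrite -[P`_n]lead_coefE lead_coef_eq0 -size_poly_gt0 (leq_trans _ sP).
have Z0 : 0 < `|P`_n| * n%:R ^+ n.+1 by rewrite mulr_gt0 ?normr_gt0// exprn_gt0// ltr0n.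
have Bn0 := bulk_bound_gt0 B0 n0.
have W0 : 0 < C * n%:R `^ (e + 1) by rewrite mulr_gt0// powR_gt0// ltr0n.
have sP' : (size P <= n.+1)%N by rewrite sn.
have ZP := pairing_bulk_ge m n0 sP'.
have mG : measurable_fun pos (bulk_fun alpha n m).
  by apply: (measurable_funS measurableT) => //; exact: measurable_bulk_fun.
have := pnorm_ge_bounded r1 Z0 Bn0 W0 mG (@measurable_horner R P pos)
  (@measurable_bulk_ind n) (fun x _ => bulk_ind01 n x) (fun x _ => hB n x n0) (hC n n0) ZP.
apply: lt_le_trans; rewrite lte_fin mulr_gt0 ?powR_gt0// divr_gt0// mulr_gt0//.
Qed.

Variables (N : nat) (M : 'I_N.+1 -> R).
Hypothesis hM : forall j, 0 <= M j.
Variables (L Q : nat -> {poly R}).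
Hypotheses (hL : laguerre_polys alpha L) (hQ : sobolev_polys alpha M L Q).
Variable c : nat -> nat -> R[i].
Hypothesis hc : forall n, 0 < normc (c n n).
Local Notation q := (sobolev_orthonormal alpha M Q).
Local Notation T := (sobolev_op alpha M q c).
Local Notation lam := (norm_lead alpha M Q).
Local Notation toC u := (fun x : R => (u x)%:C%C).

Lemma flat0_XnM J (g : {poly R}) : (N < J)%N -> flat0 N (horner ('X^J * g)).
Proof.
move=> NJ; exists ('X^J * g), 1; split=> // j jN.
by rewrite derivn_XnM0// (leq_ltn_trans jN).
Qed.

Lemma flat0_bulk n m : flat0 N (bulk_fun alpha n m).
Proof.
exists 0, 1; split=> //.
  by move=> y /andP[_ y1]; rewrite horner0 bulk_fun_near0.
by move=> j _; rewrite linear0 horner0.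
Qed.

Lemma fourier_coef_real (u : R -> R) k :
  fourier_coef alpha M q (toC u) k = (sobolev_dot alpha M u (horner (q k)))%:C%C.
Proof.
rewrite /fourier_coef Im_fun_real sobolev_dot_poly.
by have := @sformZ R alpha N M a1 0 0 (q k); rewrite scale0r mul0r => ->.
Qed.

Lemma fourier_coef_XnM J n g : (N < J)%N -> coef_dual alpha J n g ->
  normc (fourier_coef alpha M q (toC (horner ('X^J * g))) n) = (Gamma1 alpha)^-1 * lam n.
Proof.
move=> NJ gd; have G0 := Gamma1_gt0 a1.
rewrite fourier_coef_real sobolev_dot_poly sform_XnM//.
rewrite /= expr0n addr0 sqrtr_sqr normrM (ger0_norm (ltW _)) ?invr_gt0//.
by rewrite (Lint_coef_dual a1 hM hQ NJ gd).
Qed.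

Lemma fourier_coef_bulk n m k : (0 < n)%N -> (k <= n)%N ->
  fourier_coef alpha M q (toC (bulk_fun alpha n m)) k =
  ((Gamma1 alpha)^-1 * ((q k)`_n * (n%:R ^+ n * chebInt (bulk_ctr R n) (bulk_rad R n) 1)))%:C%C.
Proof.
move=> n0 kn; rewrite fourier_coef_real /sobolev_dot big1 ?addr0; last first.
  by move=> j _; rewrite (flat0_deriven (flat0_bulk n m)) ?mulr0 ?mul0r// -ltnS.
rewrite /laguerre_dot bulk_fun_pair//.
by rewrite (size_orthonormal a1 hM hQ) ltnS.
Qed.

Lemma sobolev_opE n f :
  T n f = csum n (fun k => c k n * fourier_coef alpha M q f k) q.
Proof. by []. Qed.

Lemma sobolev_op_bulk n m x : (0 < n)%N ->
  normc (T n (toC (bulk_fun alpha n m)) x) = `|(normc (c n n) * ((Gamma1 alpha)^-1 *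
     (`|(q n)`_n| * (n%:R ^+ n * chebInt (bulk_ctr R n) (bulk_rad R n) 1))) *: q n).[x]|.
Proof.
move=> n0; have G0 := Gamma1_gt0 a1.
have ch0 : 0 <= chebInt (bulk_ctr R n) (bulk_rad R n) 1.
  by apply: le_trans (bulk_chebInt1 R n0).
rewrite /sobolev_op big_ord_recr /= big1 ?add0r; last first.
  move=> k _; rewrite fourier_coef_bulk//; last by rewrite ltnW.
  by rewrite [(q k)`_n]nth_default ?(size_orthonormal a1 hM hQ)// mul0r !mulr0 mul0r.
rewrite fourier_coef_bulk// !normcM [X in _ = `|X|]hornerZ [RHS]normrM.
have nr (z : R) : normc (z%:C)%C = `|z| by rewrite /= expr0n addr0 sqrtr_sqr.
by rewrite !nr !normrM normr_id (ger0_norm (normc_ge0 _)).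
Qed.

(** The factor common to both ranges of p: pairing [q n] with x^J g gives [lam n], pairing it with G
    gives its leading coefficient times n^(n+1), a Fourier coefficient brings 1 / Gamma(alpha + 1),
    and G has weighted size [bulk_bound B n]. *)
Definition bulk_gain B n : R :=
  (Gamma1 alpha)^-1 * lam n * (`|(q n)`_n| * n%:R ^+ n.+1) / (2 * bulk_bound B n).

(** As |lead q_n| = [lam n] / n!, Stirling gives n^(n+1) / (n! e^n) >= n^(1/2) / e. With [lam n] ^ 2
    of order at least n^(-alpha) and n^((alpha+e)/2) from [bulk_bound], the total exponent is (e + 1
    - alpha) / 2. *)
Lemma bulk_gain_ge B : 0 < B -> exists k, 0 < k /\ forall n, (0 < n)%N ->
  k * n%:R `^ ((e + 1 - alpha) / 2) <= bulk_gain B n.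
Proof.
move=> B0; have G0 := Gamma1_gt0 a1.
have [c0 [c00 hc0]] := norm_lead_ge a1 hM hL hQ.
exists ((Gamma1 alpha)^-1 * c0 ^+ 2 / (2 * B * expR 1)); split.
  by rewrite divr_gt0 ?mulr_gt0 ?invr_gt0 ?exprn_gt0 ?expR_gt0.
move=> n n0; have n0' : 0 < n%:R :> R by rewrite ltr0n.
have l0 := norm_lead_gt0 a1 hM hQ n.
have f0 : 0 < n`!%:R :> R by rewrite ltr0n fact_gt0.
have s0 : 0 < Num.sqrt n%:R :> R by rewrite sqrtr_gt0.
have st := stirling_upper R n0.
have qE : `|(q n)`_n| = lam n / n`!%:R by rewrite /norm_lead mulrC mulKf// gt_eqF.
have h1 : n`!%:R * expR n%:R * n%:R <= expR 1 * (n%:R ^+ n.+1 * Num.sqrt n%:R) :> R.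
  apply: (@le_trans _ _ (expR 1 * n%:R ^+ n * Num.sqrt n%:R * n%:R)); first by rewrite ler_pM2r.
  by rewrite exprSr; apply: le_of_eq; ring.
have h2 : c0 ^+ 2 * n%:R `^ (- alpha) <= lam n ^+ 2.
  have -> : c0 ^+ 2 * n%:R `^ (- alpha) = (c0 * n%:R `^ (- (alpha / 2))) ^+ 2.
    rewrite exprMn -[(n%:R `^ _) ^+ 2]powR_mulrn ?powR_ge0// -powRrM.
    by congr (_ * _ `^ _); field.
  by apply: lerXn2r (hc0 n n0); rewrite nnegrE ?(ltW l0)// mulr_ge0 ?powR_ge0 ?(ltW c00).
have ss : Num.sqrt n%:R = n%:R `^ 2^-1 :> R by rewrite powR12_sqrt// ltW.
have pe : n%:R `^ ((e + 1 - alpha) / 2) =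
   n%:R `^ (- alpha) * n%:R / (n%:R `^ 2^-1 * n%:R `^ (- ((alpha + e) / 2))).
  rewrite -(powRD_gt0 _ _ n0')// -[X in _ * X / _](powRr1 (ltW n0')).
  rewrite -(powRD_gt0 _ _ n0')// -powRN -(powRD_gt0 _ _ n0')//.
  by congr (_ `^ _); field.
rewrite /bulk_gain /bulk_bound qE pe -ss.
set D := n%:R `^ (- ((alpha + e) / 2)); set E := expR n%:R; set A := n%:R `^ (- alpha) in h2 *.
have D0 : 0 < D by rewrite powR_gt0.
have E0 : 0 < E by rewrite expR_gt0.
have e10 : 0 < expR 1 :> R by rewrite expR_gt0.
rewrite ler_pdivlMr; last by rewrite !mulr_gt0.
have -> : (Gamma1 alpha)^-1 * c0 ^+ 2 / (2 * B * expR 1) * (A * n%:R / (Num.sqrt n%:R * D)) *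
   (2 * (B * (E * D))) = (Gamma1 alpha)^-1 * (c0 ^+ 2 * A) / n`!%:R *
    ((n`!%:R * E * n%:R) / (expR 1 * Num.sqrt n%:R)).
  by field; rewrite !gt_eqF.
have -> : (Gamma1 alpha)^-1 * lam n * (lam n / n`!%:R * n%:R ^+ n.+1) =
   (Gamma1 alpha)^-1 * lam n ^+ 2 / n`!%:R * n%:R ^+ n.+1.
  by field; rewrite !gt_eqF.
apply: ler_pM.
- by rewrite !mulr_ge0 ?invr_ge0 ?(ltW G0) ?(ltW c00) ?powR_ge0.
- by rewrite divr_ge0 ?mulr_ge0 ?(ltW E0) ?(ltW n0') ?(ltW e10) ?sqrtr_ge0.
- by rewrite ler_pM2r ?invr_gt0// ler_pM2l ?invr_gt0.
- by rewrite ler_pdivrMr ?mulr_gt0//; apply: le_trans h1 _; rewrite mulrCA mulrA mulrC mulrA mulrC.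
Qed.

Definition op_lower (p : \bar R) (f : nat -> R) (k : R) := forall n, (0 < n)%N ->
  ((k * normc (c n n) * f n)%:E <= op_norm alpha M b p (T n))%E.

Lemma op_lower_weaken p f k k' : (forall n, 0 <= f n) -> k' <= k ->
  op_lower p f k -> op_lower p f k'.
Proof.
move=> f0 kk h n n0; apply: le_trans (h n n0); rewrite lee_fin.
by apply: ler_wpM2r => //; apply: ler_wpM2r => //; exact: normc_ge0.
Qed.

Lemma op_bound_of_gain (r B C0 Cw : R) (rate : nat -> R) : 0 < r -> 0 < B -> 0 < C0 -> 0 < Cw ->
  (forall n, (0 < n)%N -> 0 < rate n) -> exists k, 0 < k /\ forall n, (0 < n)%N ->
  k * normc (c n n) * (n%:R `^ (- (alpha / 2) + (e + 1) * (r^-1 - 2^-1)) / rate n) <=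
  normc (c n n) * bulk_gain B n * (Cw * n%:R `^ (e + 1)) `^ (r^-1 - 1) / (C0 * rate n).
Proof.
move=> r0 B0 C00 Cw0 rate0; have [k [k0 hk]] := bulk_gain_ge B0.
exists (k * Cw `^ (r^-1 - 1) / C0); split; first by rewrite divr_gt0// mulr_gt0// powR_gt0.
move=> n n0; have n0' : 0 < n%:R :> R by rewrite ltr0n.
have rn := rate0 n n0; have y0 : 0 < C0 * rate n by rewrite mulr_gt0.
apply: (@le_trans _ _ (normc (c n n) * (k * n%:R `^ ((e + 1 - alpha) / 2)) *
   (Cw * n%:R `^ (e + 1)) `^ (r^-1 - 1) / (C0 * rate n))); last first.
  rewrite ler_pM2r ?invr_gt0// ler_wpM2r ?powR_ge0// ler_pM2l ?hc//.
  exact: hk.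
have -> : n%:R `^ (- (alpha / 2) + (e + 1) * (r^-1 - 2^-1)) =
  n%:R `^ ((e + 1 - alpha) / 2) * n%:R `^ ((e + 1) * (r^-1 - 1)).
  by rewrite -(powRD_gt0 _ _ n0')//; congr (_ `^ _); field; rewrite gt_eqF.
rewrite [(Cw * _) `^ _]powRM ?powR_ge0 ?(ltW Cw0)// -powRrM; apply: le_of_eq.
by field; rewrite !gt_eqF.
Qed.

Lemma op_norm_primal (r : R) (J : nat) (rate : nat -> R) : 1 <= r < 2 -> (N < J)%N ->
  (forall n, (0 < n)%N -> 0 < rate n) -> dual_family alpha e r J rate ->
  exists k, 0 < k /\
  op_lower r%:E (fun n => n%:R `^ (- (alpha / 2) + (e + 1) * (r^-1 - 2^-1)) / rate n) k.
Proof.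
move=> r12 NJ rate0 [C0 [C00 fam]]; have /andP[r1 r2] := r12.
have r0 : 0 < r by exact: lt_le_trans r1.
have J0 : (0 < J)%N by exact: leq_ltn_trans NJ.
have G0 := Gamma1_gt0 a1.
have [[B m] /= [B0 hB]] := bulk_fun_ind_le.
have [Cw [Cw0 hCw]] := bulk_mass wexp_gtN1.
have [k [k0 hk]] := op_bound_of_gain r0 B0 C00 Cw0 rate0.
exists k; split=> // n n0; have n0' : 0 < n%:R :> R by rewrite ltr0n.
have [g [gd gy]] := fam n n0.
have rn := rate0 n n0; have y0 : 0 < C0 * rate n by rewrite mulr_gt0.
have l0 := norm_lead_gt0 a1 hM hQ n.
have qn0 : 0 < `|(q n)`_n|.
  by move: l0; rewrite /norm_lead pmulr_rgt0// ltr0n fact_gt0.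
have Bn0 := bulk_bound_gt0 B0 n0.
pose u := horner ('X^J * g).
pose z := fun k => c k n * fourier_coef alpha M q (toC u) k.
have [P [sP Pn hP]] := csum_re_lead n z (size_orthonormal a1 hM hQ).
have zn : normc (z n) = normc (c n n) * ((Gamma1 alpha)^-1 * lam n).
  by rewrite /z normcM fourier_coef_XnM.
have z0 : 0 < normc (z n).
  by rewrite zn; apply: mulr_gt0 (hc n) _; apply: mulr_gt0 l0; rewrite invr_gt0.
have W0 : 0 < Cw * n%:R `^ (e + 1) by rewrite mulr_gt0// powR_gt0.
pose Z := `|P`_n| * n%:R ^+ n.+1.
have ZE : Z / (2 * bulk_bound B n) = normc (c n n) * bulk_gain B n.
  rewrite /Z Pn normrM (gtr0_norm z0) zn /bulk_gain.
  by field; rewrite !gt_eqF.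
have Z0 : 0 < Z.
  rewrite /Z Pn normrM (gtr0_norm z0); apply: mulr_gt0; last exact: exprn_gt0.
  exact: mulr_gt0.
have mG : measurable_fun pos (bulk_fun alpha n m).
  by apply: (measurable_funS measurableT) => //; exact: measurable_bulk_fun.
have lowP := pnorm_ge_bounded r1 Z0 Bn0 W0 mG (@measurable_horner R P pos)
  (@measurable_bulk_ind n) (fun x _ => bulk_ind01 n x) (fun x _ => hB n x n0) (hCw n n0)
  (pairing_bulk_ge m n0 sP).
have mT : measurable_fun pos (fun x => normc (T n (toC u) x)).
  apply: measurable_normc.
    rewrite (_ : Re_fun _ = horner (csum_re n z q 1)); first exact: measurable_horner.
    by apply/funext => x; rewrite /Re_fun sobolev_opE Re_csum.
  rewrite (_ : Im_fun _ = horner (csum_re n z q (0 -i* 1)%C)); first exact: measurable_horner.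
  by apply/funext => x; rewrite /Im_fun sobolev_opE Im_csum.
have zT : ((Z / (2 * bulk_bound B n) * (Cw * n%:R `^ (e + 1)) `^ (r^-1 - 1))%:E <=
    Lp_norm alpha b r%:E (T n (toC u)))%E.
  have ZB0 : 0 <= Z / (2 * bulk_bound B n).
    by apply: divr_ge0 (ltW Z0) _; apply: mulr_ge0 (ltW Bn0).
  apply: (@Lp_norm_fin_ge R alpha b r _ (horner P)) => //.
  - exact: mulr_ge0 ZB0 (powR_ge0 _ _).
  - rewrite (powRM _ ZB0 (powR_ge0 _ _)) -powRrM mulrBl mulVf ?gt_eqF// mul1r.
    exact: lowP.
  - apply: le_pnorm (ltW r0) (@measurable_horner R P pos) mT _.
    by move=> x _; rewrite (ger0_norm (normc_ge0 _)) sobolev_opE; exact: hP.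
have nu : (fun x => normc (toC u x)) = (fun x => `|u x|).
  by apply/funext => x; rewrite /= expr0n addr0 sqrtr_sqr.
have pnu : pn r (fun x => normc (toC u x)) = pn r u.
  by rewrite nu; apply: eq_integral => x _; rewrite normr_id.
have vr : valid_exponent r%:E by right; exists r.
have Lu : (Lp_norm alpha b r%:E (toC u) <= (C0 * rate n)%:E)%E.
  by apply: (Lp_norm_fin_le r0 (ltW y0)); rewrite pnu.
have Lu0 : (0 < Lp_norm alpha b r%:E (toC u))%E.
  rewrite Lp_norm_fin pnu; apply: poweR_gt0; apply: (pnorm_poly_gt0 r1).
  have g0 : g != 0.
    apply: contraTneq l0 => g0; rewrite -(Lint_coef_dual a1 hM hQ NJ gd) g0 mul0r.
    by rewrite (Lint0 (gtN1_addn a1 J)) normr0 ltxx.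
  by rewrite mulrC (size_mulXn _ g0) -(addn1 1) leq_add// size_poly_gt0.
have mu' : measurable_fun (setT : set (measurableTypeR R)) u by exact: measurable_horner.
apply: le_trans (op_norm_ge hM vr mu' (flat0_XnM g NJ) y0 _ Lu Lu0 zT); last first.
  apply: mulr_ge0 (powR_ge0 _ _); apply: divr_ge0 (ltW Z0) _.
  by apply: mulr_ge0 (ltW Bn0).
rewrite lee_fin ZE.
exact: hk.
Qed.
Lemma op_norm_dual (p : \bar R) (r : R) (J : nat) (rate : nat -> R) : 1 <= r < 2 -> (N < J)%N ->
  dual_exponent p r ->
  (forall n, (0 < n)%N -> 0 < rate n) -> dual_family alpha e r J rate ->
  exists k, 0 < k /\
  op_lower p (fun n => n%:R `^ (- (alpha / 2) + (e + 1) * (r^-1 - 2^-1)) / rate n) k.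
Proof.
move=> r12 NJ pr rate0 [C0 [C00 fam]]; have /andP[r1 r2] := r12.
have r0 : 0 < r by exact: lt_le_trans r1.
have J0 : (0 < J)%N by exact: leq_ltn_trans NJ.
have G0 := Gamma1_gt0 a1.
have [[B m] /= [B0 hB]] := bulk_fun_ind_le.
have [Cw [Cw0 hCw]] := bulk_mass wexp_gtN1.
have [k [k0 hk]] := op_bound_of_gain r0 B0 C00 Cw0 rate0.
exists k; split=> // n n0; have n0' : 0 < n%:R :> R by rewrite ltr0n.
have [g [gd gy]] := fam n n0.
have rn := rate0 n n0; have y0 : 0 < C0 * rate n by rewrite mulr_gt0.
have l0 := norm_lead_gt0 a1 hM hQ n.
have qn0 : 0 < `|(q n)`_n|.
  by move: l0; rewrite /norm_lead pmulr_rgt0// ltr0n fact_gt0.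
have Bn0 := bulk_bound_gt0 B0 n0.
have W0 : 0 < Cw * n%:R `^ (e + 1) by rewrite mulr_gt0// powR_gt0.
pose u := bulk_fun alpha n m.
have mu' : measurable_fun (setT : set (measurableTypeR R)) u by exact: measurable_bulk_fun.
have mup : measurable_fun pos u by exact: (measurable_funS measurableT).
have Lu := Lp_norm_bounded_le pr Bn0 W0 mup (@measurable_bulk_ind n)
  (fun x _ => bulk_ind01 n x) (fun x _ => hB n x n0) (hCw n n0).
pose Y := bulk_bound B n * (Cw * n%:R `^ (e + 1)) `^ (1 - r^-1).
have Y0 : 0 < Y by apply: mulr_gt0 => //; exact: powR_gt0.
have nu x : normc (toC u x) = `|u x| by rewrite /= expr0n addr0 sqrtr_sqr.
(* G pairs nontrivially with X^n, hence has positive norm. *)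
have Lu0 : (0 < Lp_norm alpha b p (toC u))%E.
  have [y1 [y10 hy1]] := pnorm_XnM_fin a1 wexp_gtN1 'X^(n.-1) r12 (ltn0Sn 0).
  have XE : 'X^1 * 'X^(n.-1) = 'X^n :> {poly R} by rewrite -exprD add1n prednK.
  rewrite XE in hy1.
  have sX : (size ('X^n : {poly R}) <= n.+1)%N by rewrite size_polyXn.
  have ZX := pairing_bulk_ge m n0 sX.
  have Z0 : 0 < `|('X^n : {poly R})`_n| * n%:R ^+ n.+1.
    by rewrite coefXn eqxx normr1 mul1r exprn_gt0.
  have := Lp_norm_dual_ge pr y10 Z0 mup (@measurable_horner R _ pos) nu hy1 ZX.
  by apply: lt_le_trans; rewrite lte_fin divr_gt0// mulr_gt0.
pose s := normc (c n n) * ((Gamma1 alpha)^-1 *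
     (`|(q n)`_n| * (n%:R ^+ n * chebInt (bulk_ctr R n) (bulk_rad R n) 1))).
(* The lower bound n replaces the value of [chebInt], so that the same [bulk_gain] appears as for p
   < 2. *)
pose s' := normc (c n n) * ((Gamma1 alpha)^-1 * (`|(q n)`_n| * n%:R ^+ n.+1)).
have s'0 : 0 < s'.
  apply: mulr_gt0 (hc n) _; apply: mulr_gt0; first by rewrite invr_gt0.
  by apply: mulr_gt0 => //; exact: exprn_gt0.
have ss' : s' <= s.
  rewrite /s /s' ler_pM2l ?hc// ler_pM2l ?invr_gt0// ler_pM2l// exprSr ler_pM2l ?exprn_gt0//.
  exact: bulk_chebInt1.
pose Z := s' * lam n; have Z0 : 0 < Z by exact: mulr_gt0.
have ZP : (Z%:E <= pairing alpha (horner (s *: q n)) (horner ('X^J * g)))%E.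
  apply: le_trans (pairing_XnM_ge J g (s *: q n)).
  rewrite -scalerAr (LintZ (gtN1_addn a1 J)) normrM (Lint_coef_dual a1 hM hQ NJ gd) lee_fin.
  by rewrite ler_pM2r// (le_trans ss')// ler_norm.
have zT : ((Z / (2 * (C0 * rate n)))%:E <= Lp_norm alpha b p (T n (toC u)))%E.
  apply: Lp_norm_dual_ge pr y0 Z0 (@measurable_horner R (s *: q n) pos)
    (@measurable_horner R ('X^J * g) pos) _ gy ZP.
  by move=> x; rewrite sobolev_op_bulk.
have vp := dual_exponent_valid pr.
apply: le_trans (op_norm_ge hM vp mu' (flat0_bulk n m) Y0 _ Lu Lu0 zT); last first.
  by apply: divr_ge0 (ltW Z0) _; apply: mulr_ge0 (ltW y0).
rewrite lee_fin.
have -> : Z / (2 * (C0 * rate n)) / Y =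
    normc (c n n) * bulk_gain B n * (Cw * n%:R `^ (e + 1)) `^ (r^-1 - 1) / (C0 * rate n).
  rewrite -[r^-1 - 1]opprB powRN /Z /s' /bulk_gain /Y.
  by field; rewrite !gt_eqF// powR_gt0.
exact: hk.
Qed.

Lemma op_norm_lower p r J rate : 1 <= r < 2 -> (N < J)%N -> p = r%:E \/ dual_exponent p r ->
  (forall n, (0 < n)%N -> 0 < rate n) -> dual_family alpha e r J rate ->
  exists k, 0 < k /\
  op_lower p (fun n => n%:R `^ (- (alpha / 2) + (e + 1) * (r^-1 - 2^-1)) / rate n) k.
Proof.
by move=> r12 NJ [->|pr] rate0 fam; [exact: op_norm_primal fam|exact: op_norm_dual fam].
Qed.

Lemma op_lower_power p r : 1 <= r < 2 -> p = r%:E \/ dual_exponent p r -> exists k, 0 < k /\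
  op_lower p (fun n => n%:R `^ ((2 * e + 2) * r^-1 - (2 * e + 3) / 2)) k.
Proof.
move=> r12 pr; have J0 : (0 < N.+2)%N by [].
have rate0 n : (0 < n)%N -> 0 < n%:R `^ ((1 - alpha) / 2 - (e + 1) * (r^-1 - 2^-1)).
  by move=> n0; rewrite powR_gt0// ltr0n.
have [k [k0 hk]] := op_norm_lower r12 (ltnW (ltnSn N.+1)) pr rate0 (dual_family_power a1 wexp_gtN1 r12 J0).
exists k; split=> // n n0; apply: le_trans (hk n n0); rewrite lee_fin.
have n0' : 0 < n%:R :> R by rewrite ltr0n.
rewrite -powRN -(powRD_gt0 _ _ n0')//; apply: le_of_eq.
congr (_ * _ `^ _); field; rewrite gt_eqF//.
by case/andP: r12 => r1 _; exact: lt_le_trans r1.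
Qed.

Lemma op_lower_log p r : - 2^-1 < e -> r = (4 * e + 4) / (2 * e + 3) ->
  p = r%:E \/ p = ((4 * e + 4) / (2 * e + 1))%:E -> exists k, 0 < k /\
  op_lower p (fun n => ln (n.+1)%:R `^ ((2 * e + 1) / (4 * e + 4))) k.
Proof.
(* J = N + 2 exceeds N and is at least 2, as [log_wgt_le] demands. *)
move=> e12 rE pE; have J2 : (2 <= N.+2)%N by [].
have d3 : 0 < 2 * e + 3 by move: e12 => ?; lra.
have d4 : 0 < 4 * e + 4 by move: e12 => ?; lra.
have d1 : 0 < 2 * e + 1 by move: e12 => ?; lra.
have r12 : 1 <= r < 2.
  by rewrite rE ler_pdivlMr// ltr_pdivrMr//; move: e12 => ?; apply/andP; split; lra.
have L0 n : (0 < n)%N -> 0 < ln (n.+1)%:R :> R by move=> n0; rewrite ln_gt0// ltr1n.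
pose rate n : R := n%:R `^ (4^-1 - alpha / 2) * ln (n.+1)%:R `^ (- ((2 * e + 1) / (4 * e + 4))).
have rate0 n : (0 < n)%N -> 0 < rate n by move=> n0; rewrite mulr_gt0 ?powR_gt0 ?ltr0n// L0.
have fam : dual_family alpha e r N.+2 rate by rewrite rE; exact: (dual_family_log a1 wexp_gtN1 e12 J2).
have pr : p = r%:E \/ dual_exponent p r.
  case: pE => ->; [by left|right; right; split].
    by rewrite rE ltr_pdivlMr//; move: e12 => ?; lra.
  have -> : r - 1 = (2 * e + 1) / (2 * e + 3) by rewrite rE; field; rewrite gt_eqF.
  by congr (_%:E); rewrite rE; field; rewrite !gt_eqF.
have [k [k0 hk]] := op_norm_lower r12 (ltnW (ltnSn N.+1)) pr rate0 fam.
exists k; split=> // n n0; apply: le_trans (hk n n0); rewrite lee_fin /rate.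
have n0' : 0 < n%:R :> R by rewrite ltr0n.
have -> : - (alpha / 2) + (e + 1) * (r^-1 - 2^-1) = 4^-1 - alpha / 2.
  by rewrite rE; field; rewrite !gt_eqF.
rewrite powRN; apply: le_of_eq.
have := L0 n n0; set l := ln _ => l0.
by field; rewrite !gt_eqF ?powR_gt0.
Qed.

Lemma op_lower_all p : (1 <= p)%E -> - 2^-1 < e ->
  let p0 := (4 * e + 4) / (2 * e + 3) in let q0 := (4 * e + 4) / (2 * e + 1) in
  let invp := fine (p^-1)%E in
  exists k, 0 < k /\
  [/\ (p < p0%:E)%E -> op_lower p (fun n => n%:R `^ ((2 * e + 2) * invp - (2 * e + 3) / 2)) k,
      p = p0%:E \/ p = q0%:E -> op_lower p (fun n => ln (n.+1)%:R `^ ((2 * e + 1) / (4 * e + 4))) k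
    & (q0%:E < p)%E -> op_lower p (fun n => n%:R `^ ((2 * e + 1) / 2 - (2 * e + 2) * invp)) k].
Proof.
move=> hp e12 p0 q0 invp.
have d3 : 0 < 2 * e + 3 by move: e12 => ?; lra.
have d4 : 0 < 4 * e + 4 by move: e12 => ?; lra.
have d1 : 0 < 2 * e + 1 by move: e12 => ?; lra.
have p02 : p0 < 2 by rewrite ltr_pdivrMr//; move: e12 => ?; lra.
have q02 : 2 < q0 by rewrite ltr_pdivlMr//; move: e12 => ?; lra.
have [k1 [k10 h1]] : exists k, 0 < k /\ ((p < p0%:E)%E ->
    op_lower p (fun n => n%:R `^ ((2 * e + 2) * invp - (2 * e + 3) / 2)) k).
  (* Outside its range of p a clause is vacuous and any constant serves; the minimum of the three is
     taken at the end. *)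
  have [pp|pp] := pselect (p < p0%:E)%E; last by exists 1.
  move: hp pp; rewrite /invp; case: (p) => [r| |]//.
  rewrite lee_fin lte_fin => r1 rp0; have r12 : 1 <= r < 2 by rewrite r1 (lt_trans rp0).
  rewrite fine_invr; have [k [k0 hk]] := op_lower_power r12 (or_introl (erefl r%:E)).
  by exists k.
have [k2 [k20 h2]] : exists k, 0 < k /\ (p = p0%:E \/ p = q0%:E ->
    op_lower p (fun n => ln (n.+1)%:R `^ ((2 * e + 1) / (4 * e + 4))) k).
  have [pp|pp] := pselect (p = p0%:E \/ p = q0%:E); last by exists 1.
  by have [k [k0 hk]] := op_lower_log e12 erefl pp; exists k.
have [k3 [k30 h3]] : exists k, 0 < k /\ ((q0%:E < p)%E ->
    op_lower p (fun n => n%:R `^ ((2 * e + 1) / 2 - (2 * e + 2) * invp)) k).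
  have [pp|pp] := pselect (q0%:E < p)%E; last by exists 1.
  (* Substituting 1/r = 1 - 1/p turns (2 e + 2) / r - (2 e + 3) / 2 into the exponent of this range.
     At p = oo, [invp] is 0 and r = 1. *)
  have [r [r12 pr ri]] : exists r, [/\ 1 <= r < 2, dual_exponent p r & r^-1 = 1 - invp].
    move: hp pp; rewrite /invp; case: (p) => [P| |]//; last first.
      move=> _ _; exists 1; rewrite lexx ltr1n invey /= subr0 invr1; split=> //.
      by left.
    rewrite lee_fin lte_fin fine_invr => P1 qP.
    have P2 : 2 < P by exact: lt_trans qP.
    have P10 : 0 < P - 1 by move: P2 => ?; lra.
    have P0 : 0 < P by move: P2 => ?; lra.
    exists (P / (P - 1)); split.
    - by rewrite ler_pdivlMr// ltr_pdivrMr//; move: P2 => ?; apply/andP; split; lra.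
    - right; split; first by rewrite ltr_pdivlMr//; lra.
      have -> : P / (P - 1) - 1 = (P - 1)^-1 by field; rewrite gt_eqF.
      by congr (_%:E); field; rewrite gt_eqF.
    - by field; rewrite !gt_eqF.
  have [k [k0 hk]] := op_lower_power r12 (or_intror pr); exists k; split=> // _ n n0.
  have := hk n n0; rewrite ri; apply: le_trans; rewrite lee_fin; apply: le_of_eq.
  by congr (_ * _ `^ _); field.
exists (Num.min k1 (Num.min k2 k3)); split; first by rewrite !lt_min k10 k20.
split=> h.
- apply: op_lower_weaken (h1 h) => [n|]; first exact: powR_ge0.
  by rewrite ge_min lexx.
- apply: op_lower_weaken (h2 h) => [n|]; first exact: powR_ge0.
  by rewrite !ge_min lexx orbT.
- apply: op_lower_weaken (h3 h) => [n|]; first exact: powR_ge0.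
  by rewrite !ge_min lexx !orbT.
Qed.

End OperatorBounds.

Theorem theorem1 (R : realType) (p : \bar R) (hp : (1 <= p)%E)
    (alpha : R) (halpha : -1 < alpha)
    (N : nat) (M : 'I_N.+1 -> R) (hM : forall j, 0 <= M j)
    (L Q : nat -> {poly R})
    (hL : laguerre_polys alpha L) (hQ : sobolev_polys alpha M L Q)
    (c : nat -> nat -> R[i]) (hc : forall n, 0 < normc (c n n)) :
  let q := sobolev_orthonormal alpha M Q in
  let T := sobolev_op alpha M q c in
  let invp : R := fine (p^-1)%E in
  exists C : R, 0 < C /\ forall n : nat, (1 <= n)%N ->
    (* (i) *)
    (- (1 / 2) < alpha -> forall p0 q0 : R,
       q0 = (4 * alpha + 4) / (2 * alpha + 1) -> 1 / p0 + 1 / q0 = 1 ->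
       [/\ (p < p0%:E)%E ->
             ((C * normc (c n n) *
               n%:R `^ ((2 * alpha + 2) * invp - (2 * alpha + 3) / 2))%:E
              <= op_norm alpha M BetaAlpha p (T n))%E,
           p = p0%:E \/ p = q0%:E ->
             ((C * normc (c n n) *
               ln (n.+1)%:R `^ ((2 * alpha + 1) / (4 * alpha + 4)))%:E
              <= op_norm alpha M BetaAlpha p (T n))%E
         & (q0%:E < p)%E ->
             ((C * normc (c n n) *
               n%:R `^ ((2 * alpha + 1) / 2 - (2 * alpha + 2) * invp))%:E
              <= op_norm alpha M BetaAlpha p (T n))%E])
    /\
    (* (ii) *)
    (((p < +oo)%E -> - 2 * invp < alpha) -> (p = +oo%E -> 0 <= alpha) ->
       [/\ (p < (4 / 3)%:E)%E ->
             ((C * normc (c n n) * n%:R `^ (2 * invp - 3 / 2))%:E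
              <= op_norm alpha M BetaHalf p (T n))%E,
           p = (4 / 3)%:E \/ p = 4%:E ->
             ((C * normc (c n n) * ln (n.+1)%:R `^ (1 / 4))%:E
              <= op_norm alpha M BetaHalf p (T n))%E
         & (4%:E < p)%E ->
             ((C * normc (c n n) * n%:R `^ (1 / 2 - 2 * invp))%:E
              <= op_norm alpha M BetaHalf p (T n))%E]).
Proof.
move=> q T invp.
(* C has to be chosen before alpha > -1/2 is assumed, so the condition is kept inside. *)
have [k1 [k10 hk1]] : exists k, 0 < k /\ (- (1 / 2) < alpha ->
    let p0 := (4 * alpha + 4) / (2 * alpha + 3) in let q0 := (4 * alpha + 4) / (2 * alpha + 1) in
    [/\ (p < p0%:E)%E -> op_lower alpha BetaAlpha M Q c p
          (fun n => n%:R `^ ((2 * alpha + 2) * invp - (2 * alpha + 3) / 2)) k,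
        p = p0%:E \/ p = q0%:E -> op_lower alpha BetaAlpha M Q c p
          (fun n => ln (n.+1)%:R `^ ((2 * alpha + 1) / (4 * alpha + 4))) k
      & (q0%:E < p)%E -> op_lower alpha BetaAlpha M Q c p
          (fun n => n%:R `^ ((2 * alpha + 1) / 2 - (2 * alpha + 2) * invp)) k]).
  have [a12|a12] := pselect (- (1 / 2) < alpha); last by exists 1.
  have e12 : - 2^-1 < wexp alpha BetaAlpha by rewrite -div1r.
  by have [k [k0 hk]] := op_lower_all halpha hM hL hQ hc hp e12; exists k.
(* Here e = 0, so the general critical exponents become 4/3 and 4 and the power of the logarithm
   1/4. *)
have e12 : - 2^-1 < wexp alpha BetaHalf by rewrite oppr_lt0 invr_gt0.
have [k2 [k20 [h1 h2 h3]]] := op_lower_all halpha hM hL hQ hc hp e12.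
exists (Num.min k1 k2); split; first by rewrite lt_min k10.
have min1 : Num.min k1 k2 <= k1 by rewrite ge_min lexx.
have min2 : Num.min k1 k2 <= k2 by rewrite ge_min lexx orbT.
have p0E : 4 / 3 = (4 * 0 + 4) / (2 * 0 + 3) :> R by field.
have q0E : 4 = (4 * 0 + 4) / (2 * 0 + 1) :> R by field.
move=> n n0; split.
  move=> a12 p0 q0 q0E' pq.
  have d1 : 0 < 2 * alpha + 1 by lra.
  have d3 : 0 < 2 * alpha + 3 by lra.
  have d4 : 0 < 4 * alpha + 4 by lra.
  have p0E' : p0 = (4 * alpha + 4) / (2 * alpha + 3).
    have e1 : 1 / p0 = (2 * alpha + 3) / (4 * alpha + 4).
      apply/eqP; rewrite -(addrK (1 / q0) (1 / p0)) pq q0E'; apply/eqP.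
      by field; rewrite !gt_eqF.
    by rewrite -[LHS]invrK -[p0^-1]div1r e1 invf_div.
  have [g1 g2 g3] := hk1 a12; rewrite p0E' q0E'; split=> h.
  - exact: (op_lower_weaken (fun=> powR_ge0 _ _) min1 (g1 h)).
  - exact: (op_lower_weaken (fun=> powR_ge0 _ _) min1 (g2 h)).
  - exact: (op_lower_weaken (fun=> powR_ge0 _ _) min1 (g3 h)).
move=> _ _; split=> h.
- rewrite (_ : 2 * invp - 3 / 2 = (2 * 0 + 2) * invp - (2 * 0 + 3) / 2); last by rewrite mulr0 !add0r.
  by apply: (op_lower_weaken (fun=> powR_ge0 _ _) min2 (h1 _)) => //; rewrite -p0E.
- rewrite (_ : 1 / 4 = (2 * 0 + 1) / (4 * 0 + 4)); last by rewrite !mulr0 !add0r.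
  apply: (op_lower_weaken (fun=> powR_ge0 _ _) min2 (h2 _)) => //.
  by rewrite -p0E -q0E.
- rewrite (_ : 1 / 2 - 2 * invp = (2 * 0 + 1) / 2 - (2 * 0 + 2) * invp); last by rewrite mulr0 !add0r.
  by apply: (op_lower_weaken (fun=> powR_ge0 _ _) min2 (h3 _)) => //; rewrite -q0E.
Qed.
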